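(* Let $G$ be a finite group, $R\in\mathrm{CAlg}(\mathrm{Sp}_G)$, and let $\underline S\subseteq\underline\pi_0R$ be a multiplicatively closed $G$-subset satisfying the torsion-extension condition: for every $H\le G$ and every $a\in S_H$ there exists $r\in\pi_0^HR$ such that $r\cdot a\in\mathrm{Res}^G_HS_G$. Then $L_{\underline S^{-1}}R$ exists and the canonical map $S_G^{-1}R\to L_{\underline S^{-1}}R$ is an equivalence. Furthermore, in this case, for every $K\le G$ one has $\mathrm{Res}^G_KS_G^{-1}R\simeq S_K^{-1}\mathrm{Res}^G_KR$.
   Context: ''Category'' means $\infty$-category. $\mathrm{Sp}_G$ is the category of genuine $G$-spectra and $\mathrm{CAlg}(\mathrm{Sp}_G)$ the category of $\mathbb E_\infty$-rings in it (no multiplicative norms); $\pi_0^HR=\pi_0R^H$ and $\underline\pi_0R$ is the zeroth homotopy Mackey functor. $\mathrm{Res}^G_K\colon\mathrm{Sp}_G\to\mathrm{Sp}_K$ is restriction. A $G$-subset $\underline S=\{S_H\}_{H\le G}$ of $\underline\pi_0R$ consists of subsets with $\mathrm{Res}^G_HS_G\subseteq S_H\subseteq\pi_0^HR$ for all $H\le G$. For $A\in\mathrm{CAlg}(\mathrm{Sp}_G)$, let $\mathrm{Map}^{\underline S^{-1}}(R,A)$ (resp. $\mathrm{Map}^{S_G^{-1}}(R,A)$) be the union of components of $\mathrm{Map}_{\mathrm{CAlg}(\mathrm{Sp}_G)}(R,A)$ consisting of maps sending $S_H$ to units of $\pi_0^HA$ for all $H\le G$ (resp. sending $S_G$ to units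 of $\pi_0^GA$). The second functor of $A$ is corepresented by the telescopic localisation $S_G^{-1}R$, with $\underline\pi_\star S_G^{-1}R\cong S_G^{-1}\underline\pi_\star R$. $S_K^{-1}\mathrm{Res}^G_KR$ is likewise the telescopic localisation in $\mathrm{CAlg}(\mathrm{Sp}_K)$ of $\mathrm{Res}^G_KR$ at $S_K\subseteq\pi_0^KR$. If the first functor is corepresentable, the corepresenting object is denoted $L_{\underline S^{-1}}R$, and one says it exists; the inclusion $\mathrm{Map}^{\underline S^{-1}}(R,-)\subseteq\mathrm{Map}^{S_G^{-1}}(R,-)$ then corresponds to the canonical map $S_G^{-1}R\to L_{\underline S^{-1}}R$ in $\mathrm{CAlg}(\mathrm{Sp}_G)$. *)

(* Defs.v *)
(* A point-set model of the infinity-category CAlg(Sp_G), G a finite group.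

   - Sp_G is modelled by G-symmetric spectra of simplicial sets, evaluated on
     finite H-sets for H <= G; the fibrant objects of the stable model
     structure are the genuine G-Omega-spectra.
   - An E_oo-ring is an algebra over the Barratt-Eccles operad, on which G acts
     trivially (so that there are no multiplicative norms).
   - The infinity-category is the simplicial category of bifibrant algebras:
     its mapping spaces are Kan complexes, and equivalence means homotopy
     equivalence in the simplicial category.
   - pi_0^H X is the set of components of the H-fixed points of the zeroth space
     of the Omega-spectrum X.  It is a commutative ring, of which only the
     multiplication is needed here. *)

From HB Require Import structures.
From mathcomp Require Import all_boot all_fingroup.
From mathcomp Require Import boolp.
From Stdlib Require Import Relation_Operators.
Set Implicit Arguments.
Unset Strict Implicit.
Unset Printing Implicit Defensive.

Definition monob m n (f : {ffun 'I_m.+1 -> 'I_n.+1}) : bool :=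
  [forall i : 'I_m.+1, forall j : 'I_m.+1, (i <= j) ==> (f i <= f j)].

Record dmap m n := DMap { dfun : {ffun 'I_m.+1 -> 'I_n.+1}; _ : monob dfun }.
Definition dmap_fun m n (f : dmap m n) : 'I_m.+1 -> 'I_n.+1 := fun i => dfun f i.
Coercion dmap_fun : dmap >-> Funclass.

Lemma dmapP m n (f g : dmap m n) : f =1 g -> f = g.
Proof.
case: f g => f fP [g gP] fg.
have efg : f = g by apply/ffunP => i; exact: fg.
by subst g; congr DMap; apply: bool_irrelevance.
Qed.

Lemma dmap_mono m n (f : dmap m n) (i j : 'I_m.+1) : i <= j -> f i <= f j.
Proof. by case: f => f /= fP; exact: implyP (forallP (forallP fP i) j). Qed.

Lemma dmk_proof m n (f : 'I_m.+1 -> 'I_n.+1) :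
  (forall i j : 'I_m.+1, i <= j -> f i <= f j) -> monob [ffun i => f i].
Proof.
by move=> fP; apply/forallP => i; apply/forallP => j; apply/implyP; rewrite !ffunE; apply: fP.
Qed.

Definition dmk m n f fP : dmap m n := DMap (@dmk_proof m n f fP).

Definition did n : dmap n n := @dmk n n id (fun _ _ ij => ij).

Definition dcomp l m n (g : dmap m n) (f : dmap l m) : dmap l n :=
  @dmk l n (fun i => g (f i)) (fun i j ij => dmap_mono g (dmap_mono f ij)).

Definition dcst m n (j : 'I_n.+1) : dmap m n :=
  @dmk m n (fun _ => j) (fun _ _ _ => leqnn j).

Lemma dcompE l m n (g : dmap m n) (f : dmap l m) i : dcomp g f i = g (f i).
Proof. exact: ffunE. Qed.

Lemma dcstE m n j i : @dcst m n j i = j.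
Proof. exact: ffunE. Qed.

Lemma didE n i : did n i = i.
Proof. exact: ffunE. Qed.

Lemma dcomp1 m n (f : dmap m n) : dcomp f (did m) = f.
Proof. by apply: dmapP => i; rewrite dcompE didE. Qed.

Lemma d1comp m n (f : dmap m n) : dcomp (did n) f = f.
Proof. by apply: dmapP => i; rewrite dcompE didE. Qed.

Lemma dcompA k l m n (h : dmap m n) (g : dmap l m) (f : dmap k l) :
  dcomp h (dcomp g f) = dcomp (dcomp h g) f.
Proof. by apply: dmapP => i; rewrite !dcompE. Qed.

Lemma dcst_comp l m n j (f : dmap l m) : dcomp (@dcst m n j) f = dcst l j.
Proof. by apply: dmapP => i; rewrite dcompE !dcstE. Qed.

Lemma dmap0_eq n (f g : dmap n 0) : f = g.
Proof. by apply: dmapP => i; rewrite (ord1 (f i)) (ord1 (g i)). Qed.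

Record sset := SSet {
  obj :> nat -> Type;
  op : forall m n, dmap m n -> obj n -> obj m;
  op_id : forall n (x : obj n), op (did n) x = x;
  op_comp : forall l m n (g : dmap m n) (f : dmap l m) (x : obj n),
    op (dcomp g f) x = op f (op g x) }.
Arguments op {s m n} f x.

Record smap (X Y : sset) := SMap {
  smap_fun :> forall n, X n -> Y n;
  smap_op : forall m n (f : dmap m n) (x : X n),
    smap_fun (op f x) = op f (smap_fun x) }.
Arguments smap_fun {X Y} s n x.

Lemma smapP X Y (f g : smap X Y) : (forall n (x : X n), f n x = g n x) -> f = g.
Proof.
case: f g => f fP [g gP] /= fg.
have efg : f = g by apply/functional_extensionality_dep => n; apply/funext.
by subst g; congr SMap; apply: Prop_irrelevance.
Qed.

Definition sid X : smap X X := @SMap X X (fun n x => x) (fun m n f x => erefl).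

Lemma scomp_proof X Y Z (g : smap Y Z) (f : smap X Y) m n (s : dmap m n) x :
  g m (f m (op s x)) = op s (g n (f n x)).
Proof. by rewrite !smap_op. Qed.
Definition scomp X Y Z (g : smap Y Z) (f : smap X Y) : smap X Z :=
  SMap (scomp_proof g f).

Section Sub.
Variables (X : sset) (P : forall n, X n -> Prop).
Hypothesis Pop : forall m n (f : dmap m n) x, P x -> P (op f x).
Definition sub_op m n (f : dmap m n) (x : {x : X n | P x}) : {x : X m | P x} :=
  exist _ (op f (sval x)) (Pop f (svalP x)).
Lemma sub_op_id n x : sub_op (did n) x = x.
Proof. by case: x => x Px; apply: eq_exist; rewrite /= op_id. Qed.
Lemma sub_op_comp l m n (g : dmap m n) (f : dmap l m) x :
  sub_op (dcomp g f) x = sub_op f (sub_op g x).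
Proof. by apply: eq_exist; rewrite /= op_comp. Qed.
Definition sub : sset := SSet sub_op_id sub_op_comp.
End Sub.

Definition sprod (X Y : sset) : sset.
Proof.
refine (@SSet (fun n => (X n * Y n)%type)
          (fun m n f xy => (op f xy.1, op f xy.2)) _ _).
- by move=> n [x y]; rewrite /= !op_id.
- by move=> l m n g f [x y]; rewrite /= !op_comp.
Defined.

Definition simplex (n : nat) : sset :=
  @SSet (fun k => dmap k n) (fun m k f s => dcomp s f)
    (fun k s => dcomp1 s) (fun l m k g f s => dcompA s g f).

Definition nonsurj k n (s : dmap k n) : Prop := exists j, forall i, s i <> j.

Lemma nonsurj_op n m k (f : dmap m k) (s : simplex n k) :
  nonsurj s -> nonsurj (op f s).
Proof. by case=> j sj; exists j => i; rewrite dcompE. Qed.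

Definition boundary n : sset := sub (@nonsurj_op n).

Definition misses n (i : 'I_n.+1) k (s : simplex n k) : Prop :=
  exists j, j <> i /\ forall l, s l <> j.

Lemma misses_op n (i : 'I_n.+1) m k (f : dmap m k) (s : simplex n k) :
  misses i s -> misses i (op f s).
Proof. by case=> j [ji sj]; exists j; split=> // l; rewrite dcompE. Qed.

Definition horn n (i : 'I_n.+1) : sset := sub (@misses_op n i).

Definition Kan (X : sset) : Prop :=
  forall n (i : 'I_n.+2) (f : smap (horn i) X),
  exists g : smap (simplex n.+1) X, forall k s, g k (sval s) = f k s.

Definition trivial_fibration X Y (p : smap X Y) : Prop :=
  forall n (b : smap (boundary n) X) (z : smap (simplex n) Y),
  (forall k s, p k (b k s) = z k (sval s)) ->
  exists y : smap (simplex n) X,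
    (forall k s, y k (sval s) = b k s) /\ (forall k s, p k (y k s) = z k s).

Definition homotopic X Y (f g : smap X Y) : Prop :=
  exists h : smap (sprod X (simplex 1)) Y,
    (forall n x, h n (x, dcst n ord0) = f n x) /\
    (forall n x, h n (x, dcst n ord_max) = g n x).

(* Only used between Kan complexes, where it is the same as weak equivalence. *)
Definition hequiv X Y (f : smap X Y) : Prop :=
  exists g : smap Y X,
    homotopic (scomp g f) (sid X) /\ homotopic (scomp f g) (sid Y).

Lemma ihom_op_proof X Y m n (f : dmap m n) (phi : smap (sprod X (simplex n)) Y)
    k l (s : dmap k l) (x : sprod X (simplex m) l) :
  phi k ((op s x).1, dcomp f (op s x).2) = op s (phi l (x.1, dcomp f x.2)).
Proof. by rewrite -smap_op /= dcompA. Qed.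

Definition ihom (X Y : sset) : sset.
Proof.
refine (@SSet (fun k => smap (sprod X (simplex k)) Y)
          (fun m n f phi => SMap (ihom_op_proof f phi)) _ _).
- by move=> n phi; apply: smapP => k [x s] /=; rewrite d1comp.
- by move=> l m n g f phi; apply: smapP => k [x s] /=; rewrite dcompA.
Defined.

Definition edge (X : sset) (x y : X 0) : Prop :=
  exists e : X 1, op (dcst 0 ord0) e = x /\ op (dcst 0 ord_max) e = y.

Definition connected (X : sset) : X 0 -> X 0 -> Prop :=
  clos_refl_sym_trans _ (@edge X).

(* Elements are the connected components, as sets of vertices. *)
Definition pi0 (X : sset) : Type :=
  {C : X 0 -> Prop | exists x, C = connected x}.

Definition component (X : sset) (x : X 0) : pi0 X :=
  exist _ (connected x) (ex_intro _ x erefl).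

Lemma connected_ext (X : sset) (x y : X 0) : connected x y -> connected x = connected y.
Proof.
move=> xy; apply/funext => z; apply/propext; split=> [xz|yz].
  exact: rst_trans (rst_sym _ _ _ _ xy) xz.
exact: rst_trans xy yz.
Qed.

Lemma smap_connected X Y (f : smap X Y) x y :
  connected x y -> connected (f 0 x) (f 0 y).
Proof.
elim=> {x y} [x y [e [<- <-]]|x|x y _ h|x y z _ h _ h'].
- by apply: rst_step; exists (f 1 e); rewrite !smap_op.
- exact: rst_refl.
- exact: rst_sym.
- exact: rst_trans h h'.
Qed.

Lemma pi0_map_proof X Y (f : smap X Y) (C : pi0 X) :
  exists y, (fun z => exists x, sval C x /\ connected (f 0 x) z) = connected y.
Proof.
case: C => C [x eC] /=; subst C; exists (f 0 x); apply/funext => z; apply/propext; split=> /=.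
  by case=> x' [xx' h]; apply: rst_trans h; exact: smap_connected.
by move=> h; exists x; split=> //; exact: rst_refl.
Qed.
Definition pi0_map X Y (f : smap X Y) (C : pi0 X) : pi0 Y :=
  exist _ _ (pi0_map_proof f C).

Lemma pi0_mapE X Y (f : smap X Y) x :
  pi0_map f (component x) = component (f 0 x).
Proof.
apply: eq_exist => /=; apply/funext => z; apply/propext; split.
  by case=> x' [xx' h]; apply: rst_trans h; exact: smap_connected.
by move=> h; exists x; split=> //; exact: rst_refl.
Qed.

Lemma connected_pair (X Y : sset) (x x' : X 0) (y y' : Y 0) :
  connected x x' -> connected y y' ->
  @connected (sprod X Y) (x, y) (x', y').
Proof.
move=> hx hy; apply: (@rst_trans _ _ _ (x', y)).
  elim: hx => {x x'} [a b [e [<- <-]]|a|a b _ h|a b c _ h _ h'].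
  - apply: rst_step; exists (e, op (dcst 1 ord0) y); rewrite /= -!op_comp.
    by rewrite !(dmap0_eq (dcomp _ _) (did 0)) !op_id.
  - exact: rst_refl.
  - exact: rst_sym.
  - exact: rst_trans h h'.
elim: hy => {y y'} [a b [e [<- <-]]|a|a b _ h|a b c _ h _ h'].
- apply: rst_step; exists (op (dcst 1 ord0) x', e); rewrite /= -!op_comp.
  by rewrite !(dmap0_eq (dcomp _ _) (did 0)) !op_id.
- exact: rst_refl.
- exact: rst_sym.
- exact: rst_trans h h'.
Qed.

Lemma connected_fst (X Y : sset) (u v : sprod X Y 0) : connected u v -> connected u.1 v.1.
Proof.
exact: (@smap_connected _ _ (@SMap (sprod X Y) X (fun n u => u.1) (fun m n f u => erefl))).
Qed.

Lemma connected_snd (X Y : sset) (u v : sprod X Y 0) : connected u v -> connected u.2 v.2.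
Proof.
exact: (@smap_connected _ _ (@SMap (sprod X Y) Y (fun n u => u.2) (fun m n f u => erefl))).
Qed.

Lemma pi0_pair_proof X Y (C : pi0 X) (D : pi0 Y) :
  exists u : sprod X Y 0, (fun v => sval C v.1 /\ sval D v.2) = connected u.
Proof.
case: C D => C [x eC] [D [y eD]] /=; subst C D; exists (x, y); apply/funext => -[x' y'].
apply/propext; split=> /= [[]|h]; first exact: connected_pair.
by split; [exact: connected_fst h | exact: connected_snd h].
Qed.
Definition pi0_pair X Y (C : pi0 X) (D : pi0 Y) : pi0 (sprod X Y) :=
  exist _ _ (pi0_pair_proof C D).

Lemma pi0_pairE (X Y : sset) (x : X 0) (y : Y 0) :
  pi0_pair (component x) (component y) = component ((x, y) : sprod X Y 0).
Proof.
apply: eq_exist => /=; apply/funext => -[x' y'].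
apply/propext; split=> /= [[]|h]; first exact: connected_pair.
by split; [exact: connected_fst h | exact: connected_snd h].
Qed.

(* The union of those connected components whose vertices satisfy P; P is only
   used when it is invariant under connectedness. *)
Section Full.
Variables (X : sset) (P : X 0 -> Prop).
Lemma full_op m n (f : dmap m n) (x : X n) :
  (forall v : dmap 0 n, P (op v x)) -> forall v : dmap 0 m, P (op v (op f x)).
Proof. by move=> Px v; rewrite -op_comp. Qed.
Definition full : sset := sub full_op.
End Full.

(* The coordinate-free form of a symmetric spectrum: a pointed simplicial
   functor on the category of finite sets whose morphisms from A to C are an
   injection f together with a point of the smash product of copies of
   S^1 = Delta^1/boundary indexed by the complement of the image of f.  Such a
   point is represented by t : C -> Delta^1, of which only the values off the
   image matter (push_push), and which is the basepoint as soon as one of those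
   values lies on the boundary (push_boundary).  The values of push at
   non-injective f carry no information.
   G acts on the right, as in MathComp; the values of gact outside G are never
   used. *)
Record gspectrum (gT : finGroupType) (G : {group gT}) := GSpectrum {
  space :> finType -> sset;
  pt : forall (A : finType) k, space A k;
  push : forall (A C : finType) k, (A -> C) -> (C -> dmap k 1) ->
    space A k -> space C k;
  gact : forall (A : finType) k, space A k -> gT -> space A k;

  pt_op : forall (A : finType) m n (s : dmap m n), op s (pt A n) = pt A m;
  push_id : forall (A : finType) k (t : A -> dmap k 1) (x : space A k),
    push id t x = x;
  push_push : forall (A C E : finType) k (f : A -> C) (g : C -> E)
      (t : C -> dmap k 1) (u v : E -> dmap k 1) (x : space A k),
    injective f -> injective g ->
    (forall c, c \notin codom f -> v (g c) = t c) ->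
    (forall e, e \notin codom g -> v e = u e) ->
    push g u (push f t x) = push (g \o f) v x;
  push_pt : forall (A C : finType) k (f : A -> C) (t : C -> dmap k 1),
    injective f -> push f t (pt A k) = pt C k;
  push_boundary : forall (A C : finType) k (f : A -> C) (t : C -> dmap k 1)
      (x : space A k) c,
    injective f -> c \notin codom f -> nonsurj (t c) -> push f t x = pt C k;
  push_op : forall (A C : finType) m n (s : dmap m n) (f : A -> C)
      (t : C -> dmap n 1) (x : space A n),
    injective f ->
    op s (push f t x) = push f (fun c => dcomp (t c) s) (op s x);

  gact_action : forall (A : finType) k, is_action G (@gact A k);
  gact_op : forall (A : finType) m n (s : dmap m n) (x : space A n) g,
    g \in G -> gact (op s x) g = op s (gact x g);
  gact_pt : forall (A : finType) k g, g \in G -> gact (pt A k) g = pt A k;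
  gact_push : forall (A C : finType) k (f : A -> C) (t : C -> dmap k 1)
      (x : space A k) g,
    injective f -> g \in G -> gact (push f t x) g = push f t (gact x g) }.
Arguments pt {gT G} _ A k.
Arguments push {gT G _ A C k} _ _ _.
Arguments gact {gT G _ A k} _ _.

(* An arbitrary coordinate, for push along bijections. *)
Definition nocoord (C : finType) k : C -> dmap k 1 := fun _ => dcst k ord0.
Arguments nocoord {C k} _.

Section Genuine.
Variables (gT : finGroupType) (G : {group gT}).
Implicit Types (X : gspectrum G) (H : {group gT}) (A B : finType).

(* The action on the value at an H-set combines the two actions. *)
Definition twist X A H (rA : action H A) k (x : X A k) (h : gT) : X A k :=
  push (rA^~ h) nocoord (gact x h).

Lemma twist_op X A H (rA : action H A) m n (s : dmap m n) (x : X A n) h :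
  H \subset G -> h \in H -> twist rA (op s x) h = op s (twist rA x h).
Proof.
move=> sHG hH; have hG := subsetP sHG _ hH.
have inj : injective (rA^~ h) by exact: act_inj.
rewrite /twist push_op // gact_op //; congr push.
by apply/funext => c; rewrite dcst_comp.
Qed.

Lemma fixed_op X H (sHG : H \subset G) A (rA : action H A) m n (s : dmap m n)
    (x : X A n) :
  (forall h, h \in H -> twist rA x h = x) ->
  forall h, h \in H -> twist rA (op s x) h = op s x.
Proof. by move=> xP h hH; rewrite twist_op // xP. Qed.
Definition fixed X H (sHG : H \subset G) A (rA : action H A) : sset :=
  sub (@fixed_op X H sHG A rA).

(* (Delta^1)^B, whose quotient by the union of the faces is the sphere S^B. *)
Definition cube B : sset.
Proof.
refine (@SSet (fun k => B -> dmap k 1) (fun m n f t b => dcomp (t b) f) _ _).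
- by move=> n t; apply/funext => b; rewrite dcomp1.
- by move=> l m n g f t; apply/funext => b; rewrite dcompA.
Defined.

(* The H-fixed points of the B-fold loop space of X(A): pointed H-equivariant
   maps from S^B. *)
Definition is_loop X H A (rA : action H A) B (rB : action H B) k
    (phi : ihom (cube B) (X A) k) : Prop :=
  (forall n (t : cube B n) (s : dmap n k),
     (exists b, nonsurj (t b)) -> phi n (t, s) = pt X A n) /\
  (forall h, h \in H -> forall n (t : cube B n) (s : dmap n k),
     phi n ((fun b => t (rB b h^-1%g)) : cube B n, s) = twist rA (phi n (t, s)) h).

Lemma is_loop_op X H A (rA : action H A) B (rB : action H B) m n (f : dmap m n)
    (phi : ihom (cube B) (X A) n) :
  is_loop rA rB phi -> is_loop rA rB (op f phi).
Proof. by case=> phi1 phi2; split=> [k t s|h hH k t s] /=; auto. Qed.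
Definition loops X H A (rA : action H A) B (rB : action H B) : sset :=
  sub (@is_loop_op X H A rA B rB).

Definition sum_act H A (rA : action H A) B (rB : action H B) (c : A + B) (h : gT) :
    A + B :=
  match c with inl a => inl (rA a h) | inr b => inr (rB b h) end.

Lemma sum_is_action H A (rA : action H A) B (rB : action H B) :
  is_action H (sum_act rA rB).
Proof.
split=> [h|[a|b] h h' hH h'H] /=.
- by move=> [a|b] [a'|b'] //= [] /act_inj ->.
- by rewrite actMin.
- by rewrite actMin.
Qed.
Canonical sum_action H A (rA : action H A) B (rB : action H B) :=
  Action (sum_is_action rA rB).

Definition sum_coord A B n (t : cube B n) (c : A + B) : dmap n 1 :=
  match c with inl _ => dcst n ord0 | inr b => t b end.

Lemma inl_codom A B (b : B) : inr b \notin codom (@inl A B).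
Proof. by apply/codomP => -[]. Qed.

Lemma inl_inj A B : injective (@inl A B).
Proof. by move=> a a' []. Qed.

Definition structure_fun X A B k (x : X A k) n (ts : sprod (cube B) (simplex k) n) :
    X (A + B)%type n :=
  push inl (sum_coord ts.1) (op (ts.2 : dmap n k) x).

Lemma structure_fun_op X A B k (x : X A k) m n (f : dmap m n) ts :
  structure_fun (B := B) x (op f ts) = op f (structure_fun x ts).
Proof.
rewrite /structure_fun /= push_op; last exact: inl_inj.
rewrite -op_comp; congr push; apply/funext => -[a|b] //=.
by rewrite dcst_comp.
Qed.

Definition structure_smap X A B k (x : X A k) : ihom (cube B) (X (A + B)%type) k :=
  SMap (@structure_fun_op X A B k x).

Lemma structure_loop X H (sHG : H \subset G) A (rA : action H A) B (rB : action H B)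
    k (x : fixed X sHG rA k) :
  is_loop (sum_action rA rB) rB (structure_smap B (sval x)).
Proof.
case: x => x xP; split=> [n t s [b tb]|h hH n t s] /=; rewrite /structure_fun /=.
  by apply: (@push_boundary _ _ _ _ _ _ _ _ _ (inr b)) => //; [exact: inl_inj | exact: inl_codom].
have hG := subsetP sHG _ hH.
have injA : injective (rA^~ h) by exact: act_inj.
have injS : injective ((sum_action rA rB)^~ h) by exact: act_inj.
have injl := @inl_inj A B.
rewrite -{1}(xP h hH) -twist_op // /twist gact_push //.
pose v : A + B -> dmap n 1 := sum_coord (fun b => t (rB b h^-1%g)).
set y := gact (op s x) h.
have -> : push inl (sum_coord (fun b => t (rB b h^-1%g))) (push (rA^~ h) nocoord y)
        = push (inl \o rA^~ h) v y.
  by apply: (@push_push _ _ _ _ _ _ _ (rA^~ h) inl nocoord).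
symmetry.
apply: (@push_push _ _ _ _ _ _ _ inl ((sum_action rA rB)^~ h) (sum_coord t) nocoord).
- exact: injl.
- exact: injS.
- case=> [a|b] nc /=; first by case/negP: nc; exact: codom_f.
  by rewrite actKin.
- move=> c; suff -> : c \in codom ((sum_action rA rB)^~ h) by [].
  by apply/codomP; exists ((sum_action rA rB) c h^-1%g); rewrite actKVin.
Qed.

Lemma structure_map_op X H (sHG : H \subset G) A (rA : action H A) B (rB : action H B)
    m n (f : dmap m n) (x : fixed X sHG rA n) :
  exist (fun phi => is_loop (sum_action rA rB) rB phi)
    (structure_smap B (sval (op f x))) (structure_loop rB (op f x)) =
  op (s := loops X (sum_action rA rB) rB) f
    (exist _ (structure_smap B (sval x)) (structure_loop rB x)).
Proof.
apply: eq_exist; apply: smapP => k [t s] /=.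
by rewrite /structure_fun /= -op_comp.
Qed.

Definition structure_map X H (sHG : H \subset G) A (rA : action H A)
    B (rB : action H B) : smap (fixed X sHG rA) (loops X (sum_action rA rB) rB) :=
  @SMap (fixed X sHG rA) (loops X (sum_action rA rB) rB)
    (fun k x => exist _ (structure_smap B (sval x)) (structure_loop rB x))
    (@structure_map_op X H sHG A rA B rB).

Definition fibrant X : Prop :=
  (forall H (sHG : H \subset G) A (rA : action H A), Kan (fixed X sHG rA)) /\
  (forall H (sHG : H \subset G) A (rA : action H A) B (rB : action H B),
     hequiv (structure_map X sHG rA rB)).

(* For fibrant X this represents the genuine fixed points X^H. *)
Lemma genuine_fixed_op X H (sHG : H \subset G) m n (s : dmap m n) (x : X void n) :
  (forall h, h \in H -> gact x h = x) ->
  forall h, h \in H -> gact (op s x) h = op s x.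
Proof. by move=> xP h hH; rewrite gact_op ?xP // (subsetP sHG). Qed.
Definition genuine_fixed X H (sHG : H \subset G) : sset :=
  sub (@genuine_fixed_op X H sHG).

Definition pi0_fixed X H (sHG : H \subset G) : Type := pi0 (genuine_fixed X sHG).
(* The homotopy group of X^H in degree B - A. *)
Definition pi_graded X H A (rA : action H A) B (rB : action H B) : Type :=
  pi0 (loops X rA rB).

Lemma genuine_res_proof X H (K : {group gT}) (sKH : K \subset H) k (x : X void k) :
  (forall h, h \in H -> gact x h = x) -> forall h, h \in K -> gact x h = x.
Proof. by move=> xP h hK; apply: xP; exact: (subsetP sKH). Qed.

Definition genuine_res X H (sHG : H \subset G) (K : {group gT}) (sKG : K \subset G)
    (sKH : K \subset H) : smap (genuine_fixed X sHG) (genuine_fixed X sKG).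
Proof.
refine (@SMap (genuine_fixed X sHG) (genuine_fixed X sKG)
  (fun n x => exist _ (sval x) (genuine_res_proof sKH (svalP x))) _).
by move=> m n f x; apply: eq_exist.
Defined.

Definition pi0_res X H (sHG : H \subset G) (K : {group gT}) (sKG : K \subset G) (sKH : K \subset H) :
    pi0_fixed X sHG -> pi0_fixed X sKG :=
  pi0_map (genuine_res X sHG sKG sKH).

End Genuine.
Arguments pi0_res {gT G X H} sHG {K} sKG sKH _.

Lemma res_action (gT : finGroupType) (G K : {group gT}) (sKG : K \subset G) T
    (to : T -> gT -> T) : is_action G to -> is_action K to.
Proof.
by case=> inj toM; split=> // x g h gK hK; apply: toM; exact: (subsetP sKG).
Qed.

Definition res_spectrum (gT : finGroupType) (G K : {group gT}) (sKG : K \subset G)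
    (X : gspectrum G) : gspectrum K :=
  @GSpectrum gT K X (pt X) (@push _ _ X) (@gact _ _ X)
    (@pt_op _ _ X) (@push_id _ _ X) (@push_push _ _ X) (@push_pt _ _ X)
    (@push_boundary _ _ X) (@push_op _ _ X)
    (fun A k => res_action sKG (@gact_action _ _ X A k))
    (fun A m n s x g gK => @gact_op _ _ X A m n s x g (subsetP sKG _ gK))
    (fun A k g gK => @gact_pt _ _ X A k g (subsetP sKG _ gK))
    (fun A C k f t x g injf gK =>
       @gact_push _ _ X A C k f t x g injf (subsetP sKG _ gK)).

Definition Sigma (I : finType) (A : I -> finType) : finType := {i : I & A i}.

Definition is_order (I : Type) (r : rel I) : Prop :=
  [/\ total r, transitive r & antisymmetric r].

Definition lex (I : eqType) (J : I -> Type) (o : rel I) (q : forall i, rel (J i)) :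
    rel {i : I & J i} :=
  fun u v => if tag u == tag v then q (tag u) (tagged u) (tagged_as u v)
             else o (tag u) (tag v).

(* Algebras over the Barratt-Eccles operad in coordinate-free form: the space of
   operations of arity I is the simplicial set whose k-simplices are the
   (k+1)-tuples of total orders on I, and operadic composition is lexicographic.
   The multilinear maps mu encode maps out of smash products over the sphere
   spectrum, so they are natural for all morphisms of the indexing category
   (mu_push).  The values of mu at tuples of relations which are not orders
   carry no information. *)
Record algebra (gT : finGroupType) (G : {group gT}) := Algebra {
  spectrum :> gspectrum G;
  mu : forall (I : finType) (A : I -> finType) k, ('I_k.+1 -> rel I) ->
    (forall i, spectrum (A i) k) -> spectrum (Sigma A) k;

  mu_op : forall (I : finType) (A : I -> finType) m n (s : dmap m n)
      (o : 'I_n.+1 -> rel I) (x : forall i, spectrum (A i) n),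
    (forall l, is_order (o l)) ->
    op s (mu o x) = mu (fun l => o (s l)) (fun i => op s (x i));
  mu_pt : forall (I : finType) (A : I -> finType) k (o : 'I_k.+1 -> rel I)
      (x : forall i, spectrum (A i) k) i,
    (forall l, is_order (o l)) -> x i = pt spectrum (A i) k ->
    mu o x = pt spectrum (Sigma A) k;
  mu_push : forall (I : finType) (A C : I -> finType) k (o : 'I_k.+1 -> rel I)
      (f : forall i, A i -> C i) (t : forall i, C i -> dmap k 1)
      (x : forall i, spectrum (A i) k),
    (forall l, is_order (o l)) -> (forall i, injective (f i)) ->
    mu o (fun i => push (f i) (t i) (x i)) =
    push (fun u : Sigma A => existT C (tag u) (f (tag u) (tagged u)) : Sigma C)
      (fun u => t (tag u) (tagged u)) (mu o x);
  mu_gact : forall (I : finType) (A : I -> finType) k (o : 'I_k.+1 -> rel I)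
      (x : forall i, spectrum (A i) k) g,
    (forall l, is_order (o l)) -> g \in G ->
    gact (mu o x) g = mu o (fun i => gact (x i) g);
  mu_sym : forall (I I' : finType) (e : I -> I') (A : I' -> finType) k
      (o : 'I_k.+1 -> rel I') (x : forall i, spectrum (A i) k),
    (forall l, is_order (o l)) -> bijective e ->
    push (fun u : Sigma (fun i => A (e i)) => existT A (e (tag u)) (tagged u) : Sigma A)
      nocoord (mu (fun l i j => o l (e i) (e j)) (fun i => x (e i))) = mu o x;
  mu_unit : forall (A : finType) k (o : 'I_k.+1 -> rel unit) (x : spectrum A k),
    (forall l, is_order (o l)) ->
    mu o (fun _ => x) =
    push (fun a => existT (fun _ : unit => A) tt a : Sigma (fun _ : unit => A))
      nocoord x;
  mu_comp : forall (I : finType) (J : I -> finType) (A : forall i, J i -> finType) k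
      (o : 'I_k.+1 -> rel I) (q : forall i, 'I_k.+1 -> rel (J i))
      (x : forall i j, spectrum (A i j) k),
    (forall l, is_order (o l)) -> (forall i l, is_order (q i l)) ->
    push (fun u : Sigma (fun ij : Sigma J => A (tag ij) (tagged ij)) =>
            existT (fun i => Sigma (A i)) (tag (tag u))
              (existT (A (tag (tag u))) (tagged (tag u)) (tagged u))
            : Sigma (fun i => Sigma (A i)))
      nocoord (mu (I := Sigma J) (fun l => lex (o l) (fun i => q i l))
                 (fun ij => x (tag ij) (tagged ij))) =
    mu o (fun i => mu (q i) (x i)) }.
Arguments mu {gT G _ I A k} _ _.

Definition res_algebra (gT : finGroupType) (G K : {group gT}) (sKG : K \subset G)
    (X : algebra G) : algebra K :=
  @Algebra gT K (res_spectrum sKG X) (@mu _ _ X)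
    (@mu_op _ _ X) (@mu_pt _ _ X) (@mu_push _ _ X)
    (fun I A k o x g oP gK => @mu_gact _ _ X I A k o x g oP (subsetP sKG _ gK))
    (@mu_sym _ _ X) (@mu_unit _ _ X) (@mu_comp _ _ X).

Section Mult.
Variables (gT : finGroupType) (G : {group gT}) (X : algebra G).
Implicit Types (H : {group gT}) (A B : finType).

Definition bool_order : rel bool := fun b c => c ==> b.

Lemma bool_orderP : is_order bool_order.
Proof. by split; [case=> [] [] | case=> [] [] [] | case=> [] []]. Qed.

Definition bfam A (b : bool) : finType := if b then (void : finType) else A.

Definition bpair A k (x : X void k) (y : X A k) (b : bool) : X (bfam A b) k :=
  match b return X (bfam A b) k with true => x | false => y end.

Definition bsum A (u : Sigma (bfam A)) : A :=
  match u with
  | existT true v => match v : void with end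
  | existT false a => a
  end.

Lemma bsum_inj A : injective (@bsum A).
Proof. by case=> [[] // a] [[] // b] /= ->. Qed.

Definition dot A k (x : X void k) (y : X A k) : X A k :=
  push (@bsum A) nocoord (mu (fun _ => bool_order) (bpair x y)).

Definition vsum (u : Sigma (fun _ : void => void)) : void := tag u.

Definition one k : X void k :=
  push vsum nocoord
    (mu (fun _ _ _ => true) (fun i : void => match i with end)).

Lemma dot_op A m n (s : dmap m n) x (y : X A n) :
  op s (dot x y) = dot (op s x) (op s y).
Proof.
rewrite /dot push_op; last exact: bsum_inj.
rewrite mu_op; last by move=> ?; exact: bool_orderP.
congr push; first by apply/funext => c; rewrite dcst_comp.
by congr mu; apply/functional_extensionality_dep => -[].
Qed.

Lemma dot_gact A k x (y : X A k) g :
  g \in G -> gact (dot x y) g = dot (gact x g) (gact y g).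
Proof.
move=> gG; rewrite /dot gact_push //; last exact: bsum_inj.
rewrite mu_gact //; last by move=> ?; exact: bool_orderP.
by congr push; congr mu; apply/functional_extensionality_dep => -[].
Qed.

Lemma void_order (r : rel void) : is_order r.
Proof. by split; case. Qed.

Lemma one_op m n (s : dmap m n) : op s (one n) = one m.
Proof.
have inj : injective vsum by case=> -[].
rewrite /one push_op // mu_op; last by move=> ?; exact: void_order.
congr push; first by apply/funext => -[].
by congr mu; apply/functional_extensionality_dep => -[].
Qed.

Lemma one_gact k g : g \in G -> gact (one k) g = one k.
Proof.
move=> gG; have inj : injective vsum by case=> -[].
rewrite /one gact_push // mu_gact //; last by move=> ?; exact: void_order.
by congr push; congr mu; apply/functional_extensionality_dep => -[].
Qed.

Lemma dot_push A (C : finType) k (f : A -> C) x (y : X A k) : bijective f ->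
  dot x (push f nocoord y) = push f nocoord (dot x y).
Proof.
move=> bij_f; have injf := bij_inj bij_f.
pose F b : bfam A b -> bfam C b :=
  match b return bfam A b -> bfam C b with true => id | false => f end.
have injF b : injective (F b) by case: b => //; exact: injf.
pose z : forall b, bfam C b -> dmap k 1 := fun b => nocoord.
have eF : bpair x (push f nocoord y) = fun b => push (F b) (z b) (bpair x y b).
  by apply/functional_extensionality_dep => -[] //=; rewrite push_id.
rewrite /dot eF mu_push //; last by move=> ?; exact: bool_orderP.
have injSF : injective (fun u : Sigma (bfam A) =>
    existT (bfam C) (tag u) (F (tag u) (tagged u)) : Sigma (bfam C)).
  case=> [[] // a] [[] // b] h.
  have e : a = b by apply: injf; exact: (congr1 (@bsum C) h).
  by rewrite e.
rewrite (@push_push _ _ _ _ _ _ _ _ _ _ nocoord nocoord) //; last exact: bsum_inj.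
rewrite (@push_push _ _ _ _ _ _ _ _ _ _ nocoord nocoord) //; last exact: bsum_inj.
by congr push; apply/funext => -[[] // a].
Qed.

Lemma dot_twist A H (rA : action H A) k x (y : X A k) h : H \subset G -> h \in H ->
  twist rA (dot x y) h = dot (gact x h) (twist rA y h).
Proof.
move=> sHG hH; rewrite /twist dot_gact ?(subsetP sHG) //.
rewrite dot_push //; exact: injF_bij (act_inj rA h).
Qed.

Lemma dot_pt A k x : dot x (pt X A k) = pt X A k.
Proof.
rewrite /dot (@mu_pt _ _ _ _ _ _ _ _ false) //; last by move=> ?; exact: bool_orderP.
by rewrite push_pt //; exact: bsum_inj.
Qed.

Section Fixed.
Variables (H : {group gT}) (sHG : H \subset G).

Lemma fixed_dot k (x y : genuine_fixed X sHG k) h :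
  h \in H -> gact (dot (sval x) (sval y)) h = dot (sval x) (sval y).
Proof.
case: x y => x xP [y yP] hH.
by rewrite /= dot_gact ?(subsetP sHG) // xP // yP.
Qed.

Definition fixed_mul : smap (sprod (genuine_fixed X sHG) (genuine_fixed X sHG))
                            (genuine_fixed X sHG).
Proof.
refine (@SMap (sprod (genuine_fixed X sHG) (genuine_fixed X sHG)) (genuine_fixed X sHG)
  (fun k (xy : genuine_fixed X sHG k * genuine_fixed X sHG k) =>
     exist _ (dot (sval xy.1) (sval xy.2)) (@fixed_dot k xy.1 xy.2)) _).
by move=> m n f [x y]; apply: eq_exist; rewrite /= dot_op.
Defined.

Definition pi0_mul (a b : pi0_fixed X sHG) : pi0_fixed X sHG :=
  pi0_map fixed_mul (pi0_pair a b).

Definition pi0_one : pi0_fixed X sHG :=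
  component (exist (fun x : X void 0 => forall h, h \in H -> gact x h = x) (one 0)
               (fun h hH => one_gact 0 (subsetP sHG _ hH)) : genuine_fixed X sHG 0).

Definition pi0_unit (a : pi0_fixed X sHG) : Prop :=
  exists b, pi0_mul a b = pi0_one /\ pi0_mul b a = pi0_one.

Variables (A : finType) (rA : action H A) (B : finType) (rB : action H B).

Lemma loop_dot_op k (x : X void k) (phi : ihom (cube B) (X A) k)
    m n (f : dmap m n) (ts : sprod (cube B) (simplex k) n) :
  dot (op ((op f ts).2 : dmap m k) x) (phi m (op f ts)) =
  op f (dot (op (ts.2 : dmap n k) x) (phi n ts)).
Proof. by rewrite dot_op smap_op /= op_comp. Qed.

Definition loop_dot k (x : X void k) (phi : ihom (cube B) (X A) k) :
    ihom (cube B) (X A) k := SMap (loop_dot_op x phi).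

Lemma loop_dot_loop k (x : genuine_fixed X sHG k) (phi : loops X rA rB k) :
  is_loop rA rB (loop_dot (sval x) (sval phi)).
Proof.
case: x phi => x xP [phi [phi1 phi2]]; split=> [n t s tb|h hH n t s] /=.
  by rewrite phi1 // dot_pt.
by rewrite dot_twist // -phi2 // gact_op ?(subsetP sHG) // xP.
Qed.

Definition loops_mul : smap (sprod (genuine_fixed X sHG) (loops X rA rB))
                            (loops X rA rB).
Proof.
refine (@SMap (sprod (genuine_fixed X sHG) (loops X rA rB)) (loops X rA rB)
  (fun k (xy : genuine_fixed X sHG k * loops X rA rB k) =>
     exist _ (loop_dot (sval xy.1) (sval xy.2)) (@loop_dot_loop k xy.1 xy.2)) _).
move=> m n f [x y]; apply: eq_exist; apply: smapP => k [t s] /=.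
by rewrite op_comp.
Defined.

Definition pi_scale (a : pi0_fixed X sHG) (x : pi_graded X rA rB) :
    pi_graded X rA rB :=
  pi0_map loops_mul (pi0_pair a x).

End Fixed.
End Mult.
Arguments pi0_one {gT G} X {H} sHG.
Arguments pi_scale {gT G X H sHG A rA B rB} a x.

(* The n-simplices of the mapping space from X to Y: the morphisms from X to
   the cotensor of Y with Delta^n. *)
Record mor (gT : finGroupType) (G : {group gT}) (X Y : algebra G) (n : nat) := Mor {
  mor_fun :> forall (A : finType) k, X A k -> dmap k n -> Y A k;
  mor_op : forall (A : finType) k l (f : dmap k l) (x : X A l) (s : dmap l n),
    mor_fun (op f x) (dcomp s f) = op f (mor_fun x s);
  mor_pt : forall (A : finType) k (s : dmap k n), mor_fun (pt X A k) s = pt Y A k;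
  mor_push : forall (A C : finType) k (f : A -> C) (t : C -> dmap k 1) (x : X A k) s,
    injective f -> mor_fun (push f t x) s = push f t (mor_fun x s);
  mor_gact : forall (A : finType) k (x : X A k) s g,
    g \in G -> mor_fun (gact x g) s = gact (mor_fun x s) g;
  mor_mu : forall (I : finType) (A : I -> finType) k (o : 'I_k.+1 -> rel I)
      (x : forall i, X (A i) k) s,
    (forall l, is_order (o l)) ->
    mor_fun (mu o x) s = mu o (fun i => mor_fun (x i) s) }.
Arguments mor_fun {gT G X Y n} _ A k x s.

Section Mor.
Variables (gT : finGroupType) (G : {group gT}).
Implicit Types (X Y Z : algebra G) (H : {group gT}) (A B C : finType).

Lemma morP X Y n (f g : mor X Y n) :
  (forall A k (x : X A k) s, f A k x s = g A k x s) -> f = g.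
Proof.
case: f g => f f1 f2 f3 f4 f5 [g g1 g2 g3 g4 g5] /= fg.
have efg : f = g.
  apply/functional_extensionality_dep => A; apply/functional_extensionality_dep => k.
  by apply/funext => x; apply/funext => s.
by subst g; congr Mor; apply: Prop_irrelevance.
Qed.

Definition Map_op X Y m n (u : dmap m n) (f : mor X Y n) : mor X Y m.
Proof.
refine (@Mor _ _ X Y m (fun A k x s => f A k x (dcomp u s)) _ _ _ _ _).
- by move=> A k l v x s; rewrite dcompA mor_op.
- by move=> A k s; rewrite mor_pt.
- by move=> A C k v t x s injv; rewrite mor_push.
- by move=> A k x s g gG; rewrite mor_gact.
- by move=> I A k o x s oP; rewrite mor_mu.
Defined.

Definition Map X Y : sset.
Proof.
refine (@SSet (mor X Y) (@Map_op X Y) _ _).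
- by move=> n f; apply: morP => A k x s; rewrite /= d1comp.
- by move=> l m n g f x; apply: morP => A k y s; rewrite /= dcompA.
Defined.

Definition zero_deg k : dmap k 0 := dcst k ord0.

Definition mor_comp X Y Z n (f : mor Y Z n) (l : mor X Y 0) : mor X Z n.
Proof.
refine (@Mor _ _ X Z n (fun A k x s => f A k (l A k x (zero_deg k)) s) _ _ _ _ _).
- move=> A k j v x s; rewrite -mor_op -(mor_op l); congr (f _ _ (l _ _ _ _) _).
  exact: dmap0_eq.
- by move=> A k s; rewrite !mor_pt.
- by move=> A C k v t x s injv; rewrite !mor_push.
- by move=> A k x s g gG; rewrite !mor_gact.
- by move=> I A k o x s oP; rewrite !mor_mu.
Defined.

Definition mor_id X : mor X X 0.
Proof. by refine (@Mor _ _ X X 0 (fun A k x s => x) _ _ _ _ _). Defined.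

Definition precomp X Y (l : mor X Y 0) Z : smap (Map Y Z) (Map X Z).
Proof.
refine (@SMap (Map Y Z) (Map X Z) (fun n f => mor_comp f l) _).
by move=> m n u f; apply: morP.
Defined.

Section Induced.
Variables (X Y : algebra G) (f : mor X Y 0).

Definition ev A k (x : X A k) : Y A k := f A k x (zero_deg k).

Lemma ev_op A m n (s : dmap m n) (x : X A n) : ev (op s x) = op s (ev x).
Proof. by rewrite /ev -mor_op; congr (f _ _ _ _); exact: dmap0_eq. Qed.

Lemma ev_twist H (sHG : H \subset G) A (rA : action H A) k (x : X A k) h :
  h \in H -> ev (twist rA x h) = twist rA (ev x) h.
Proof.
move=> hH; rewrite /ev mor_push ?mor_gact ?(subsetP sHG) //.
exact: act_inj.
Qed.

Lemma fixed_map_proof H (sHG : H \subset G) A (rA : action H A) k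
    (x : fixed X sHG rA k) h :
  h \in H -> twist rA (ev (sval x)) h = ev (sval x).
Proof. by case: x => x xP hH; rewrite -(ev_twist sHG) //= xP. Qed.

Definition fixed_map H (sHG : H \subset G) A (rA : action H A) :
  smap (fixed X sHG rA) (fixed Y sHG rA).
Proof.
refine (@SMap (fixed X sHG rA) (fixed Y sHG rA)
  (fun k x => exist _ (ev (sval x)) (fixed_map_proof x)) _).
by move=> m n s x; apply: eq_exist; rewrite /= ev_op.
Defined.

Lemma genuine_map_proof H (sHG : H \subset G) k (x : genuine_fixed X sHG k) h :
  h \in H -> gact (ev (sval x)) h = ev (sval x).
Proof.
case: x => x xP hH; rewrite /= -[in RHS](xP h hH) /ev mor_gact //.
exact: (subsetP sHG).
Qed.

Definition genuine_map H (sHG : H \subset G) :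
  smap (genuine_fixed X sHG) (genuine_fixed Y sHG).
Proof.
refine (@SMap (genuine_fixed X sHG) (genuine_fixed Y sHG)
  (fun k x => exist _ (ev (sval x)) (genuine_map_proof x)) _).
by move=> m n s x; apply: eq_exist; rewrite /= ev_op.
Defined.

Definition pi0_ind H (sHG : H \subset G) : pi0_fixed X sHG -> pi0_fixed Y sHG :=
  pi0_map (genuine_map sHG).

Lemma loop_map_op B A k (phi : ihom (cube B) (X A) k) m n (s : dmap m n)
    (ts : sprod (cube B) (simplex k) n) :
  ev (phi m (op s ts)) = op s (ev (phi n ts)).
Proof. by rewrite smap_op ev_op. Qed.

Definition loop_map B A k (phi : ihom (cube B) (X A) k) : ihom (cube B) (Y A) k :=
  SMap (@loop_map_op B A k phi).

Lemma loop_map_loop H (sHG : H \subset G) A (rA : action H A) B (rB : action H B) k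
    (phi : loops X rA rB k) : is_loop rA rB (loop_map (sval phi)).
Proof.
case: phi => phi [phi1 phi2]; split=> [n t s tb|h hH n t s] /=.
  by rewrite phi1 // /ev mor_pt.
by rewrite phi2 // (ev_twist sHG).
Qed.

Definition loops_map H (sHG : H \subset G) A (rA : action H A) B (rB : action H B) :
  smap (loops X rA rB) (loops Y rA rB).
Proof.
refine (@SMap (loops X rA rB) (loops Y rA rB)
  (fun k phi => exist _ (loop_map (sval phi)) (loop_map_loop sHG phi)) _).
by move=> m n s phi; apply: eq_exist; apply: smapP.
Defined.

Definition pi_ind H (sHG : H \subset G) A (rA : action H A) B (rB : action H B) :
    pi_graded X rA rB -> pi_graded Y rA rB :=
  pi0_map (loops_map sHG rA rB).

End Induced.
End Mor.
Arguments pi0_ind {gT G X Y} f {H} sHG _.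
Arguments pi_ind {gT G X Y} f {H} sHG {A} rA {B} rB _.

(* The left lifting property against trivial fibrations.  It is required after
   restriction to each subgroup, where it follows from the property for G itself
   because coinduction of algebras preserves trivial fibrations. *)
Definition cofibrant (gT : finGroupType) (G : {group gT}) (X : algebra G) : Prop :=
  forall (K : {group gT}) (sKG : K \subset G) (Y Z : algebra K) (p : mor Y Z 0),
  (forall (H : {group gT}) (sHK : H \subset K) (A : finType) (rA : action H A),
     trivial_fibration (fixed_map p sHK rA)) ->
  forall f : mor (res_algebra sKG X) Z 0,
  exists g : mor (res_algebra sKG X) Y 0,
    forall (A : finType) k (x : X A k), ev p (ev g x) = ev f x.

Record CAlg (gT : finGroupType) (G : {group gT}) := MkCAlg {
  calg :> algebra G;
  calg_fibrant : fibrant calg;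
  calg_cofibrant : cofibrant calg }.

Lemma Kan_irr X (P : forall n, obj X n -> Prop) (h1 h2 : forall m n (f : dmap m n) x,
    P n x -> P m (op f x)) : Kan (sub h1) -> Kan (sub h2).
Proof. by rewrite (Prop_irrelevance h1 h2). Qed.

Lemma hequiv_irr X Y (P : forall n, obj X n -> Prop) (Q : forall n, obj Y n -> Prop)
    (h1 h2 : forall m n (f : dmap m n) x, P n x -> P m (op f x))
    (q1 q2 : forall m n (f : dmap m n) x, Q n x -> Q m (op f x))
    (f : smap (sub h1) (sub q1)) (g : smap (sub h2) (sub q2)) :
  (forall n (x : {x | P n x}), sval (f n x) = sval (g n x)) -> hequiv f -> hequiv g.
Proof.
move: f g; rewrite (Prop_irrelevance h1 h2) (Prop_irrelevance q1 q2) => f g fg.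
suff -> : f = g by [].
apply: smapP => n x; move: (fg n x).
by case: (f n x) (g n x) => a pa [b pb] /= e; exact: eq_exist.
Qed.

Lemma res_fibrant (gT : finGroupType) (G K : {group gT}) (sKG : K \subset G)
    (X : gspectrum G) : fibrant X -> fibrant (res_spectrum sKG X).
Proof.
case=> X1 X2; split=> [H sHK A rA|H sHK A rA B rB]; have sHG := subset_trans sHK sKG.
  exact: Kan_irr (X1 H sHG A rA).
refine (@hequiv_irr _ _ _ _ _ _ _ _ (structure_map X sHG rA rB)
  (structure_map (res_spectrum sKG X) sHK rA rB) _ (X2 H sHG A rA B rB)) => n x.
exact: (@smapP (sprod (cube B) (simplex n)) (X (A + B)%type)).
Qed.

Lemma res_cofibrant (gT : finGroupType) (G K : {group gT}) (sKG : K \subset G)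
    (X : algebra G) : cofibrant X -> cofibrant (res_algebra sKG X).
Proof.
move=> cX L sLK Y Z p pP f; have sLG := subset_trans sLK sKG.
pose f' := @Mor _ _ (res_algebra sLG X) Z 0 f (@mor_op _ _ _ _ _ f)
  (@mor_pt _ _ _ _ _ f) (@mor_push _ _ _ _ _ f) (@mor_gact _ _ _ _ _ f)
  (@mor_mu _ _ _ _ _ f).
have [g gP] := cX L sLG Y Z p pP f'.
by exists (@Mor _ _ (res_algebra sLK (res_algebra sKG X)) Y 0 g (@mor_op _ _ _ _ _ g)
    (@mor_pt _ _ _ _ _ g) (@mor_push _ _ _ _ _ g) (@mor_gact _ _ _ _ _ g)
    (@mor_mu _ _ _ _ _ g)).
Qed.

Definition Res (gT : finGroupType) (G K : {group gT}) (sKG : K \subset G)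
    (X : CAlg G) : CAlg K :=
  @MkCAlg gT K (res_algebra sKG X) (res_fibrant sKG (calg_fibrant X))
    (@res_cofibrant _ _ _ sKG X (@calg_cofibrant _ _ X)).

Section Res.
Variables (gT : finGroupType) (G K : {group gT}) (sKG : K \subset G) (X : CAlg G).

Definition genuine_fixed_Res :
  smap (genuine_fixed (Res sKG X) (subxx K)) (genuine_fixed X sKG).
Proof.
refine (@SMap (genuine_fixed (Res sKG X) (subxx K)) (genuine_fixed X sKG)
  (fun n x => exist _ (sval x) (svalP x)) _).
by move=> m n f x; apply: eq_exist.
Defined.

Definition pi0_Res : pi0_fixed (Res sKG X) (subxx K) -> pi0_fixed X sKG :=
  pi0_map genuine_fixed_Res.

End Res.

Section Corep.
Variables (gT : finGroupType) (G : {group gT}).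
Implicit Types (R T L A : CAlg G).

Definition homotopic_mor R T (f g : mor R T 0) : Prop := @connected (Map R T) f g.

Definition is_equivalence R T (f : mor R T 0) : Prop :=
  exists g : mor T R 0,
    homotopic_mor (mor_comp g f) (mor_id R) /\ homotopic_mor (mor_comp f g) (mor_id T).

Definition equivalent R T : Prop := exists f : mor R T 0, is_equivalence f.

(* The subfunctor of Map(R, -) on the components selected by P is corepresented
   by L, with universal element u. *)
Definition corepresents R (P : forall A, mor R A 0 -> Prop) L (u : mor R L 0) : Prop :=
  P L u /\
  forall A, exists e : smap (Map L A) (full (X := Map R A) (P A)),
    (forall n (f : mor L A n), sval (e n f) = mor_comp f u) /\ hequiv e.

Definition inverts R (S : pi0_fixed R (subxx G) -> Prop) A (f : mor R A 0) : Prop :=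
  forall a, S a -> pi0_unit (pi0_ind f (subxx G) a).

(* The map l exhibits the homotopy Mackey functor of T as the localisation of
   that of R at the multiplicatively closed subset S of pi_0^G R: at each level
   H, in each degree B - A, pi_*^H T is the localisation at Res^G_H S. *)
Definition localises R (S : pi0_fixed R (subxx G) -> Prop) T (l : mor R T 0) : Prop :=
  forall (H : {group gT}) (sHG : H \subset G)
    (A : finType) (rA : action H A) (B : finType) (rB : action H B),
  let res := pi0_res (X := R) (subxx G) sHG sHG in
  let l0 := pi0_ind l sHG in
  let lpi := pi_ind l sHG rA rB in
  [/\ forall s, S s -> bijective (pi_scale (rA := rA) (rB := rB) (l0 (res s))),
      forall y, exists s x, S s /\ pi_scale (l0 (res s)) y = lpi x
    & forall x x', lpi x = lpi x' ->
        exists s, S s /\ pi_scale (res s) x = pi_scale (res s) x'].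

Definition telescopic_localisation R (S : pi0_fixed R (subxx G) -> Prop)
    T (l : mor R T 0) : Prop :=
  corepresents (inverts S) l /\ localises S l.

Definition subset_family R : Type :=
  forall (H : {group gT}) (sHG : H \subset G), pi0_fixed R sHG -> Prop.

Definition Gsubset R (S : subset_family R) : Prop :=
  forall (H : {group gT}) (sHG : H \subset G) a,
    S G (subxx G) a -> S H sHG (pi0_res (subxx G) sHG sHG a).

(* In particular S_H contains 1. *)
Definition mult_closed R (S : subset_family R) : Prop :=
  forall (H : {group gT}) (sHG : H \subset G),
    S H sHG (pi0_one R sHG) /\
    forall a b, S H sHG a -> S H sHG b -> S H sHG (pi0_mul a b).

Definition torsion_extension R (S : subset_family R) : Prop :=
  forall (H : {group gT}) (sHG : H \subset G) a, S H sHG a ->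
    exists r b, S G (subxx G) b /\ pi0_mul r a = pi0_res (subxx G) sHG sHG b.

Definition inverts_family R (S : subset_family R) A (f : mor R A 0) : Prop :=
  forall (H : {group gT}) (sHG : H \subset G) a, S H sHG a ->
    pi0_unit (pi0_ind f sHG a).

Definition is_Glocalisation R (S : subset_family R) L (u : mor R L 0) : Prop :=
  corepresents (inverts_family S) u.

Definition Res_subset R (S : subset_family R) (K : {group gT}) (sKG : K \subset G) :
    pi0_fixed (Res sKG R) (subxx K) -> Prop :=
  fun a => S K sKG (pi0_Res a).

End Corep.
Arguments Res_subset {gT G R} S {K} sKG _.

(* Main.v *)
(* The unit conditions for S_G and for the whole family S agree: if r * a restricts
   from S_G then a becomes a unit as soon as S_G does.  So the two subfunctors of
   Map(R, -) coincide, and the universal property of T is the one asked of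
   L_{S^-1} R.

   For the restriction to K, the map Res l inverts S_K, hence factors through a
   comparison map c : TK -> Res T.  On homotopy groups both sides are localisations
   of those of R, at the actions of S_K and of the image of S_G in S_K; the latter
   acts invertibly on the first and the former on the second, so c is bijective on
   all homotopy groups.  What remains is the Whitehead theorem for bifibrant
   algebras.  The mapping path object of c is an algebra with pointwise structure;
   its projection to the target is a trivial fibration on all fixed points, so it
   has a section because the target is cofibrant.  This gives a right homotopy
   inverse of c, which has a right homotopy inverse for the same reason, so c is an
   equivalence.

   That the projection is a trivial fibration is a statement on maps of Kan
   complexes W -> V which are bijective on the homotopy groups at the base point.
   These make the homotopy fibre contractible, which gives the lifting property for
   the loop map; since fixed points at A are loops in the fixed points at A + 1,
   this passes to W -> V itself, for all components. *)

Require Import Defs.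
From mathcomp Require Import all_boot all_fingroup.
From mathcomp Require Import boolp zify.
From Stdlib Require Import Relation_Operators.

Set Implicit Arguments.
Unset Strict Implicit.
Unset Printing Implicit Defensive.

(** * Subcomplexes and partial maps *)

(** Homotopy groups of a spectrum are components of loops at the base point, so bijectivity on them
    says nothing directly about the other components of the fixed points. This obstacle shapes the
    topology below. A contractible homotopy fibre over the base point lifts only maps on B x Delta^1
    that are constant at one end; families of loops are of this kind, and the remaining components
    are reached by delooping. Weak equivalences enter as a relative extension and lifting property
    over all pairs (B, A). In this form cancellation in squares, invariance under homotopy and the
    lifting of boundaries follow without a choice of base points. The Kan condition is used once, to
    obtain homotopy extension for arbitrary pairs. After that every homotopy is the missing face of
    an open box. Homotopy groups are treated cubically because the spheres of the spectrum are
    quotients of cubes; the passage to simplices is made once, in the proof that vanishing homotopy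
    groups allow every extension. *)

Record subcx (D : sset) := Subcx {
  insub_cx :> forall n, D n -> Prop;
  subcx_op : forall m n (s : dmap m n) (x : D n), insub_cx x -> insub_cx (op s x) }.
Arguments insub_cx {D} _ n x.

Definition sim_on (D Z : sset) (A : subcx D) (f : forall n, D n -> Z n) : Prop :=
  forall m n (s : dmap m n) x, A n x -> f m (op s x) = op s (f n x).

(* Maps on a subcomplex are represented by functions on the whole simplicial set
   that are simplicial on the subcomplex; their other values are junk. *)
Definition ext (Z D : sset) (A : subcx D) : Prop :=
  forall f : forall n, D n -> Z n, sim_on A f ->
  exists g : smap D Z, forall n (x : D n), A n x -> g n x = f n x.

Definition sc_union D (A A' : subcx D) : subcx D.
Proof.
refine (@Subcx D (fun n x => A n x \/ A' n x) _).
by move=> m n s x [h|h]; [left|right]; apply: subcx_op.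
Defined.

Program Definition sc_pre D E (f : smap D E) (A : subcx E) : subcx D :=
  @Subcx D (fun n x => A n (f n x)) _.
Next Obligation. by rewrite smap_op; apply: subcx_op. Qed.

Program Definition sc_empty D : subcx D := @Subcx D (fun n x => False) _.
Program Definition sc_all D : subcx D := @Subcx D (fun n x => True) _.

Definition sc_bd n : subcx (simplex n) := Subcx (@nonsurj_op n).
Definition sc_horn n i : subcx (simplex n) := Subcx (@misses_op n i).

Notation Delta1 := (simplex 1).
Definition endp k (e : bool) : dmap k 1 := dcst k (if e then ord_max else ord0).

Lemma endp_op m n (s : dmap m n) e : dcomp (endp n e) s = endp m e.
Proof. exact: dcst_comp. Qed.

Program Definition sc_end (e : bool) : subcx Delta1 := @Subcx Delta1 (fun n t => t = endp n e) _.
Next Obligation. exact: endp_op. Qed.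

Program Definition pfst X Y : smap (sprod X Y) X := @SMap (sprod X Y) X (fun n x => x.1) _.
Program Definition psnd X Y : smap (sprod X Y) Y := @SMap (sprod X Y) Y (fun n x => x.2) _.

(* Not a product: A x Y united with X x C, as in a pushout-product. *)
Definition sc_prod X Y (A : subcx X) (C : subcx Y) : subcx (sprod X Y) :=
  sc_union (sc_pre (pfst X Y) A) (sc_pre (psnd X Y) C).

Lemma sim_on_smap D Z (A : subcx D) (g : smap D Z) : sim_on A g.
Proof. by move=> m n s x _; rewrite smap_op. Qed.

Lemma sim_onW (D Z : sset) (A A' : subcx D) (f : forall n, D n -> Z n) :
  (forall n x, A' n x -> A n x) -> sim_on A f -> sim_on A' f.
Proof. by move=> h sf m n s x /h; apply: sf. Qed.

Lemma sim_on_comp (D Z Z' : sset) (A : subcx D) (f : forall n, D n -> Z n) (g : smap Z Z') :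
  sim_on A f -> sim_on A (fun n x => g n (f n x)).
Proof. by move=> sf m n s x /sf ->; rewrite smap_op. Qed.

Lemma sim_on_pre (D E Z : sset) (h : smap D E) (A : subcx E) (f : forall n, E n -> Z n) :
  sim_on A f -> sim_on (sc_pre h A) (fun n x => f n (h n x)).
Proof. by move=> sf m n s x /sf <-; rewrite smap_op. Qed.

Lemma glue (D Z : sset) (A A' : subcx D) (f f' : forall n, D n -> Z n) :
  sim_on A f -> sim_on A' f' ->
  (forall n x, A n x -> A' n x -> f n x = f' n x) ->
  exists h, [/\ sim_on (sc_union A A') h, forall n x, A n x -> h n x = f n x
    & forall n x, A' n x -> h n x = f' n x].
Proof.
move=> sf sf' ff'.
pose h n (x : D n) := if pselect (A n x) is left _ then f n x else f' n x.
have hA n x : A n x -> h n x = f n x by rewrite /h; case: pselect.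
have hA' n x : A' n x -> h n x = f' n x.
  by rewrite /h; case: pselect => // a a'; apply: ff'.
exists h; split=> // m n s x [a|a].
  by rewrite !hA //; [apply: sf|apply: subcx_op].
by rewrite !hA' //; [apply: sf'|apply: subcx_op].
Qed.

Definition sc_im (J : Type) (D Q : sset) (u : J -> smap Q D) : subcx D.
Proof.
refine (@Subcx D (fun n x => exists j q, x = u j n q) _).
by move=> m n s x [j [q ->]]; exists j, (op s q); rewrite smap_op.
Defined.

(** All cells [u j] are glued to [A] at once. Injectivity is asked only off [A], since inside [A]
    the values are dictated by [f]. *)
Lemma attach (J : Type) (Q D Z : sset) (A : subcx D) (u : J -> smap Q D)
    (f : forall n, D n -> Z n) (g : J -> smap Q Z) :
  sim_on A f ->
  (forall j n q, A n (u j n q) -> g j n q = f n (u j n q)) ->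
  (forall n j q j' q', u j n q = u j' n q' -> ~ A n (u j n q) -> j = j' /\ q = q') ->
  exists h : forall n, D n -> Z n, [/\ sim_on (sc_union A (sc_im u)) h,
    forall n x, A n x -> h n x = f n x
    & forall j n q, h n (u j n q) = g j n q].
Proof.
move=> sf fg inj.
pose f' n (x : D n) : Z n :=
  if pselect (exists jq : J * Q n, x = u jq.1 n jq.2) is left e then
    g (sval (cid e)).1 n (sval (cid e)).2 else f n x.
pose h n (x : D n) := if pselect (A n x) is left _ then f n x else f' n x.
have hA n x : A n x -> h n x = f n x by rewrite /h; case: pselect.
have hu j n q : h n (u j n q) = g j n q.
  rewrite /h; case: pselect => [a|na]; first by rewrite fg.
  rewrite /f'; case: pselect => [e|[]]; last by exists (j, q).
  by case: (cid e) => -[j' q'] /= e'; case: (inj _ _ _ _ _ e' na) => <- <-.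
exists h; split=> // m n s x [a|[j [q ->]]].
  by rewrite !hA //; [apply: sf|apply: subcx_op].
by rewrite -smap_op !hu smap_op.
Qed.

(** * Degeneracies *)

Lemma dmk_fun m n f fP i : @dmk m n f fP i = f i.
Proof. exact: ffunE. Qed.

Lemma dmap0_surj k (s : dmap k 0) : ~ nonsurj s.
Proof. by case=> j /(_ ord0); rewrite (ord1 j) (ord1 (s _)). Qed.

Lemma surj_of n k (s : dmap k n) : ~ nonsurj s -> forall j, exists i, s i = j.
Proof.
move=> ns j; apply: contrapT => h; apply: ns; exists j => i e; apply: h; by exists i.
Qed.


Lemma incr_le m n (f : 'I_m.+1 -> 'I_n.+1) :
  (forall i j : 'I_m.+1, i < j -> f i < f j) -> forall i : 'I_m.+1, i <= f i.
Proof.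
move=> fP [i]; elim: i => // i IH im /=.
have im' : i < m.+1 by apply: ltnW.
exact: leq_ltn_trans (IH im') (fP (Ordinal im') (Ordinal im) (ltnSn _)).
Qed.

Lemma incr_ge n (f : 'I_n.+1 -> 'I_n.+1) :
  (forall i j : 'I_n.+1, i < j -> f i < f j) -> forall i : 'I_n.+1, f i <= i.
Proof.
move=> fP i; pose g a := rev_ord (f (rev_ord a)).
have H (a b : 'I_n.+1) : a < b -> g a < g b.
  move=> ab; have := fP (rev_ord b) (rev_ord a); rewrite /=.
  have := ltn_ord (f (rev_ord a)); have := ltn_ord (f (rev_ord b)).
  by have := ltn_ord a; have := ltn_ord b; lia.
have := incr_le H (rev_ord i); rewrite /g rev_ordK /=.
by have := ltn_ord (f i); have := ltn_ord i; lia.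
Qed.

Lemma dmap_lt k n (s : dmap k n) i j : s i < s j -> i < j.
Proof. by move=> h; rewrite ltnNge; apply/negP => /(dmap_mono s); lia. Qed.

Lemma surj_id n (s : dmap n n) : ~ nonsurj s -> s = did n.
Proof.
move=> /surj_of sP; have [d dP] := choice sP.
have dlt (i j : 'I_n.+1) : i < j -> d i < d j by move=> ij; apply: (@dmap_lt _ _ s); rewrite !dP.
have did_ i : d i = i.
  by apply/val_inj/eqP; rewrite eqn_leq incr_ge ?incr_le.
by apply: dmapP => i; rewrite didE -{1}(did_ i) dP.
Qed.

(** The freedom to pass through a chosen [i] is what lets [degeneracy_inj] compare two maps point by
    point. *)
Lemma surj_section n k (s : dmap k n) i :
  ~ nonsurj s -> exists d : dmap n k, dcomp s d = did n /\ d (s i) = i.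
Proof.
move=> /surj_of sP; have [d dP] := choice sP.
pose d' j := if j == s i then i else d j.
have d'P j : s (d' j) = j by rewrite /d'; case: eqP => [->|].
have mono (a b : 'I_n.+1) : a <= b -> d' a <= d' b.
  rewrite leq_eqVlt => /orP[/eqP/val_inj -> //|ab].
  by apply/ltnW/(@dmap_lt _ _ s); rewrite !d'P.
exists (dmk mono); split; last by rewrite dmk_fun /d' eqxx.
by apply: dmapP => j; rewrite dcompE dmk_fun d'P didE.
Qed.

Lemma nonsurj_factor n k (s : dmap k n.+1) : nonsurj s ->
  exists (d : dmap n n.+1) (r : dmap k n), s = dcomp d r.
Proof.
case=> j sj.
have dP (a b : 'I_n.+1) : a <= b -> lift j a <= lift j b by rewrite /= leq_bump2.
have rP (a : 'I_k.+1) : exists b, lift j b = s a.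
  have ne : j != s a by apply/eqP => e; apply: (sj a).
  by case: (unlift_some ne) => b eb _; exists b.
have [r rE] := choice rP.
have rmono (a b : 'I_k.+1) : a <= b -> r a <= r b.
  by move/(dmap_mono s); rewrite -!rE /= leq_bump2.
exists (dmk dP), (dmk rmono).
by apply: dmapP => a; rewrite dcompE !dmk_fun rE.
Qed.

(** The uniqueness half of the Eilenberg-Zilber lemma. If [d] is a section of [s] through [i], then
    [dcomp s' d] fixes [x], so it is surjective, hence the identity, and [s' i = s i]. *)
Lemma degeneracy_inj (X : sset) n k (s s' : dmap k n) (x : X n) :
  (forall (d : dmap n n), nonsurj d -> op d x <> x) ->
  ~ nonsurj s -> op s x = op s' x -> s = s'.
Proof.
move=> nd ss e; apply: dmapP => i.
have [d [sd di]] := surj_section i ss.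
have : op (dcomp s' d) x = x by rewrite op_comp -e -op_comp sd op_id.
have [ns|/surj_id e'] := pselect (nonsurj (dcomp s' d)); first by move=> /(nd _ ns).
by move=> _; rewrite -{2}di -dcompE e' didE.
Qed.

(** The index is shifted by one from the usual skeleton, so that [skel B 0] is empty and the step at
    [n] attaches the [n]-cells. *)
Definition skel (B : sset) (N : nat) : subcx B.
Proof.
refine (@Subcx B (fun n x => exists k (y : B k) (s : dmap n k), k < N /\ x = op s y) _).
by move=> m n s x [k [y [r [kN ->]]]]; exists k, y, (dcomp r s); rewrite op_comp.
Defined.

Lemma nonsurj_skel (B : sset) n k (s : dmap k n) (y : B n) :
  nonsurj s -> skel B n k (op s y).
Proof.
case: n s y => [|n] s y; first by move/dmap0_surj.
by case/nonsurj_factor => d [r ->]; exists n, (op d y), r; rewrite op_comp.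
Qed.

Program Definition yoneda (B : sset) n (y : B n) : smap (simplex n) B :=
  @SMap (simplex n) B (fun k s => op s y) _.
Next Obligation. exact: op_comp. Qed.

Program Definition smap_prod X X' Y Y' (f : smap X X') (g : smap Y Y') :
    smap (sprod X Y) (sprod X' Y') :=
  @SMap (sprod X Y) (sprod X' Y') (fun n x => (f n x.1, g n x.2)) _.
Next Obligation. by rewrite !smap_op. Qed.

(** * Extension cell by cell, relative to a fixed second factor *)

Section Cells.
Variables (Z Q : sset) (Q0 : subcx Q).
Hypothesis ext_bd : forall n, ext Z (sc_prod (sc_bd n) Q0).
Variables (B : sset) (A : subcx B).

Let stage n : subcx (sprod B Q) := sc_prod (sc_union A (skel B n)) Q0.

(** [J] consists of the nondegenerate [n]-simplices outside [A]. Their boundaries lie in the stage,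
    so [ext_bd] extends over each of them, and Eilenberg-Zilber makes the attachment free. *)
Lemma ext_cells_step n (f : forall k, sprod B Q k -> Z k) : sim_on (stage n) f ->
  exists f' : forall k, sprod B Q k -> Z k,
    sim_on (stage n.+1) f' /\ forall k x, stage n k x -> f' k x = f k x.
Proof.
move=> sf; pose J := {y : B n | ~ sc_union A (skel B n) n y}.
pose u (y : J) := smap_prod (yoneda (sval y)) (sid Q).
(* A section of a surjective [s] would carry [op s y] back to [y] inside the stage. *)
have uP (y : J) k (s : dmap k n) : sc_union A (skel B n) k (op s (sval y)) -> nonsurj s.
  move=> h; apply: contrapT => /(surj_section ord0) [d [sd _]].
  by apply: (svalP y); rewrite -(op_id (sval y)) -sd op_comp; apply: subcx_op.
have gP (y : J) : exists g : smap (sprod (simplex n) Q) Z,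
    forall k x, sc_prod (sc_bd n) Q0 k x -> g k x = f k (u y k x).
  apply: (ext_bd (f := fun k x => f k (u y k x))) => m k s [t q] h.
  rewrite smap_op; apply: sf; case: h => h; [left|by right].
  by right; exact: nonsurj_skel.
have [g gE] := choice gP.
have fg y k q : stage n k (u y k q) -> g y k q = f k (u y k q).
  case: q => s q [h|h]; rewrite gE //; [left|by right].
  exact: uP h.
have inj k y q y' q' : u y k q = u y' k q' -> ~ stage n k (u y k q) -> y = y' /\ q = q'.
  case: q q' => s q [s' q'] /= [e eq] h.
  have {h} [ns ns'] : ~ nonsurj s /\ ~ nonsurj s'.
    split=> [|] h'; apply: h; left; right => /=; first exact: nonsurj_skel.
    by rewrite e; apply: nonsurj_skel.
  subst q'; case: y y' e => y yP [y' y'P] /= e.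
  have ey : y = y'.
    have [d [sd _]] := surj_section ord0 ns.
    have [h|/surj_id h] := pselect (nonsurj (dcomp s' d)).
      case: yP; right; rewrite -(op_id y) -sd op_comp e -op_comp; exact: nonsurj_skel.
    by rewrite -(op_id y) -sd op_comp e -op_comp h op_id.
  subst y'; split; first exact: eq_exist.
  congr pair; apply: degeneracy_inj ns e => d nd ed.
  by case: yP; right; rewrite -ed; apply: nonsurj_skel.
have [f' [sf' f'A f'u]] := attach sf fg inj; exists f'; split=> // m k s [y q] h; apply: sf'.
case: h => [[h|[k' [y' [r [k'n e]]]]]|h]; [by left; left; left| |by left; right].
move: k'n; rewrite ltnS leq_eqVlt => /orP[/eqP e'|k'n]; last first.
  by left; left; right; exists k', y', r.
subst k'; have [h|h] := pselect (sc_union A (skel B n) n y').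
  left; left; move: e => /= ->; exact: (@subcx_op _ (sc_union A (skel B n))).
right; exists (exist _ y' h), (r, q); congr pair; exact: e.
Qed.

(** No colimit is formed: the value on a [k]-simplex is read off at stage [k.+1], which contains all
    [k]-simplices, and later stages do not change it. *)
Lemma ext_cells : ext Z (sc_prod A Q0).
Proof.
move=> f sf.
pose T n := {f : forall k, sprod B Q k -> Z k | sim_on (stage n) f}.
have step n (t : T n) : {t' : T n.+1 | forall k x, stage n k x -> sval t' k x = sval t k x}.
  apply: cid; have [f' [sf' e]] := ext_cells_step (svalP t).
  by exists (exist _ f' sf').
have sf0 : sim_on (stage 0) f.
  apply: sim_onW sf => n x [[h|[k [y [s []]]]]|h] //; [by left|by right].
pose F := fix F n : T n := if n is m.+1 then sval (step m (F m)) else exist _ f sf0.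
have FS n k x : stage n k x -> sval (F n.+1) k x = sval (F n) k x.
  by move=> h /=; case: (step n (F n)) => t /= ->.
have stageW n m k (x : sprod B Q k) : n <= m -> stage n k x -> stage m k x.
  move=> nm [[h|[k' [y [s [k'n e]]]]]|h]; [by left; left| |by right].
  by left; right; exists k', y, s; split=> //; exact: leq_trans nm.
have Fle n m k x : n <= m -> stage n k x -> sval (F m) k x = sval (F n) k x.
  move=> /subnKC <- h; elim: (m - n) => [|d IH]; first by rewrite addn0.
  by rewrite addnS FS ?IH //; apply: stageW h; exact: leq_addr.
have top k N x : k < N -> stage N k x.
  by move=> kN; left; right; exists k, x.1, (did k); rewrite op_id.
have sm m n (s : dmap m n) (x : sprod B Q n) :
    sval (F m.+1) m (op s x) = op s (sval (F n.+1) n x).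
  have hm : m.+1 <= maxn m n + 1 by lia.
  have hn : n.+1 <= maxn m n + 1 by lia.
  rewrite -(Fle _ _ _ _ hm (top _ _ _ _)) // -(Fle _ _ _ _ hn (top _ _ x _)) //.
  by apply: (svalP (F _)); apply: top; lia.
exists (SMap sm) => n x h.
have h0 : stage 0 n x by case: h => h; [left; left|right].
by rewrite [LHS](Fle 0).
Qed.
End Cells.

(** * Homotopy extension *)

Section Prism.
Variable n : nat.

Lemma prism_s_mono i (a b : 'I_n.+2) : a <= b ->
  (inord (if a <= i then minn a n else a.-1) : 'I_n.+1) <=
  (inord (if b <= i then minn b n else b.-1) : 'I_n.+1).
Proof.
move=> ab; have a_n := ltn_ord a; have b_n := ltn_ord b.
by rewrite !inordK; (do ?case: ifP); lia.
Qed.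

Lemma prism_t_mono i (a b : 'I_n.+2) : a <= b ->
  (if a <= i then ord0 else ord_max : 'I_2) <= (if b <= i then ord0 else ord_max : 'I_2).
Proof. by move=> ab; case: ifP; case: ifP => //=; lia. Qed.

(* The i-th top-dimensional simplex of the prism: (0,0) ... (i,0) (i,1) ... (n,1). *)
Program Definition prism_simplex (i : nat) : smap (simplex n.+1) (sprod (simplex n) Delta1) :=
  @SMap (simplex n.+1) (sprod (simplex n) Delta1)
    (fun k r => (dcomp (dmk (@prism_s_mono i)) r, dcomp (dmk (@prism_t_mono i)) r)) _.
Next Obligation. by rewrite /= !dcompA. Qed.

Lemma prism_sE i k (r : dmap k n.+1) j : i <= n ->
  (prism_simplex i k r).1 j = (if r j <= i then r j : nat else (r j).-1) :> nat.
Proof.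
move=> i_n; rewrite dcompE dmk_fun; have rj := ltn_ord (r j).
by case: ifP => h; rewrite inordK; lia.
Qed.

Lemma prism_tE i k (r : dmap k n.+1) j :
  (prism_simplex i k r).2 j = ~~ (r j <= i) :> nat.
Proof. by rewrite dcompE dmk_fun; case: ifP. Qed.

Lemma dmap_nat m k (s s' : dmap m k) : (forall j, s j = s' j :> nat) -> s = s'.
Proof. by move=> e; apply: dmapP => j; apply/val_inj/e. Qed.

Lemma prism_inj i k (r r' : dmap k n.+1) : i <= n ->
  prism_simplex i k r = prism_simplex i k r' -> r = r'.
Proof.
move=> i_n e; apply: dmap_nat => j.
have := prism_sE r j i_n; rewrite e prism_sE //.
have := prism_tE i r j; rewrite e prism_tE.
by case: (leqP (r j)) => h1; case: (leqP (r' j)) => h2; lia.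
Qed.

Definition in_prism i k (x : sprod (simplex n) Delta1 k) : Prop :=
  forall j, if x.2 j == 0 :> nat then x.1 j <= i else i <= x.1 j.

Lemma in_prismP i k x : i <= n -> in_prism i x -> exists r, x = prism_simplex i k r.
Proof.
case: x => s t i_n h.
(* The preimage is [s + t]: the [i]-th simplex has the vertex (a, 0) in position a and the vertex
   (a, 1) in position a + 1. *)
have mono (a b : 'I_k.+1) : a <= b ->
    (inord (s a + t a) : 'I_n.+2) <= (inord (s b + t b) : 'I_n.+2).
  move=> ab; have sab := dmap_mono s ab; have tab := dmap_mono t ab.
  have sb := ltn_ord (s b); have tb := ltn_ord (t b).
  by rewrite !inordK; lia.
exists (dmk mono); congr pair; apply: dmap_nat => j.
  rewrite prism_sE // dmk_fun; have sj := ltn_ord (s j); have tj := ltn_ord (t j).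
  by have /= := h j; rewrite inordK; (do ?case: eqP); (do ?case: ifP); lia.
rewrite prism_tE // dmk_fun; have sj := ltn_ord (s j); have tj := ltn_ord (t j).
by have /= := h j; rewrite inordK; last lia; case: eqP => h0 h1; case: leqP => h2; lia.
Qed.

Variables (Z : sset).
Hypothesis ZK : Kan Z.

(** One prism simplex is filled by the Kan condition, provided that the part already treated meets
    it exactly in the horn lacking the face opposite [h]. *)
Lemma prism_step i (h : 'I_n.+2) (C : subcx (sprod (simplex n) Delta1)) f : i <= n ->
  (forall k r, C k (prism_simplex i k r) <-> misses h r) ->
  sim_on C f -> exists f' : forall k, sprod (simplex n) Delta1 k -> Z k,
    sim_on (sc_union C (sc_im (fun _ : unit => prism_simplex i))) f' /\
    forall k x, C k x -> f' k x = f k x.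
Proof.
move=> i_n Ch sf.
have sm m k (s : dmap m k) (r : horn h k) :
    f m (prism_simplex i m (sval (op s r))) = op s (f k (prism_simplex i k (sval r))).
  by rewrite [sval _]/= -[dcomp _ _]/(op s (sval r)) smap_op; apply: sf; apply/Ch; case: r.
have [g gE] := ZK (SMap sm).
have [||f' [sf' f'C _]] := attach (u := fun _ : unit => prism_simplex i) (g := fun=> g) sf.
- by move=> _ k r /Ch hr; exact: (gE k (exist _ r hr)).
- by move=> k [] r [] r' /(prism_inj i_n) ->.
by exists f'.
Qed.

Definition sc_prism (P : nat -> Prop) : subcx (sprod (simplex n) Delta1).
Proof.
refine (@Subcx (sprod (simplex n) Delta1) (fun k x => exists i, P i /\ in_prism i x) _).
by move=> i j s x [l [Pl h]]; exists l; split=> // a; rewrite /= !dcompE; apply: h.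
Defined.

Lemma exist_prism k x : exists i, i <= n /\ @in_prism i k x.
Proof.
(* The largest first coordinate on level 0. Vertices on level 1 come later, so their first
   coordinates are at least as large. *)
case: x => s t; exists (\max_(j | t j == 0 :> nat) s j); split.
  by apply/bigmax_leqP => j _; rewrite -ltnS.
move=> j /=; case: eqP => tj; first by apply: (@leq_bigmax_cond _ _ (fun j => nat_of_ord (s j)) j); apply/eqP.
apply/bigmax_leqP => j' /eqP tj'; apply: dmap_mono.
by rewrite leqNgt; apply/negP => /ltnW /(dmap_mono t); lia.
Qed.
End Prism.

Section PrismExt.
Variables (n : nat) (Z : sset).
Hypothesis ZK : Kan Z.

Lemma dmap1_endp k (t : dmap k 1) (e : bool) : (forall j, t j = e :> nat) -> t = endp k e.
Proof. by move=> h; apply: dmap_nat => j; rewrite h dcstE; case: e h. Qed.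

Lemma dmap1_endpP k (t : dmap k 1) (e : bool) j : t = endp k e -> t j = e :> nat.
Proof. by move=> ->; rewrite dcstE; case: e. Qed.

Lemma missesP k (h : 'I_n.+2) (r : dmap k n.+1) :
  misses h r <-> exists m, [/\ m <= n.+1, m <> h & forall l, r l <> m :> nat].
Proof.
split=> [[j [jh rj]]|[m [mn mh rm]]].
  exists j; split; first by rewrite -ltnS.
    by move=> /val_inj.
  by move=> l /val_inj; apply: rj.
exists (Ordinal (mn : m < n.+2)); split; first by move/(congr1 val).
by move=> l /(congr1 val); apply: rm.
Qed.

Lemma nonsurjP m k (s : dmap k m) : nonsurj s <-> exists i, i <= m /\ forall l, s l <> i :> nat.
Proof.
split=> [[j sj]|[i [i_m sj]]].
  by exists j; split=> [|l /val_inj]; [rewrite -ltnS|apply: sj].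
by exists (Ordinal (i_m : i < m.+1)) => l /(congr1 val); apply: sj.
Qed.

Let base e := sc_prod (sc_bd n) (sc_end e).
Let stage e P := sc_union (base e) (sc_prism n P).


(** From the end [false] the prism is filled downwards from [i = n]. The face opposite [i.+1] is
    shared with the next simplex, or is the end itself when [i = n]; the faces other than those
    opposite [i] and [i.+1] lie over the boundary. Only the face opposite [i] is new. *)
Lemma prism_last i k (r : dmap k n.+1) : i <= n ->
  stage false (fun i' => i < i' <= n) k (prism_simplex n i k r) <->
  misses (inord i : 'I_n.+2) r.
Proof.
move=> i_n; rewrite missesP inordK; last by lia.
set x := prism_simplex n i k r.
have sE l : x.1 l = (if r l <= i then r l : nat else (r l).-1) :> nat by exact: prism_sE.
have tE l : x.2 l = ~~ (r l <= i) :> nat by exact: prism_tE.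
split=> [[[/nonsurjP[j [j_n sj]]|t0]|[i' [ii' h]]]|[m [m_n mi rm]]].
- exists (if j < i then j else j.+1); split; [by case: ltnP; lia|by case: ltnP; lia|].
  move=> l; have := sj l; change (x.1 l <> j :> nat -> r l <> (if j < i then j else j.+1) :> nat).
  by rewrite sE; case: (leqP (r l)) => ?; case: ltnP; lia.
- exists i.+1; split; [lia|lia|] => l.
  by have := dmap1_endpP l t0; have := tE l; case: leqP; rewrite /=; lia.
- exists i.+1; split; [lia|lia|] => l.
  by have := h l; rewrite tE sE; case: (leqP (r l) i) => /=; lia.
have [m_i|] := ltnP m i.+1.
  left; left; apply/nonsurjP; exists m; split=> [|l]; first lia.
  by have := rm l; have := sE l; rewrite /=; case: leqP; lia.
rewrite leq_eqVlt => /orP[/eqP e|im]; last first.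
  left; left; apply/nonsurjP; exists m.-1; split=> [|l]; first lia.
  by have := rm l; have := sE l; rewrite /=; case: leqP; lia.
have [i_n'|n_i] := ltnP i n.
  right; exists i.+1; split=> [|l]; first lia.
  by have := rm l; rewrite tE sE; case: (leqP (r l) i) => /=; lia.
left; right; apply: dmap1_endp => l; have := rm l; have := tE l.
by have := ltn_ord (r l); rewrite /=; case: leqP; lia.
Qed.

(** The mirror image: from the end [true] the prism is filled upwards from [i = 0], with the face
    opposite [i] already present and the one opposite [i.+1] new. *)
Lemma prism_first i k (r : dmap k n.+1) : i <= n ->
  stage true (fun i' => i' < i) k (prism_simplex n i k r) <->
  misses (inord i.+1 : 'I_n.+2) r.
Proof.
move=> i_n; rewrite missesP inordK; last by lia.
set x := prism_simplex n i k r.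
have sE l : x.1 l = (if r l <= i then r l : nat else (r l).-1) :> nat by exact: prism_sE.
have tE l : x.2 l = ~~ (r l <= i) :> nat by exact: prism_tE.
split=> [[[/nonsurjP[j [j_n sj]]|t0]|[i' [ii' h]]]|[m [m_n mi rm]]].
- exists (if j <= i then j else j.+1); split; [by case: (leqP j i); lia|by case: (leqP j i); lia|].
  move=> l; have := sj l; change (x.1 l <> j :> nat -> r l <> (if j <= i then j else j.+1) :> nat).
  by rewrite sE; case: (leqP (r l)) => ?; case: (leqP j i); lia.
- exists i; split; [lia|lia|] => l.
  by have := dmap1_endpP l t0; have := tE l; case: leqP; rewrite /=; lia.
- exists i; split; [lia|lia|] => l.
  by have := h l; rewrite tE sE; case: (leqP (r l) i) => /=; lia.
have [i_m|] := ltnP i m.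
  left; left; apply/nonsurjP; exists m.-1; split=> [|l]; first lia.
  by have := rm l; have := sE l; rewrite /=; case: leqP; lia.
rewrite leq_eqVlt => /orP[/eqP e|im]; last first.
  left; left; apply/nonsurjP; exists m; split=> [|l]; first lia.
  by have := rm l; have := sE l; rewrite /=; case: leqP; lia.
have [i_gt|i_0] := ltnP 0 i.
  right; exists i.-1; split=> [|l]; first lia.
  by have := rm l; rewrite tE sE; case: (leqP (r l) i) => /=; lia.
left; right; apply: dmap1_endp => l; have := rm l; have := tE l.
by rewrite /=; case: leqP; lia.
Qed.

Lemma prism_all e (P : nat -> Prop) k (x : sprod (simplex n) Delta1 k) :
  (forall i, i <= n -> P i) -> stage e P k x.
Proof. by move=> h; right; have [i [i_n hi]] := exist_prism x; exists i; split=> //; apply: h. Qed.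

Lemma prism_succ e i (P P' : nat -> Prop) k x : i <= n ->
  (forall j, P' j -> j = i \/ P j) -> stage e P' k x ->
  sc_union (stage e P) (sc_im (fun _ : unit => prism_simplex n i)) k x.
Proof.
move=> i_n PP' [h|[j [/PP'[->|Pj] hj]]]; first by left; left.
  by right; exists tt; apply: in_prismP.
by left; right; exists j.
Qed.

Lemma ext_prism e : ext Z (base e).
Proof.
move=> f sf.
suff [f' sf' f'f] : exists2 f' : forall k, sprod (simplex n) Delta1 k -> Z k,
    sim_on (stage e (fun i => i <= n)) f' & forall k x, base e k x -> f' k x = f k x.
  have sm m k (s : dmap m k) x : f' m (op s x) = op s (f' k x).
    by apply: sf'; apply: prism_all.
  by exists (SMap sm).
case: e f sf => f sf.
  suff H N : N <= n.+1 -> exists2 f' : forall k, sprod (simplex n) Delta1 k -> Z k,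
      sim_on (stage true (fun i => i < N)) f' & forall k x, base true k x -> f' k x = f k x.
    exact: H n.+1 (leqnn _).
  elim: N => [|N IH] Nn.
    by exists f => //; apply: sim_onW sf => k x [|[i []]].
  have [f1 sf1 f1f] := IH (ltnW Nn); have {}Nn : N <= n by [].
  have [f2 [sf2 f2f]] := prism_step ZK Nn (fun k r => prism_first r Nn) sf1.
  exists f2 => [|k x h]; last by rewrite f2f ?f1f //; left.
  by apply: sim_onW sf2 => k x; apply: prism_succ => // j; lia.
suff H N : N <= n.+1 -> exists2 f' : forall k, sprod (simplex n) Delta1 k -> Z k,
    sim_on (stage false (fun i => n.+1 - N <= i <= n)) f' &
    forall k x, base false k x -> f' k x = f k x.
  have [f' sf' f'f] := H n.+1 (leqnn _); exists f' => //.
  by apply: sim_onW sf' => k x _; apply: prism_all => i; lia.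
elim: N => [|N IH] Nn.
  by exists f => //; apply: sim_onW sf => k x [|[i []]] //; lia.
have [f1 sf1 f1f] := IH (ltnW Nn); have Nn' : n - N <= n by lia.
have sf1' : sim_on (stage false (fun i' => n - N < i' <= n)) f1.
  by apply: sim_onW sf1 => k x [|[i [ii hi]]]; [left|right; exists i; split=> //; lia].
have [f2 [sf2 f2f]] := prism_step ZK Nn' (fun k r => prism_last r Nn') sf1'.
exists f2 => [|k x h]; last by rewrite f2f ?f1f //; left.
by apply: sim_onW sf2 => k x; apply: prism_succ => // j; lia.
Qed.
End PrismExt.

(* The homotopy extension property. *)
Definition hep (Z : sset) : Prop :=
  forall (B : sset) (A : subcx B) e, ext Z (sc_prod A (sc_end e)).

Lemma Kan_hep Z : Kan Z -> hep Z.
Proof. by move=> ZK B A e; apply: ext_cells => n; apply: ext_prism. Qed.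

(** * Relative homotopies and weak equivalences *)

Definition sc_ends : subcx Delta1 := sc_union (sc_end false) (sc_end true).

Lemma endp_neq k : endp k false <> endp k true.
Proof. by move/(congr1 (fun t : dmap k 1 => val (t ord0))); rewrite /= !dcstE. Qed.

Definition to_fst_fst B : smap (sprod (sprod B Delta1) Delta1) B :=
  scomp (pfst B Delta1) (pfst _ Delta1).

Section Box.
Variable Z : sset.
Hypothesis ZH : hep Z.
Variables (B : sset) (A : subcx B).

(* Fills B x s x t from the face t = e, the faces s = 0 and s = 1, and A x s x t. *)
Lemma box (e : bool) (c l r : smap (sprod B Delta1) Z)
    (a : forall n, sprod (sprod B Delta1) Delta1 n -> Z n) :
  sim_on (sc_pre (to_fst_fst B) A) a ->
  (forall n b, c n (b, endp n false) = l n (b, endp n e)) ->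
  (forall n b, c n (b, endp n true) = r n (b, endp n e)) ->
  (forall n b s, A n b -> a n ((b, s), endp n e) = c n (b, s)) ->
  (forall n b t, A n b -> a n ((b, endp n false), t) = l n (b, t)) ->
  (forall n b t, A n b -> a n ((b, endp n true), t) = r n (b, t)) ->
  exists G : smap (sprod (sprod B Delta1) Delta1) Z,
    [/\ forall n b s, G n ((b, s), endp n e) = c n (b, s),
        forall n b t, G n ((b, endp n false), t) = l n (b, t),
        forall n b t, G n ((b, endp n true), t) = r n (b, t)
      & forall n b s t, A n b -> G n ((b, s), t) = a n ((b, s), t)].
Proof.
move=> sa cl cr ac al ar.
pose D := sprod (sprod B Delta1) Delta1.
pose lr : smap D (sprod B Delta1) := smap_prod (pfst B Delta1) (sid Delta1).
pose sv : smap D Delta1 := scomp (psnd B Delta1) (pfst _ Delta1).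
have [f1 [s1 f1l f1r]] := @glue D Z (sc_pre sv (sc_end false)) (sc_pre sv (sc_end true))
  (fun n x => l n (lr n x)) (fun n x => r n (lr n x))
  (@sim_on_smap _ _ _ (scomp l lr)) (@sim_on_smap _ _ _ (scomp r lr))
  (fun n x e0 e1 => False_ind _ (endp_neq (etrans (esym e0) e1))).
have e12 n (x : D n) : sc_pre (to_fst_fst B) A n x ->
    sc_union (sc_pre sv (sc_end false)) (sc_pre sv (sc_end true)) n x -> a n x = f1 n x.
  case: x => [[b s] t] /= Ab [] es; rewrite /= in es; subst s.
    by rewrite f1l // al.
  by rewrite f1r // ar.
have [f2 [s2 f2a f2b]] := glue sa s1 e12.
have e23 n (x : D n) : sc_union (sc_pre (to_fst_fst B) A)
      (sc_union (sc_pre sv (sc_end false)) (sc_pre sv (sc_end true))) n x ->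
    sc_pre (psnd _ Delta1) (sc_end e) n x -> f2 n x = scomp c (pfst _ Delta1) n x.
  case: x => [[b s] t] /= + et; rewrite /= in et; subst t.
  case=> [Ab|es]; first by rewrite f2a // ac.
  rewrite f2b //; case: es => /= es; rewrite /= in es; subst s.
    by rewrite f1l // -cl.
  by rewrite f1r // -cr.
have [f3 [s3 f3a f3b]] := glue s2 (@sim_on_smap _ _ _ (scomp c (pfst _ Delta1))) e23.
(* The glued data form a single homotopy extension problem in the direction t, for B x s relative to
   [A] and both ends of s. *)
have [G GE] : exists G : smap D Z, forall n x,
   sc_prod (sc_prod A sc_ends) (sc_end e) n x -> G n x = f3 n x.
  apply: ZH; apply: sim_onW s3 => n x [[h|h]|h]; [left; left|left; right|right] => //.
exists G; split=> [n b s|n b t|n b t|n b s t Ab].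
- by rewrite GE ?f3b //; right.
- by rewrite GE; [rewrite f3a; [rewrite f2b; [rewrite f1l|left]|right; left]|left; right; left].
- by rewrite GE; [rewrite f3a; [rewrite f2b; [rewrite f1r|right]|right; right]|left; right; right].
by rewrite GE; [rewrite f3a; [rewrite f2a|left]|left; left].
Qed.
End Box.

Program Definition at_end (B : sset) (e : bool) : smap B (sprod B Delta1) :=
  @SMap B (sprod B Delta1) (fun n b => (b, endp n e)) _.
Next Obligation. by rewrite /= endp_op. Qed.

Definition hrel B Z (A : subcx B) (u v : smap B Z) : Prop :=
  exists h : smap (sprod B Delta1) Z,
    [/\ forall n b, h n (b, endp n false) = u n b, forall n b, h n (b, endp n true) = v n b
      & forall n b t, A n b -> h n (b, t) = u n b].

Lemma hrel_refl B Z (A : subcx B) (u : smap B Z) : hrel A u u.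
Proof. by exists (scomp u (pfst _ _)); split. Qed.

Lemma hrel_post B Z Z' (A : subcx B) (u v : smap B Z) (F : smap Z Z') :
  hrel A u v -> hrel A (scomp F u) (scomp F v).
Proof.
case=> h [h0 h1 hA]; exists (scomp F h).
by split=> [n b|n b|n b t Ab] /=; rewrite ?h0 ?h1 ?hA.
Qed.

Section HepCalculus.
Variable Z : sset.
Hypothesis ZH : hep Z.

Lemma hep_ext B (A : subcx B) e (z : smap B Z) (h : forall n, sprod B Delta1 n -> Z n) :
  sim_on (sc_pre (pfst B Delta1) A) h ->
  (forall n b, A n b -> h n (b, endp n e) = z n b) ->
  exists H : smap (sprod B Delta1) Z,
    (forall n b, H n (b, endp n e) = z n b) /\
    (forall n b t, A n b -> H n (b, t) = h n (b, t)).
Proof.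
move=> sh hz.
have agree n (x : sprod B Delta1 n) : sc_pre (pfst B Delta1) A n x ->
    sc_pre (psnd B Delta1) (sc_end e) n x -> h n x = scomp z (pfst _ _) n x.
  by case: x => b t /= Ab et; rewrite /= in et; subst t; rewrite hz.
have [f [sf fh fz]] := glue sh (@sim_on_smap _ _ _ (scomp z (pfst _ _))) agree.
have [H HE] := ZH sf; exists H; split=> [n b|n b t Ab].
  by rewrite HE ?fz //; right.
by rewrite HE ?fh //; left.
Qed.

(** The open box has bottom [m], a constant left side and right side [k]; its top is the
    composite. *)
Lemma hrel_trans B (A : subcx B) (u v w : smap B Z) :
  hrel A u v -> hrel A v w -> hrel A u w.
Proof.
move=> [m [m0 m1 mA]] [k [k0 k1 kA]].
have uv n b : A n b -> u n b = v n b by move=> Ab; rewrite -m1 mA.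
have [||||||G [G0 Gl Gr Ga]] := @box Z ZH B A false m (scomp u (pfst _ _)) k
  (fun n x => u n x.1.1).
- by move=> i j s x _; rewrite -smap_op.
- by move=> n b; rewrite m0.
- by move=> n b; rewrite m1 k0.
- by move=> n b s Ab; rewrite mA.
- by [].
- by move=> n b t Ab; rewrite kA ?uv.
exists (scomp G (at_end _ true)); split=> [n b|n b|n b t Ab] /=.
- by rewrite Gl.
- by rewrite Gr k1.
- by rewrite Ga.
Qed.

(** Here the bottom and the right side are constant at [u] and the left side is [h], so the top runs
    backwards. *)
Lemma hrel_sym B (A : subcx B) (u v : smap B Z) : hrel A u v -> hrel A v u.
Proof.
move=> [h [h0 h1 hA]].
have uv n b : A n b -> u n b = v n b by move=> Ab; rewrite -h1 hA.
have [||||||G [G0 Gl Gr Ga]] := @box Z ZH B A false (scomp u (pfst _ _)) h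
  (scomp u (pfst _ _)) (fun n x => u n x.1.1).
- by move=> i j s x _; rewrite -smap_op.
- by move=> n b; rewrite h0.
- by [].
- by [].
- by move=> n b t Ab; rewrite hA.
- by [].
exists (scomp G (at_end _ true)); split=> [n b|n b|n b t Ab] /=.
- by rewrite Gl.
- by rewrite Gr.
- by rewrite Ga ?uv.
Qed.
End HepCalculus.

(* A weak homotopy equivalence, in the form of the homotopy extension and lifting
   property. *)
Definition weq W V (F : smap W V) : Prop :=
  forall (B : sset) (A : subcx B) (x : forall n, B n -> W n) (z : smap B V),
  sim_on A x -> (forall n b, A n b -> F n (x n b) = z n b) ->
  exists x' : smap B W,
    (forall n b, A n b -> x' n b = x n b) /\ hrel A (scomp F x') z.

Lemma weq_id W : weq (sid W).
Proof. by move=> B A x z sx xz; exists z; split=> [n b /xz //|]; apply: hrel_refl. Qed.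

(** The target [z] is moved along [D] on [A] until it is compatible with [F], and lifted there. A
    box with sides [D x'] and [H] then carries the resulting homotopy [k] back to [F']. *)
Lemma weq_homotopic W V (F F' : smap W V) : hep V -> homotopic F' F -> weq F -> weq F'.
Proof.
move=> VH [D [D0 D1]] wF B A x z sx xz.
have [||H [H0 HA]] := hep_ext VH (A := A) (e := false) (z := z)
  (h := fun n bt => D n (x n bt.1, bt.2)).
- by move=> m n s [b t] /sx /= e; rewrite -smap_op /= e.
- by move=> n b Ab; rewrite D0 xz.
have [|x' [x'x [k [k0 k1 kA]]]] := wF B A x (scomp H (at_end B true)) sx.
  by move=> n b Ab; rewrite /= HA // D1.
pose Dx' := scomp D (smap_prod x' (sid Delta1)).
have [||||||G [Gc Gl Gr Ga]] := @box V VH B A true k Dx' H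
  (fun n y => D n (x n y.1.1, y.2)).
- by move=> m n s [[b s'] t] /sx /= e; rewrite -smap_op /= e.
- by move=> n b; rewrite k0 /= D1.
- by move=> n b; rewrite k1.
- by move=> n b s Ab; rewrite kA // D1 /= x'x.
- by move=> n b t Ab; rewrite /= x'x.
- by move=> n b t Ab; rewrite HA.
exists x'; split=> //; exists (scomp G (at_end _ false)); split=> [n b|n b|n b t Ab] /=.
- by rewrite Gl /= D0.
- by rewrite Gr H0.
- by rewrite Ga // D0 x'x.
Qed.

Lemma ends_glue B (Z : sset) (A : subcx B) (u v : smap B Z) :
  (forall n b, A n b -> u n b = v n b) ->
  exists y : forall n, sprod B Delta1 n -> Z n,
    [/\ sim_on (sc_prod A sc_ends) y, forall n b, y n (b, endp n false) = u n b,
        forall n b, y n (b, endp n true) = v n b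
      & forall n b t, A n b -> y n (b, t) = u n b].
Proof.
move=> uv.
pose y n (x : sprod B Delta1 n) := if pselect (x.2 = endp n false) is left _ then u n x.1 else v n x.1.
have y0 n b : y n (b, endp n false) = u n b by rewrite /y; case: pselect.
have y1 n b : y n (b, endp n true) = v n b.
  by rewrite /y; case: pselect => // /esym /endp_neq.
have yA n b t : A n b -> y n (b, t) = u n b.
  by move=> Ab; rewrite /y; case: pselect => //= _; rewrite uv.
exists y; split=> // m n s [b t] [/= Ab|[] /= et].
- by rewrite !yA ?smap_op //; apply: subcx_op.
- by rewrite /= in et; subst t; rewrite endp_op !y0 smap_op.
- by rewrite /= in et; subst t; rewrite endp_op !y1 smap_op.
Qed.

Lemma hrel_intro B (Z : sset) (A : subcx B) (u v : smap B Z)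
    (y : forall n, sprod B Delta1 n -> Z n) (h : smap (sprod B Delta1) Z) :
  (forall n b, y n (b, endp n false) = u n b) ->
  (forall n b, y n (b, endp n true) = v n b) ->
  (forall n b t, A n b -> y n (b, t) = u n b) ->
  (forall n x, sc_prod A sc_ends n x -> h n x = y n x) -> hrel A u v.
Proof.
move=> y0 y1 yA hy; exists h; split=> [n b|n b|n b t Ab].
- by rewrite hy ?y0 //; right; left.
- by rewrite hy ?y1 //; right; right.
- by rewrite hy ?yA //; left.
Qed.

Lemma ext_hrel B (Z : sset) (A : subcx B) (u v : smap B Z) : ext Z (sc_prod A sc_ends) ->
  (forall n b, A n b -> u n b = v n b) -> hrel A u v.
Proof.
move=> ex /ends_glue[y [sy y0 y1 yA]]; have [h hy] := ex y sy.
exact: hrel_intro hy.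
Qed.

(** Weak equivalences reflect relative homotopies: the homotopy is itself lifted, as a map on B x
    Delta^1 prescribed on [A] and at both ends. *)
Lemma weq_hrel W V (F : smap W V) B (A : subcx B) (u v : smap B W) :
  weq F -> (forall n b, A n b -> u n b = v n b) ->
  hrel A (scomp F u) (scomp F v) -> hrel A u v.
Proof.
move=> wF /ends_glue[y [sy y0 y1 yA]] [h [h0 h1 hA]].
have [|y' [y'y _]] := wF _ _ y h sy.
  move=> n [b t] [/= Ab|[] /= et].
  - by rewrite yA // hA.
  - by rewrite /= in et; subst t; rewrite y0 h0.
  - by rewrite /= in et; subst t; rewrite y1 h1.
exact: hrel_intro y'y.
Qed.

(** A lift of [g z] through [g F] gives a homotopy [g F x' ~ g z]; after applying [F] it is
    reflected by [F g] to [F x' ~ z]. *)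
Lemma weq_two_of_six W V (F : smap W V) (g : smap V W) :
  weq (scomp g F) -> weq (scomp F g) -> weq F.
Proof.
move=> wgF wFg B A x z sx xz.
have [|x' [x'x k]] := wgF B A x (scomp g z) sx; first by move=> n b /xz /= ->.
exists x'; split=> //; apply: (weq_hrel wFg).
  by move=> n b Ab; rewrite /= x'x ?xz.
exact: (hrel_post F k).
Qed.

Lemma hequiv_weq W V (F : smap W V) : hep W -> hep V -> hequiv F -> weq F.
Proof.
move=> WH VH [g [gF Fg]]; apply: (weq_two_of_six (g := g)).
  exact: weq_homotopic WH gF (@weq_id W).
exact: weq_homotopic VH Fg (@weq_id V).
Qed.

(** The problem is sent down the square, lifted through [F'] and then [f], and [g] reflects the
    homotopy so obtained. *)
Lemma weq_cancel W V W' V' (F : smap W V) (F' : smap W' V') (f : smap W W') (g : smap V V') :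
  hep V' -> (forall n x, g n (F n x) = F' n (f n x)) ->
  weq F' -> weq f -> weq g -> weq F.
Proof.
move=> V'H gF wF' wf wg B A x z sx xz.
have [||w [wx k]] := wF' B A (fun n b => f n (x n b)) (scomp g z).
- exact: sim_on_comp.
- by move=> n b Ab; rewrite -gF xz.
have [|x' [x'x m]] := wf B A x w sx; first by move=> n b Ab; rewrite wx.
exists x'; split=> //; apply: (weq_hrel wg).
  by move=> n b Ab; rewrite /= x'x ?xz.
have -> : scomp g (scomp F x') = scomp F' (scomp f x') by apply: smapP => n b /=.
exact: (hrel_trans V'H (hrel_post F' m) k).
Qed.

Lemma dmin_mono k (s t : dmap k 1) (i j : 'I_k.+1) : i <= j ->
  (if s i <= t i then s i else t i) <= (if s j <= t j then s j else t j).
Proof.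
move=> ij; have := dmap_mono s ij; have := dmap_mono t ij.
by case: (leqP (s i) (t i)); case: (leqP (s j) (t j)); lia.
Qed.

(** The connection on the interval: with [t] as parameter it contracts [s] to the end [false]. *)
Definition dmin k (s t : dmap k 1) : dmap k 1 := dmk (@dmin_mono k s t).

Program Definition smin : smap (sprod Delta1 Delta1) Delta1 :=
  @SMap (sprod Delta1 Delta1) Delta1 (fun n st => dmin st.1 st.2) _.
Next Obligation. by apply: dmapP => i; rewrite /= !(dmk_fun, dcompE). Qed.

Lemma ord2P (i : 'I_2) : i = ord0 \/ i = ord_max.
Proof. by case: i => -[|[|//]] h; [left|right]; apply: val_inj. Qed.

Lemma dmin0 k (t : dmap k 1) : dmin (endp k false) t = endp k false.
Proof. by apply: dmapP => i; rewrite dmk_fun !dcstE; case: (t i). Qed.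

Lemma dmin0r k (t : dmap k 1) : dmin t (endp k false) = endp k false.
Proof.
by apply: dmapP => i; rewrite dmk_fun !dcstE; case: (ord2P (t i)) => ->.
Qed.

Lemma dmin1 k (t : dmap k 1) : dmin (endp k true) t = t.
Proof.
by apply: dmapP => i; rewrite dmk_fun !dcstE; case: (ord2P (t i)) => ->.
Qed.

Lemma dmin1r k (t : dmap k 1) : dmin t (endp k true) = t.
Proof.
by apply: dmapP => i; rewrite dmk_fun !dcstE; case: (ord2P (t i)) => ->.
Qed.

(** The form that meets a mapping path object: over [A] the path from [F x] to [z] is prescribed by
    [h] instead of being constant. *)
Lemma weq_lift W V (F : smap W V) : hep V -> weq F ->
  forall (B : sset) (A : subcx B) (x : forall n, B n -> W n) (z : smap B V)
    (h : forall n, sprod B Delta1 n -> V n),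
  sim_on A x -> sim_on (sc_pre (pfst B Delta1) A) h ->
  (forall n b, A n b -> h n (b, endp n false) = F n (x n b)) ->
  (forall n b, A n b -> h n (b, endp n true) = z n b) ->
  exists (x' : smap B W) (H : smap (sprod B Delta1) V),
    [/\ forall n b, A n b -> x' n b = x n b,
        forall n b, H n (b, endp n false) = F n (x' n b),
        forall n b, H n (b, endp n true) = z n b
      & forall n b t, A n b -> H n (b, t) = h n (b, t)].
Proof.
move=> VH wF B A x z h sx sh h0 h1.
have [H [H1 HA]] := hep_ext VH sh h1.
have [|x' [x'x [k [k0 k1 kA]]]] := wF B A x (scomp H (at_end B false)) sx.
  by move=> n b Ab; rewrite /= HA // h0.
(* Over [A] the box is [h] at [min(s, t)]: constant on the bottom and the left, and equal to [h] on
   the right and the top. *)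
have [||||||G [Gc Gl Gr Ga]] := @box V VH B A false k (scomp F (scomp x' (pfst _ _))) H
  (fun n y => h n (y.1.1, smin n (y.1.2, y.2))).
- move=> m n s [[b s'] t] Ab /=; rewrite -[dmin (dcomp _ _) _]/(smin m (op s ((s', t) : sprod Delta1 Delta1 n))).
  by rewrite smap_op; apply: (sh m n s (b, _)).
- by move=> n b; rewrite k0.
- by move=> n b; rewrite k1.
- by move=> n b s Ab; rewrite kA //= dmin0r h0 // x'x.
- by move=> n b t Ab; rewrite /= dmin0 h0 // x'x.
- by move=> n b t Ab; rewrite /= dmin1 HA.
exists x', (scomp G (at_end _ true)); split=> // [n b|n b|n b t Ab] /=.
- by rewrite Gl.
- by rewrite Gr.
- by rewrite Ga //= dmin1r.
Qed.

(** * Contractibility from cubical homotopy groups *)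

Lemma ext_iso D D' Z (A : subcx D) (A' : subcx D') (f : smap D D') (g : smap D' D) :
  (forall n x, g n (f n x) = x) ->
  (forall n x, A n x -> A' n (f n x)) -> (forall n y, A' n y -> A n (g n y)) ->
  ext Z A' -> ext Z A.
Proof.
move=> gf AA' A'A ex x sx.
have [|y yE] := ex (fun n d => x n (g n d)).
  by move=> m n s d /A'A h; rewrite smap_op; apply: sx.
by exists (scomp y f) => n d Ad /=; rewrite yE ?gf //; apply: AA'.
Qed.

Definition cpt (Z : sset) (p : Z 0) n : Z n := op (zero_deg n) p.

Lemma op_cpt (Z : sset) (p : Z 0) m n (s : dmap m n) : op s (cpt p n) = cpt p m.
Proof. by rewrite /cpt -op_comp; congr (op _ p); apply: dmap0_eq. Qed.

Program Definition sconst (B Z : sset) (p : Z 0) : smap B Z := @SMap B Z (fun n _ => cpt p n) _.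
Next Obligation. by rewrite op_cpt. Qed.

(** Iterated products, in place of [cube], make the last coordinate available as a homotopy
    parameter; [fromI] and [toI] translate. *)
Fixpoint Icube m : sset := if m is m'.+1 then sprod (Icube m') Delta1 else simplex 0.
Fixpoint Ibd m : subcx (Icube m) :=
  match m with 0 => sc_empty _ | m'.+1 => sc_prod (Ibd m') sc_ends end.
Fixpoint Ibase m : Icube m 0 :=
  match m with 0 => zero_deg 0 | m'.+1 => (Ibase m', endp 0 false) end.

Fixpoint Icontr m n : sprod (Icube m) Delta1 n -> Icube m n :=
  match m with
  | 0 => fun x => x.1
  | m'.+1 => fun x => (@Icontr m' n (x.1.1, x.2), dmin x.1.2 x.2)
  end.

Lemma Icontr_op m k n (s : dmap k n) x : @Icontr m k (op s x) = op s (Icontr x).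
Proof.
elim: m x => // m IH [[c t] u] /=; rewrite -(IH (c, u)); congr pair.
exact: (smap_op smin s (t, u)).
Qed.

Definition Icontr_map m : smap (sprod (Icube m) Delta1) (Icube m) := SMap (@Icontr_op m).

Lemma Icontr1 m n c : @Icontr m n (c, endp n true) = c.
Proof. by elim: m c => // m IH [c t] /=; rewrite IH dmin1r. Qed.

Lemma Icontr0 m n c : @Icontr m n (c, endp n false) = cpt (Ibase m) n.
Proof.
elim: m c => [c|m IH [c t]] /=; first exact: dmap0_eq.
by rewrite IH dmin0r /cpt /= endp_op.
Qed.

Lemma hrel_contr m Z (g : smap (Icube m) Z) :
  hrel (sc_empty _) (sconst (Icube m) (g 0 (Ibase m))) g.
Proof.
exists (scomp g (Icontr_map m)); split=> // n c /=; last by rewrite Icontr1.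
by rewrite Icontr0 /cpt smap_op.
Qed.

Section Contract.
Variables (Z : sset) (p : Z 0).
Hypothesis ZH : hep Z.

(** Homotopy extension gives [g] on the cube, correct on every face but the last, where [b1] is
    wanted. Cubes contract, so [g] is homotopic to the constant [p] by [k]. Carried along [k], [b1]
    becomes constant on the boundary of the face, where [null] applies, and a box undoes [k] with
    the right last face. *)
Lemma Icube_ext_bd :
  (forall m (f : smap (Icube m) Z), (forall n c, Ibd m n c -> f n c = cpt p n) ->
     hrel (Ibd m) f (sconst _ p)) ->
  forall m, ext Z (Ibd m).
Proof.
move=> null [|m] f sf; first by exists (sconst _ p).
pose C := Icube m; pose A := Ibd m; rewrite -/C in f sf *.
have [|g gE] := ZH (A := A) (e := false) (f := f).
  by apply: sim_onW sf => n x [h|h]; [left|right; left].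
have [k [k0 k1 _]] : hrel (sc_empty _) g (sconst _ p).
  apply: (hrel_trans ZH (hrel_sym ZH (hrel_contr (m := m.+1) g))).
  (* In dimension 0 the boundary is empty, so [null] joins any vertex to [p]. *)
  have [//|h [h0 h1 hA]] := null 0 (sconst _ (g 0 (Ibase m.+1))).
  exists (scomp h (smap_prod (sconst _ (did 0 : simplex 0 0)) (sid Delta1))).
  by split=> // n b /=; rewrite ?h0 ?h1.
have b1P i n (s : dmap i n) (c : C n) :
    f i (op s c, endp i true) = op s (f n (c, endp n true)).
  by rewrite -sf /= ?endp_op //; right; right.
pose b1 : smap C Z := SMap b1P.
have [||k' [k'0 k'A]] := hep_ext ZH (A := A) (e := false) (z := b1)
    (h := fun n x => k n ((x.1, endp n true), x.2)).
- by move=> i n s x _; rewrite -smap_op /= endp_op.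
- by move=> n c Ac /=; rewrite k0 gE //; left.
have [th [th0 th1 thA]] : hrel A (sconst _ p) (scomp k' (at_end _ true)).
  by apply: (hrel_sym ZH); apply: null => n c Ac; rewrite /= k'A //= k1.
pose l := scomp k (smap_prod (at_end C false) (sid Delta1)).
have [||||||G [Gc Gl Gr Ga]] := @box Z ZH C A true th l k' (fun n x => k n x).
- exact: sim_on_smap.
- by move=> n c; rewrite th0 /= k1.
- by move=> n c; rewrite th1.
- by move=> n c s Ac; rewrite k1 thA.
- by [].
- by move=> n c t Ac; rewrite k'A.
exists (scomp G (at_end _ false)) => n [c s] [/= Ac|[] /= es].
- by rewrite Ga // k0 gE //; left.
- by rewrite /= in es; subst s; rewrite Gl /= k0 gE //; right.
- by rewrite /= in es; subst s; rewrite Gr k'0.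
Qed.

End Contract.

(** * From boundaries of cubes to boundaries of simplices *)

Section SimplexStep.
Variable n : nat.

Lemma cone_mono k (s : dmap k n.+1) (t : dmap k 1) (i j : 'I_k.+1) : i <= j ->
  (if t i == ord0 then ord0 : 'I_n.+2 else s i) <= (if t j == ord0 then ord0 : 'I_n.+2 else s j).
Proof.
move=> ij; have := dmap_mono s ij; have := dmap_mono t ij.
rewrite -!val_eqE /=; case: (nat_of_ord (t i) =P 0) => //= ti.
by case: (nat_of_ord (t j) =P 0) => //=; lia.
Qed.

(* The contraction of a simplex onto its vertex 0. *)
Program Definition cone : smap (sprod (simplex n.+1) Delta1) (simplex n.+1) :=
  @SMap (sprod (simplex n.+1) Delta1) (simplex n.+1) (fun k st => dmk (@cone_mono k st.1 st.2)) _.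
Next Obligation. by apply: dmapP => i; rewrite /= !(dmk_fun, dcompE). Qed.

Lemma support_mono k (s : dmap k n.+1) (i j : 'I_k.+1) : i <= j ->
  (if s i == ord0 then ord0 : 'I_2 else ord_max) <= (if s j == ord0 then ord0 : 'I_2 else ord_max).
Proof.
move=> ij; have := dmap_mono s ij.
rewrite -!val_eqE /=; case: (nat_of_ord (s i) =P 0) => //= si.
by case: (nat_of_ord (s j) =P 0) => //=; lia.
Qed.

(** The section of [cone] is the graph of this function ([cone_support]); it is the end [false]
    exactly where [s] is the vertex 0. *)
Program Definition support : smap (simplex n.+1) Delta1 :=
  @SMap (simplex n.+1) Delta1 (fun k s => dmk (@support_mono k s)) _.
Next Obligation. by apply: dmapP => i; rewrite /= !(dmk_fun, dcompE). Qed.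

Lemma cone_support k s : cone k (s, support k s) = s.
Proof.
by apply: dmapP => i; rewrite !dmk_fun /=; case: (s i =P ord0) => [->|].
Qed.

Lemma cone0 k s : cone k (s, endp k false) = dcst k ord0.
Proof. by apply: dmapP => i; rewrite dmk_fun /= !dcstE. Qed.

Lemma cone_horn k s t : sc_horn ord0 k s -> sc_horn ord0 k (cone k (s, t)).
Proof.
case=> j [j0 sj]; exists j; split=> // l; rewrite dmk_fun /=.
by case: ifP => // _ /esym.
Qed.

Lemma dcst_horn k : sc_horn (@ord0 n.+1) k (dcst k ord0).
Proof. by exists ord_max; split=> // l; rewrite dcstE. Qed.

Lemma up_mono k (s : dmap k n) (i j : 'I_k.+1) : i <= j ->
  lift ord0 (s i) <= lift ord0 (s j).
Proof. by move=> ij; rewrite /= leq_bump2; apply: dmap_mono. Qed.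

Program Definition up : smap (simplex n) (simplex n.+1) :=
  @SMap (simplex n) (simplex n.+1) (fun k s => dmk (@up_mono k s)) _.
Next Obligation. by apply: dmapP => i; rewrite /= !(dmk_fun, dcompE). Qed.

Lemma down_mono k (s : dmap k n.+1) (i j : 'I_k.+1) : i <= j ->
  (inord (s i).-1 : 'I_n.+1) <= (inord (s j).-1 : 'I_n.+1).
Proof.
move=> ij; have := dmap_mono s ij; have si := ltn_ord (s i); have sj := ltn_ord (s j).
by rewrite !inordK; lia.
Qed.

Program Definition down : smap (simplex n.+1) (simplex n) :=
  @SMap (simplex n.+1) (simplex n) (fun k s => dmk (@down_mono k s)) _.
Next Obligation. by apply: dmapP => i; rewrite /= !(dmk_fun, dcompE). Qed.

Lemma downK k (s : dmap k n.+1) : (forall i, s i <> ord0) -> up k (down k s) = s.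
Proof.
move=> s0; apply: dmap_nat => i; rewrite !dmk_fun /= /bump /=.
have si := ltn_ord (s i).
have ne : s i <> 0 :> nat by move=> e; apply: (s0 i); apply: val_inj.
by rewrite inordK; lia.
Qed.

Lemma up_neq0 k (s : dmap k n) i : up k s i <> ord0.
Proof. by rewrite dmk_fun => /(congr1 val). Qed.

Lemma up_bd k s : sc_bd n.+1 k (up k s).
Proof. by exists ord0 => i; apply: up_neq0. Qed.

Lemma up_horn k s : sc_bd n k s -> sc_horn ord0 k (up k s).
Proof.
case=> j sj; exists (lift ord0 j); split=> [/(congr1 val) //|l].
by rewrite dmk_fun => /lift_inj; apply: sj.
Qed.

Lemma down_bd k (s : dmap k n.+1) : (forall i, s i <> ord0) -> sc_horn ord0 k s -> sc_bd n k (down k s).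
Proof.
move=> s0 [j [j0 sj]]; exists (inord j.-1) => i; rewrite dmk_fun => /(congr1 val) /=.
have jn := ltn_ord j; have si := ltn_ord (s i).
have ne1 : j <> 0 :> nat by move=> e; apply: j0; apply: val_inj.
have ne2 : s i <> 0 :> nat by move=> e; apply: (s0 i); apply: val_inj.
have ne3 : s i <> j :> nat by move=> e; apply: (sj i); apply: val_inj.
by rewrite !inordK; lia.
Qed.


Variables (Z C : sset) (A : subcx C).
Hypothesis ZH : hep Z.

(** The contraction [cone] preserves the 0-horn and ends in its vertex 0, so the data pulled back
    along it form a homotopy extension problem; restricting the solution to the graph of [support]
    gives the filler. *)
Lemma ext_horn : ext Z (sc_prod (sc_horn (@ord0 n.+1)) A).
Proof.
move=> f sf.
pose D := sprod (simplex n.+1) C.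
pose r : smap (sprod D Delta1) D :=
  @SMap (sprod D Delta1) D (fun k x => (cone k (x.1.1, x.2), x.1.2))
    (fun m k s x => congr1 (fun y => (y, _)) (smap_op cone s (x.1.1, x.2))).
have [|H HE] := ZH (A := sc_prod (sc_horn (@ord0 n.+1)) A) (e := false)
    (f := fun k x => f k (r k x)).
  apply: sim_onW (sim_on_pre (h := r) sf) => k [[s c] t] [[h|h]|h].
  - by left; exact: cone_horn.
  - by right.
  - by left; rewrite /= in h *; subst t; rewrite [dmk _]cone0; exact: dcst_horn.
pose i : smap D (sprod D Delta1) := @SMap D (sprod D Delta1)
  (fun k x => (x, support k x.1)) (fun m k s x => congr1 (pair _) (smap_op support s x.1)).
exists (scomp H i) => k [s c] h; rewrite [LHS]HE; last by left.
by rewrite /r /= [dmk _]cone_support.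
Qed.

(** The boundary is the 0-horn together with the face opposite 0. A filler [g] of the horn agrees
    with [f] on the boundary of that face, so the hypothesis supplies a homotopy between them there,
    and extending it corrects [g]. *)
Lemma ext_simplex_step :
  ext Z (sc_prod (sc_prod (sc_bd n) A) sc_ends) -> ext Z (sc_prod (sc_bd n.+1) A).
Proof.
move=> ex f sf.
pose J := sc_prod (sc_horn (@ord0 n.+1)) A.
have J_bd k x : J k x -> sc_prod (sc_bd n.+1) A k x.
  by case=> h; [left; case: h => j [_ h]; exists j|right].
have [g gE] := ext_horn (sim_onW J_bd sf).
pose upC := smap_prod up (sid C); pose downC := smap_prod down (sid C).
have fuP m k (s : dmap m k) x : f m (upC m (op s x)) = op s (f k (upC k x)).
  by rewrite smap_op; apply: sf; left; exact: up_bd.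
pose fu : smap (sprod (simplex n) C) Z := SMap fuP.
have [k [k0 k1 kA]] : hrel (sc_prod (sc_bd n) A) (scomp g upC) fu.
  apply: (ext_hrel ex) => k x h; apply: gE.
  by case: h => h; [left; apply: up_horn|right].
pose F : subcx (simplex n.+1) := @Subcx (simplex n.+1) (fun k s => forall i, s i <> ord0)
  (fun m k (s : dmap m k) x h i => eq_ind_r (fun y => y <> ord0) (h _) (dcompE _ _ _)).
pose D := sprod (simplex n.+1) C.
pose kd := scomp k (smap_prod downC (sid Delta1)).
have sJ : sim_on (sc_pre (pfst D Delta1) J) (fun i x => f i x.1).
  exact: (sim_on_pre (h := pfst D Delta1) (sim_onW J_bd sf)).
have agree i (x : sprod D Delta1 i) : sc_pre (pfst D Delta1) J i x ->
    sc_pre (scomp (pfst _ C) (pfst D Delta1)) F i x -> f i x.1 = kd i x.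
  case: x => [[s c] t] h s0; rewrite /kd /= kA; last first.
    by case: h => h; [left; apply: down_bd|right].
  by rewrite /= [dmk _](downK s0) -gE.
have [K [sK KJ KF]] := glue sJ (@sim_on_smap _ _ _ kd) agree.
have bd_JF i x : sc_prod (sc_bd n.+1) A i x -> J i x \/ F i x.1.
  case: x => s c [[j sj]|h] /=; last by left; right.
  have [e|j0] := pselect (j = ord0); first by right=> l; rewrite -e; apply: sj.
  by left; left; exists j.
have [||H [H0 HA]] := hep_ext ZH (A := sc_prod (sc_bd n.+1) A) (e := false) (z := g) (h := K).
- by apply: sim_onW sK => i x /bd_JF.
- move=> i x /bd_JF[h|h]; first by rewrite KJ // gE.
  by rewrite KF // /kd /= k0 /=; case: x h => s c h; rewrite [dmk _](downK h).
exists (scomp H (at_end _ true)) => i x h; rewrite /= HA //.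
case: (bd_JF i x h) => h'; first by rewrite KJ.
by rewrite KF // /kd /= k1 /=; case: x h h' => s c h h'; rewrite [dmk _](downK h').
Qed.
End SimplexStep.

(* A space all of whose based homotopy groups vanish, phrased cubically. *)
Lemma ext_null (Z : sset) (p : Z 0) : hep Z ->
  (forall m (f : smap (Icube m) Z), (forall n c, Ibd m n c -> f n c = cpt p n) ->
     hrel (Ibd m) f (sconst _ p)) ->
  forall B (A : subcx B), ext Z A.
Proof.
move=> ZH null B A.
have exI := Icube_ext_bd ZH null.
(* Each step of the induction on [n] trades a simplex direction for a cube direction, which is why
   [m] varies. *)
have exD n : forall m, ext Z (sc_prod (sc_bd n) (Ibd m)).
  elim: n => [|n IH] m.
    apply: (@ext_iso _ _ _ _ (Ibd m) (psnd _ _)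
      (@SMap (Icube m) (sprod (simplex 0) (Icube m)) (fun k c => (zero_deg k, c))
        (fun _ _ _ _ => congr1 (fun s => (s, _)) (dmap0_eq _ _)))) => //.
    - by move=> k [s c]; congr pair; apply: dmap0_eq.
    - by move=> k [s c] [/dmap0_surj|].
    - by move=> k c h; right.
  apply: ext_simplex_step => //; set C := Icube m.
  pose X := simplex n; pose L := sprod (sprod X C) Delta1; pose R := sprod X (sprod C Delta1).
  pose f : smap L R := @SMap L R (fun k x => (x.1.1, (x.1.2, x.2))) (fun _ _ _ _ => erefl).
  pose g : smap R L := @SMap R L (fun k x => ((x.1, x.2.1), x.2.2)) (fun _ _ _ _ => erefl).
  apply: (@ext_iso _ _ _ _ (sc_prod (sc_bd n) (Ibd m.+1)) f g) => //.
  - by move=> k [[s c] t].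
  - by move=> k [[s c] t] [[h|h]|h]; [left|right; left|right; right].
  - by move=> k [s [c t]] [h|[h|h]]; [left; left|left; right|right].
have ex := @ext_cells Z (Icube 0) (sc_empty _) (fun n => exD n 0) B A.
apply: (@ext_iso _ _ _ _ (sc_prod A (sc_empty (Icube 0)))
  (@SMap B (sprod B (Icube 0)) (fun k c => (c, zero_deg k))
        (fun _ _ _ _ => congr1 (pair _) (dmap0_eq _ _))) (pfst _ _)) => //.
- by move=> n x h; left.
- by move=> n x [].
Qed.

(** * The homotopy fibre *)

Lemma sval_eq T (P : T -> Prop) (x y : {x | P x}) : sval x = sval y -> x = y.
Proof. by case: x y => x Px [y Py] /= e; apply: eq_exist. Qed.

Section Hofiber.
Variables (W V : sset) (F : smap W V) (w0 : W 0) (v0 : V 0).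
Hypothesis Fw0 : F 0 w0 = v0.

Definition is_hofib k (x : sprod W (ihom Delta1 V) k) : Prop :=
  (forall n (s : dmap n k), x.2 n (endp n false, s) = cpt v0 n) /\
  (forall n (s : dmap n k), x.2 n (endp n true, s) = F n (op s x.1)).

Lemma is_hofib_op m n (f : dmap m n) x : is_hofib x -> is_hofib (op f x).
Proof. by case=> h0 h1; split=> [k s|k s] /=; rewrite ?h0 ?h1 ?op_comp. Qed.

(* The homotopy fibre of F over v0, with paths running from v0 to Fx. *)
Definition hofib : sset := sub is_hofib_op.

Definition hf_pt : smap hofib W :=
  @SMap hofib W (fun n x => (sval x).1) (fun _ _ _ _ => erefl).

Definition hf_path : smap (sprod hofib Delta1) V.
Proof.
refine (@SMap (sprod hofib Delta1) V (fun n x => (sval x.1).2 n (x.2, did n)) _).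
move=> m n s [[[x g] xg] t] /=; rewrite -smap_op /=; congr (g m (_, _)).
by rewrite dcomp1 d1comp.
Defined.

Lemma hf_path0 n (x : hofib n) : hf_path n (x, endp n false) = cpt v0 n.
Proof. by case: x => x [h0 h1] /=; rewrite h0. Qed.

Lemma hf_path1 n (x : hofib n) : hf_path n (x, endp n true) = F n (hf_pt n x).
Proof. by case: x => x [h0 h1] /=; rewrite h1 op_id. Qed.

Lemma hofib_eq n (x y : hofib n) : hf_pt n x = hf_pt n y ->
  (forall k (s : dmap k n) t, hf_path k (op s x, t) = hf_path k (op s y, t)) -> x = y.
Proof.
case: x y => [[x g] xg] [[y g'] yg'] /= exy egg; apply: eq_exist; congr pair => //.
apply: smapP => k [t s]; have := egg k s t; rewrite /=.
by rewrite dcomp1.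
Qed.

Definition hf_base : hofib 0.
Proof.
exists (w0, scomp (sconst _ v0) (pfst _ _)); split=> //= n s.
by rewrite /cpt -Fw0 smap_op; congr (op _ _); apply: dmap0_eq.
Defined.

Lemma hf_pt_base n : hf_pt n (cpt hf_base n) = cpt w0 n.
Proof. by []. Qed.

Lemma hf_path_base n t : hf_path n (cpt hf_base n, t) = cpt v0 n.
Proof. by []. Qed.

Section Intro.
Variables (B : sset) (x : forall n, B n -> W n) (g : smap (sprod B Delta1) V).

Definition path_at_op n (b : B n) i j (s : dmap i j) (ts : sprod Delta1 (simplex n) j) :
  g i (op (op s ts).2 b, (op s ts).1) = op s (g j (op ts.2 b, ts.1)).
Proof. by rewrite -smap_op /= op_comp. Qed.

Definition path_at n (b : B n) : ihom Delta1 V n := SMap (path_at_op b).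

(** Where the points and paths do not fit together the base point is returned, so that the function
    is total as [sim_on] requires. *)
Definition hofib_fun n (b : B n) : hofib n :=
  if pselect (@is_hofib n (x b, path_at b)) is left h then exist _ _ h else cpt hf_base n.

Variable A : subcx B.
Hypothesis sx : sim_on A x.
Hypothesis g0 : forall n b, A n b -> g n (b, endp n false) = cpt v0 n.
Hypothesis g1 : forall n b, A n b -> g n (b, endp n true) = F n (x b).

Lemma hofib_funE n b : A n b -> sval (hofib_fun b) = (x b, path_at b).
Proof.
move=> Ab; rewrite /hofib_fun; case: pselect => // -[]; split=> k s /=.
  by rewrite g0 //; apply: subcx_op.
by rewrite g1 ?sx //; apply: subcx_op.
Qed.

Lemma hofib_fun_sim : sim_on A hofib_fun.
Proof.
move=> m n s b Ab; apply: sval_eq; rewrite hofib_funE; last exact: subcx_op.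
rewrite /= hofib_funE //= sx //; congr pair; apply: smapP => k [t r] /=.
by rewrite op_comp.
Qed.

Lemma hofib_fun_pt n b : A n b -> hf_pt n (hofib_fun b) = x b.
Proof. by move=> Ab; rewrite /= hofib_funE. Qed.

Lemma hofib_fun_path n b t : A n b -> hf_path n (hofib_fun b, t) = g n (b, t).
Proof. by move=> Ab; rewrite /= hofib_funE //= op_id. Qed.
End Intro.

Lemma hofib_intro B (x : smap B W) (g : smap (sprod B Delta1) V) :
  (forall n b, g n (b, endp n false) = cpt v0 n) ->
  (forall n b, g n (b, endp n true) = F n (x n b)) ->
  exists f : smap B hofib, (forall n b, hf_pt n (f n b) = x n b) /\
    (forall n b t, hf_path n (f n b, t) = g n (b, t)).
Proof.
move=> g0 g1.
have sx := @sim_on_smap _ _ (sc_all B) x.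
have sf := @hofib_fun_sim B x g (sc_all B) sx (fun n b _ => g0 n b) (fun n b _ => g1 n b).
exists (SMap (fun m n s b => sf m n s b Logic.I)); split=> [n b|n b t].
  exact: (@hofib_fun_pt B x g (sc_all B) sx (fun n b _ => g0 n b) (fun n b _ => g1 n b)).
exact: (@hofib_fun_path B x g (sc_all B) sx (fun n b _ => g0 n b) (fun n b _ => g1 n b)).
Qed.

Hypotheses (WH : hep W) (VH : hep V).

(** The points are extended in [W]. The paths are then a box in [V] whose first parameter is the
    path parameter, with sides the constant [v0] and the image of the extended points. *)
Lemma hep_hofib : hep hofib.
Proof.
move=> B A e f sf.
have [X XE] := WH (sim_on_comp hf_pt sf).
have cP i n (s : dmap i n) (x : sprod B Delta1 n) :
    hf_path i (f i ((op s x).1, endp i e), (op s x).2) =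
    op s (hf_path n (f n (x.1, endp n e), x.2)).
  rewrite -(smap_op hf_path s (f n (x.1, endp n e), x.2)); congr (hf_path i (_, _)).
  by rewrite -sf /= ?endp_op //; right.
pose c : smap (sprod B Delta1) V := SMap cP.
pose a n (y : sprod (sprod B Delta1) Delta1 n) := hf_path n (f n (y.1.1, y.2), y.1.2).
have [||||||G [Gc Gl Gr Ga]] := @box V VH B A e c (sconst _ v0) (scomp F X) a.
- move=> m n s [[b u] t] /= Ab.
  rewrite /a -(smap_op hf_path s (f n (b, t), u)); congr (hf_path m (_, _)).
  exact: (sf m n s (b, t) (or_introl Ab)).
- by move=> n b; rewrite [LHS]hf_path0.
- by move=> n b; rewrite [LHS]hf_path1 /= XE //; right.
- by [].
- by move=> n b t Ab; rewrite /a hf_path0.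
- by move=> n b t Ab; rewrite /a hf_path1 /= XE //; left.
pose D := sprod B Delta1.
pose g : smap (sprod D Delta1) V :=
  @SMap (sprod D Delta1) V (fun n y => G n ((y.1.1, y.2), y.1.2))
    (fun m n s y => smap_op G s ((y.1.1, y.2), y.1.2)).
have [||H [Hpt Hpath]] := @hofib_intro D X g.
- by move=> n [b t]; rewrite /g /= Gl.
- by move=> n [b t]; rewrite /g /= Gr.
exists H => n d Ad; apply: hofib_eq => [|k s u]; first by rewrite Hpt XE.
rewrite -smap_op Hpath; rewrite -(sf k n s d Ad).
have := subcx_op s Ad; case: (op s d) => b t [/= Ab|/= et]; first by rewrite Ga.
by rewrite /= in et; subst t; rewrite /g [LHS]/= Gc.
Qed.

Hypothesis surj : forall m (v : smap (Icube m) V),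
  (forall n c, Ibd m n c -> v n c = cpt v0 n) ->
  exists u : smap (Icube m) W, (forall n c, Ibd m n c -> u n c = cpt w0 n) /\
    hrel (Ibd m) (scomp F u) v.
Hypothesis inj : forall m (u : smap (Icube m) W),
  (forall n c, Ibd m n c -> u n c = cpt w0 n) ->
  hrel (Ibd m) (scomp F u) (sconst _ v0) -> hrel (Ibd m) u (sconst _ w0).

Lemma F_cpt n : F n (cpt w0 n) = cpt v0 n.
Proof. by rewrite /cpt smap_op Fw0. Qed.

(** Such a map is a cube [u] in [W] with a path [g] from [v0] to [F u]. By [inj] there is a
    null-homotopy [U0] of [u], but [F U0] and [g] may differ by a loop [om]. By [surj], [om] lifts
    to [W] up to homotopy, and correcting [U0] by the lift gives [U1] with [F U1] homotopic to [g]
    relative to both ends. So [f] is homotopic to the pair of [u] and [F U1], which contracts along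
    [U1]. *)
Lemma hofib_null m (f : smap (Icube m) hofib) :
  (forall n c, Ibd m n c -> f n c = cpt hf_base n) ->
  hrel (Ibd m) f (sconst _ hf_base).
Proof.
move=> f0; pose C := Icube m; pose A := Ibd m; rewrite -/C -/A in f f0 *.
have [u uE] : exists u : smap C W, forall n c, hf_pt n (f n c) = u n c.
  by exists (scomp hf_pt f).
have [g gE] : exists g : smap (sprod C Delta1) V, forall n c t, hf_path n (f n c, t) = g n (c, t).
  by exists (scomp hf_path (smap_prod f (sid Delta1))).
have g0 n c : g n (c, endp n false) = cpt v0 n by rewrite -gE hf_path0.
have g1 n c : g n (c, endp n true) = F n (u n c).
  by rewrite -gE hf_path1 uE.
have uA n c : A n c -> u n c = cpt w0 n by move=> Ac; rewrite -uE f0 // hf_pt_base.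
have gA n c t : A n c -> g n (c, t) = cpt v0 n by move=> Ac; rewrite -gE f0 // hf_path_base.
have [U0 [U00 U01 U0A]] : hrel A (sconst _ w0) u.
  apply: (hrel_sym WH); apply: inj => //; apply: (hrel_sym VH).
  by exists g; split.
(* The missing face is the loop comparing the two null-homotopies [F U0] and [g] of [F u]. *)
have [||||||GV [GVc GVl GVr GVa]] := @box V VH C A true (scomp (scomp F u) (pfst _ _))
    (scomp F U0) g (fun n _ => cpt v0 n).
- by move=> i n s x _; rewrite op_cpt.
- by move=> n c; rewrite /= U01.
- by move=> n c; rewrite g1.
- by move=> n c s Ac; rewrite [RHS]/= uA // F_cpt.
- by move=> n c t Ac; rewrite /= U0A // F_cpt.
- by move=> n c t Ac; rewrite gA.
pose om := scomp GV (at_end _ false).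
have omA n x : Ibd m.+1 n x -> om n x = cpt v0 n.
  case: x => c s [/= Ac|[] /= es]; first by rewrite GVa.
  - by rewrite /= in es; subst s; rewrite GVl /= U00 F_cpt.
  - by rewrite /= in es; subst s; rewrite GVr g0.
have [ze [zeA /(hrel_sym VH) [th [th0 th1 thA]]]] := @surj m.+1 om omA.
(* The missing face is [U0] corrected by the lifted loop [ze]. *)
have [||||||GW [GWc GWl GWr GWa]] := @box W WH C A false U0 ze
    (scomp u (pfst _ _)) (fun n _ => cpt w0 n).
- by move=> i n s x _; rewrite op_cpt.
- by move=> n c; rewrite U00 zeA //; right; left.
- by move=> n c; rewrite U01.
- by move=> n c s Ac; rewrite U0A.
- by move=> n c t Ac; rewrite zeA //; left.
- by move=> n c t Ac; rewrite [RHS]/= uA.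
have [U1 U1E] : exists U1 : smap (sprod C Delta1) W, forall n x, U1 n x = GW n (x, endp n true).
  by exists (scomp GW (at_end _ true)).
have U10 n c : U1 n (c, endp n false) = cpt w0 n.
  by rewrite U1E GWl zeA //; right; right.
have U11 n c : U1 n (c, endp n true) = u n c by rewrite U1E GWr.
have U1A n c t : A n c -> U1 n (c, t) = cpt w0 n by move=> Ac; rewrite U1E GWa.
pose C1 := sprod C Delta1.
pose D := sprod (sprod C1 Delta1) Delta1.
(* coordinates of D are (((c, t), tau), s) *)
pose thD : smap D V := @SMap D V (fun n y => th n ((y.1.1.1, y.2), y.1.2))
    (fun i n s y => smap_op th s ((y.1.1.1, y.2), y.1.2)).
pose uD : smap D V := @SMap D V (fun n y => F n (u n y.1.1.1))
    (fun i n s y => smap_op (scomp F u) s y.1.1.1).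
have [|a [sa ath au]] := @glue D V (sc_pre (to_fst_fst C1) (sc_prod A (sc_end false)))
    (sc_pre (to_fst_fst C1) (sc_pre (psnd _ _) (sc_end true))) thD uD
    (@sim_on_smap _ _ _ thD) (@sim_on_smap _ _ _ uD).
  move=> n [[[c t] ta] s] [/= Ac|/= e0] /= e1; last by case: (@endp_neq n); rewrite -e0 -e1.
  rewrite /thD /uD [LHS]/= thA ?omA; try by left.
  by rewrite [RHS]/= uA // F_cpt.
have aA n c t ta s : A n c -> a n (((c, t), ta), s) = cpt v0 n.
  by move=> Ac; rewrite ath ?[LHS]/= ?thA ?omA //; left.
have a0 n c ta s : a n (((c, endp n false), ta), s) = th n ((c, s), ta).
  by rewrite ath //; right.
have a1 n c ta s : a n (((c, endp n true), ta), s) = F n (u n c).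
  by rewrite au.
pose GV' : smap (sprod C1 Delta1) V := @SMap (sprod C1 Delta1) V
  (fun n y => GV n ((y.1.1, y.2), y.1.2)) (fun i n s y => smap_op GV s ((y.1.1, y.2), y.1.2)).
(* One dimension up, with sides [GV'] and the image of [GW]: the missing face is the homotopy from
   [g] to [F U1]. *)
have [||||||G [Gc Gl Gr Ga]] := @box V VH C1 (Ibd m.+1) false
    (scomp (scomp F U0) (pfst _ _)) GV' (scomp F GW) a.
- apply: sim_onW sa => n [[[c t] ta] s] [/= Ac|[] /= e]; [by left; left|left; right|right] => //.
- by move=> n [c t]; rewrite /GV' /= GVl.
- by move=> n [c t]; rewrite /= GWc.
- move=> n [c t] ta [/= Ac|[] /= e]; try (rewrite /= in e; subst t).
  + by rewrite aA //= U0A // F_cpt.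
  + by rewrite a0 /= U00 F_cpt thA ?omA //; right; left.
  + by rewrite a1 /= U01.
- move=> n [c t] s [/= Ac|[] /= e]; try (rewrite /= in e; subst t).
  + by rewrite aA // /GV' /= GVa.
  + by rewrite a0 th0.
  + by rewrite a1 /GV' /= GVc.
- move=> n [c t] s [/= Ac|[] /= e]; try (rewrite /= in e; subst t).
  + by rewrite aA //= GWa // F_cpt.
  + by rewrite a0 th1 /= GWl.
  + by rewrite a1 /= GWr.
pose G1 : smap (sprod C1 Delta1) V := @SMap (sprod C1 Delta1) V
  (fun n y => G n (((y.1.1, y.2), y.1.2), endp n true))
  (fun i n s y => etrans (congr1 (fun e => G i (_, e)) (esym (endp_op s true)))
     (smap_op G s (((y.1.1, y.2), y.1.2), endp n true))).
have [||h1 [h1pt h1path]] := @hofib_intro C1 (scomp u (pfst _ _)) G1.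
- move=> n [c t]; rewrite /G1 /= Ga; last by right; left.
  by rewrite a0 thA ?omA //; right; right.
- by move=> n [c t]; rewrite /G1 /= Ga ?a1 //; right; right.
have [||f1 [f1pt f1path]] := @hofib_intro C u (scomp F U1).
- by move=> n c; rewrite [LHS]/= U10 F_cpt.
- by move=> n c; rewrite [LHS]/= U11.
(* At time [t] the path is [F U1] stopped at [t], so that it always ends over the point [U1] at
   [t]. *)
pose U1min : smap (sprod C1 Delta1) V := @SMap (sprod C1 Delta1) V
  (fun n y => F n (U1 n (y.1.1, smin n (y.1.2, y.2))))
  (fun i n s y => etrans (congr1 (fun e => F i (U1 i (_, e))) (smap_op smin s (y.1.2, y.2)))
     (smap_op (scomp F U1) s (y.1.1, smin n (y.1.2, y.2)))).
have [||h2 [h2pt h2path]] := @hofib_intro C1 U1 U1min.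
- by move=> n [c t]; rewrite [LHS]/= dmin0r U10 F_cpt.
- by move=> n [c t]; rewrite [LHS]/= dmin1r.
have opE i n (s : dmap i n) (c : C n) e :
    op s ((c, endp n e) : C1 n) = ((op s c, endp i e) : C1 i) by rewrite /= endp_op.
have ff1 : hrel A f f1.
  exists h1; split=> [n c|n c|n c t Ac]; apply: hofib_eq => [|k s r] //; rewrite -?smap_op.
  - by rewrite h1pt uE.
  - by rewrite opE h1path gE /G1 /= Gl /GV' /= GVr.
  - by rewrite h1pt f1pt.
  - by rewrite opE h1path f1path /G1 /= Gr U1E.
  - by rewrite h1pt uE.
  - have sAc := subcx_op s Ac; rewrite h1path gE gA // /G1 /= Ga ?aA //; by left.
apply: (hrel_trans (hep_hofib) ff1 (hrel_sym hep_hofib _)).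
exists h2; split=> [n c|n c|n c t Ac]; apply: hofib_eq => [|k s r] //; rewrite -?smap_op.
- by rewrite h2pt U10.
- rewrite opE h2path [LHS]/= dmin0 U10.
  by rewrite [op s c]/= [RHS]hf_path_base F_cpt.
- by rewrite h2pt U11 f1pt.
- by rewrite opE h2path f1path [LHS]/= dmin1.
- by rewrite h2pt U1A.
- have sAc := subcx_op s Ac; rewrite h2path [LHS]/= U1A //.
  by rewrite [RHS]hf_path_base F_cpt.
Qed.
End Hofiber.

(* The homotopy z(b, min(s, t)) contracts z to the base point, so that x and z define a
   map to the homotopy fibre. *)
Lemma hofib_ext_path (W V : sset) (F : smap W V) w0 v0 (Fw0 : F 0 w0 = v0) : hep V ->
  (forall B (A : subcx B), ext (hofib F v0) A) ->
  forall B (A : subcx (sprod B Delta1)) (x : forall n, sprod B Delta1 n -> W n)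
    (z : smap (sprod B Delta1) V),
  sim_on A x -> (forall n d, A n d -> F n (x n d) = z n d) ->
  (forall n b, z n (b, endp n false) = cpt v0 n) ->
  exists x' : smap (sprod B Delta1) W,
    (forall n d, A n d -> x' n d = x n d) /\ hrel A (scomp F x') z.
Proof.
move=> VH ex B A x z sx xz z0; pose D := sprod B Delta1.
pose g : smap (sprod D Delta1) V := @SMap (sprod D Delta1) V
  (fun n y => z n (y.1.1, smin n (y.1.2, y.2)))
  (fun i n s y => etrans (congr1 (fun e => z i (_, e)) (smap_op smin s (y.1.2, y.2)))
     (smap_op z s (y.1.1, smin n (y.1.2, y.2)))).
have g0 n d : g n (d, endp n false) = cpt v0 n by rewrite /g /= dmin0r z0.
have g1 n d : g n (d, endp n true) = z n d by rewrite /g /= dmin1r; case: d.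
have g1A n d : A n d -> g n (d, endp n true) = F n (x n d) by move=> Ad; rewrite g1 xz.
have sf := hofib_fun_sim Fw0 sx (fun n d _ => g0 n d) g1A.
have [f fE] := ex D A _ sf.
have fx n d : A n d -> hf_pt F v0 n (f n d) = x n d.
  by move=> Ad; rewrite fE // (hofib_fun_pt Fw0 sx (fun n d _ => g0 n d) g1A).
have fg n d t : A n d -> hf_path F v0 n (f n d, t) = g n (d, t).
  by move=> Ad; rewrite fE // (hofib_fun_path Fw0 sx (fun n d _ => g0 n d) g1A).
have [x' x'E] : exists x' : smap D W, forall n d, hf_pt F v0 n (f n d) = x' n d.
  by exists (scomp (hf_pt F v0) f).
exists x'; split=> [n d Ad|]; first by rewrite -x'E fx.
(* Both families of paths start at [v0]; a box on this constant bottom joins their ends [F x'] and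
   [z]. *)
have [||||||G [Gc Gl Gr Ga]] := @box V VH D A false (sconst _ v0)
    (scomp (hf_path F v0) (smap_prod f (sid _))) g (fun n y => g n (y.1.1, y.2)).
- by move=> i n s y _; rewrite -smap_op.
- by move=> n d; rewrite [RHS]hf_path0.
- by move=> n d; rewrite g0.
- by move=> n d s Ad; rewrite g0.
- by move=> n d t Ad; rewrite [RHS]fg.
- by [].
exists (scomp G (at_end _ true)); split=> [n d|n d|n d t Ad] /=.
- by rewrite Gl [LHS]hf_path1 x'E.
- by rewrite Gr g1.
- by rewrite Ga // g1 -xz // -x'E fx.
Qed.

Lemma component_eq (X : sset) (x y : X 0) : component x = component y -> connected x y.
Proof. by case=> /(congr1 (fun P => P y)) ->; apply: rst_refl. Qed.

Lemma component_surj (X : sset) (C : pi0 X) : exists x, C = component x.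
Proof. by case: C => C [x eC]; exists x; apply: eq_exist. Qed.

Lemma connected_component (X : sset) (x y : X 0) : connected x y -> component x = component y.
Proof. by move=> h; apply/eq_exist/connected_ext. Qed.

(** * Loop spaces and the homotopy groups of a spectrum *)

Lemma nonsurj1P k (t : dmap k 1) : nonsurj t <-> sc_ends k t.
Proof.
split=> [[j tj]|[] ->]; last 2 first.
- by exists ord_max => i; rewrite dcstE.
- by exists ord0 => i; rewrite dcstE.
case: (ord2P j) => ej; [right|left]; apply: dmap1_endp => i; have := tj i; rewrite ej.
  by case: (ord2P (t i)) => ->.
by case: (ord2P (t i)) => ->.
Qed.

Fixpoint Bset m : finType := if m is m'.+1 then (option (Bset m') : finType) else (void : finType).

Fixpoint fromI m n : Icube m n -> cube (Bset m) n :=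
  match m with
  | 0 => fun _ b => match b with end
  | m'.+1 => fun c o => if o is Some b then @fromI m' n c.1 b else c.2
  end.

Fixpoint toI m n : cube (Bset m) n -> Icube m n :=
  match m with
  | 0 => fun _ => zero_deg n
  | m'.+1 => fun t => (@toI m' n (fun b => t (Some b)), t None)
  end.

Lemma fromI_op m k n (s : dmap k n) c : @fromI m k (op s c) = op s (fromI c).
Proof.
apply/funext; elim: m c => [c []|m IH [c t] [b|]] //=; exact: IH.
Qed.

Lemma toI_op m k n (s : dmap k n) c : @toI m k (op s c) = op s (toI c).
Proof.
elim: m c => [c|m IH c] /=; first exact: dmap0_eq.
by rewrite -[in RHS]IH.
Qed.

Lemma fromIK m n c : toI (@fromI m n c) = c.
Proof.
elim: m c => [c|m IH [c t]] /=; first exact: dmap0_eq.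
by congr pair; exact: IH.
Qed.

Lemma toIK m n c : fromI (@toI m n c) = c.
Proof. by apply/funext; elim: m c => [c []|m IH c [b|]] //=; rewrite IH. Qed.

Lemma fromI_bd m n (c : Icube m n) : Ibd m n c <-> exists b, nonsurj (fromI c b).
Proof.
elim: m c => [c|m IH [c t]]; first by split=> // -[[]].
split=> [[/IH[b h]|/nonsurj1P h]|[[b|] h]].
- by exists (Some b).
- by exists None.
- by left; apply/IH; exists b.
- by right; apply/nonsurj1P.
Qed.

Section Loops.
Variables (gT : finGroupType) (G : {group gT}).
Variables (H : {group gT}) (sHG : H \subset G).

Lemma triv_is_action (B : finType) : is_action H (fun (b : B) (_ : gT) => b).
Proof. by split=> // h b b'. Qed.
(** For this action an equivariant loop is an ordinary loop in the fixed points, so non-equivariant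
    homotopy theory applies. *)
Definition triv_act (B : finType) : action H B := Action (triv_is_action B).

Section Space.
Variables (X : gspectrum G) (A : finType) (rA : action H A).
Let W := fixed X sHG rA.

Lemma twist_pt k h : h \in H -> twist rA (pt X A k) h = pt X A k.
Proof.
move=> hH; rewrite /twist gact_pt ?(subsetP sHG) // push_pt //.
exact: act_inj.
Qed.

Definition fix_pt : W 0 := 
  exist (fun x : X A 0 => forall h, h \in H -> twist rA x h = x) (pt X A 0) (@twist_pt 0).

Lemma cpt_fix n : sval (cpt fix_pt n) = pt X A n.
Proof. by rewrite /= pt_op. Qed.

Section Curry.
Variable B : finType.
Notation L := (loops X rA (triv_act B)).

Lemma loop_ev_fixed n (x : sprod L (cube B) n) h : h \in H ->
  twist rA (sval x.1 n (x.2, did n)) h = sval x.1 n (x.2, did n).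
Proof. by case: x => [[l [l1 l2]] t] hH; rewrite -l2. Qed.

Definition loop_ev : smap (sprod L (cube B)) W.
Proof.
refine (@SMap (sprod L (cube B)) W (fun n x => exist
  (fun y : X A n => forall h, h \in H -> twist rA y h = y) _ (loop_ev_fixed x)) _).
move=> m n s [[l lP] t]; apply: sval_eq => /=; rewrite -smap_op /=.
by rewrite dcomp1 d1comp.
Defined.

Lemma loop_ev_bd n (l : L n) (t : cube B n) : (exists b, nonsurj (t b)) ->
  loop_ev n (l, t) = cpt fix_pt n.
Proof. by case: l => l [l1 l2] h; apply: sval_eq; rewrite cpt_fix /= l1. Qed.

Lemma loop_eq n (l l' : L n) :
  (forall k (s : dmap k n) t, loop_ev k (op s l, t) = loop_ev k (op s l', t)) -> l = l'.
Proof.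
case: l l' => [l lP] [l' l'P] e; apply: sval_eq; apply: smapP => k [t s] /=.
by have [] := e k s t; rewrite /= dcomp1.
Qed.

Lemma curry_op D (u : smap (sprod D (cube B)) W) n (d : D n) i j (s : dmap i j)
    (ts : sprod (cube B) (simplex n) j) :
  sval (u i (op (op s ts).2 d, (op s ts).1)) = op s (sval (u j (op ts.2 d, ts.1))).
Proof. by rewrite -[op s (sval _)]/(sval (op s (u j _))) -smap_op /= op_comp. Qed.

Definition curry_fun D (u : smap (sprod D (cube B)) W) n (d : D n) : ihom (cube B) (X A) n :=
  SMap (curry_op u d).

Lemma curry D (u : smap (sprod D (cube B)) W) :
  (forall n d t, (exists b, nonsurj (t b)) -> u n (d, t) = cpt fix_pt n) ->
  exists f : smap D L, forall n d t, loop_ev n (f n d, t) = u n (d, t).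
Proof.
move=> u0.
have uL n (d : D n) : is_loop rA (triv_act B) (curry_fun u d).
  split=> [k t s tb|h hH k t s] /=; first by rewrite u0 // cpt_fix.
  by case: (u k _) => y yP /=; rewrite yP.
have uop m n (s : dmap m n) (d : D n) : (exist _ _ (uL m (op s d)) : L m) = op s (exist _ _ (uL n d) : L n).
  by apply: sval_eq; apply: smapP => k [t r] /=; rewrite op_comp.
by exists (SMap uop) => n d t; apply: sval_eq; rewrite /= op_id.
Qed.
End Curry.

Hypothesis WH : hep W.

(** A homotopy of loops is a box whose first parameter is the loop parameter and whose two sides are
    constant at the base point. *)
Lemma hep_loops : hep (loops X rA (triv_act unit)).
Proof.
move=> B A' e f sf; set L := loops _ _ _ in f sf *.
pose ev n (l : L n) (t : Delta1 n) : W n := loop_ev unit n (l, fun _ => t).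
have evop i n (s : dmap i n) l t : ev i (op s l) (op s t) = op s (ev n l t).
  by rewrite /ev -smap_op.
have ev0 n l e' : ev n l (endp n e') = cpt fix_pt n.
  by apply: loop_ev_bd; exists tt; apply/nonsurj1P; case: e'; [right|left].
have cP i n (s : dmap i n) (x : sprod B Delta1 n) :
    ev i (f i ((op s x).1, endp i e)) (op s x).2 = op s (ev n (f n (x.1, endp n e)) x.2).
  by rewrite -evop -sf /= ?endp_op //; right.
have [||||||G0 [Gc Gl Gr Ga]] := @box W WH B A' e (SMap cP) (sconst _ fix_pt) (sconst _ fix_pt)
    (fun n y => ev n (f n (y.1.1, y.2)) y.1.2).
- move=> m n s [[b u] t] Ab; rewrite -evop; congr (ev m _ _).
  exact: (sf m n s (b, t) (or_introl Ab)).
- by move=> n b; rewrite [LHS]ev0.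
- by move=> n b; rewrite [LHS]ev0.
- by [].
- by move=> n b t Ab; rewrite [LHS]ev0.
- by move=> n b t Ab; rewrite [LHS]ev0.
pose u : smap (sprod (sprod B Delta1) (cube unit)) W :=
  @SMap (sprod (sprod B Delta1) (cube unit)) W (fun n y => G0 n ((y.1.1, y.2 tt), y.1.2))
    (fun m n s y => smap_op G0 s ((y.1.1, y.2 tt), y.1.2)).
have [|g gE] := @curry unit _ u.
  move=> n [b s] t [[] /nonsurj1P[] /= et]; rewrite /u /= in et *.
    by rewrite et Gl.
  by rewrite et Gr.
exists g => n x Ax; apply: loop_eq => k s t.
rewrite -smap_op gE -(sf _ _ _ _ Ax); have := subcx_op s Ax.
have -> : t = (fun _ => t tt) by apply/funext => -[].
case: (op s x) => b r [/= Ab|/= er]; first by rewrite /u /= Ga.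
by rewrite /= in er; subst r; rewrite /u /= Gc.
Qed.

Section Shape.
Variable m : nat.
Notation L := (loops X rA (triv_act (Bset m))).

Definition loop_shape (l : L 0) : smap (Icube m) W.
Proof.
refine (@SMap (Icube m) W (fun n c => loop_ev (Bset m) n (cpt l n, fromI c)) _).
by move=> i n s c; rewrite fromI_op -(op_cpt l s) -smap_op.
Defined.

Lemma loop_shape_bd l n c : Ibd m n c -> loop_shape l n c = cpt fix_pt n.
Proof. by move/fromI_bd; apply: loop_ev_bd. Qed.

Lemma curryI D (u : smap (sprod D (Icube m)) W) :
  (forall n d c, Ibd m n c -> u n (d, c) = cpt fix_pt n) ->
  exists f : smap D L, forall n d c, loop_ev (Bset m) n (f n d, fromI c) = u n (d, c).
Proof.
move=> u0.
pose u' : smap (sprod D (cube (Bset m))) W := @SMap (sprod D (cube (Bset m))) W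
  (fun n y => u n (y.1, toI y.2))
  (fun i n s y => etrans (congr1 (fun e => u i (_, e)) (toI_op s y.2)) (smap_op u s (y.1, toI y.2))).
have [|f fE] := @curry (Bset m) D u'.
  by move=> n d t h; apply: u0; apply/fromI_bd; rewrite toIK.
by exists f => n d c; rewrite fE /u' /= fromIK.
Qed.

Lemma loop_shape_surj (v : smap (Icube m) W) : (forall n c, Ibd m n c -> v n c = cpt fix_pt n) ->
  exists l, loop_shape l = v.
Proof.
move=> v0; have [|f fE] := @curryI (simplex 0) (scomp v (psnd _ _)); first by move=> n d; apply: v0.
exists (f 0 (did 0)); apply: smapP => n c.
rewrite -[RHS](fE n (zero_deg n) c) [zero_deg n](dmap0_eq _ (op (zero_deg n) (did 0 : simplex 0 0))).
by rewrite smap_op.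
Qed.

(** With [connected_hrel] this identifies the components of the loop space with relative homotopy
    classes of cubes in the fixed points. *)
Lemma hrel_connected l l' : hrel (Ibd m) (loop_shape l) (loop_shape l') -> connected l l'.
Proof.
move=> [h [h0 h1 hA]].
pose u : smap (sprod Delta1 (Icube m)) W := @SMap (sprod Delta1 (Icube m)) W
  (fun n y => h n (y.2, y.1)) (fun i n s y => smap_op h s (y.2, y.1)).
have [|f fE] := @curryI Delta1 u.
  by move=> n t c Ac; rewrite /u /= hA // loop_shape_bd.
apply: rst_step; exists (f 1 (did 1)).
split; apply: loop_eq => k s t; rewrite -!smap_op -(toIK t) fE /u /= d1comp dcst_comp.
  by rewrite h0 /=; congr (loop_ev _ _ (op _ l, _)); apply: dmap0_eq.
by rewrite h1 /=; congr (loop_ev _ _ (op _ l', _)); apply: dmap0_eq.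
Qed.

Lemma connected_hrel l l' : connected l l' -> hrel (Ibd m) (loop_shape l) (loop_shape l').
Proof.
elim=> {l l'} [_ _ [e [<- <-]]|l|l l' _ h|l l' l'' _ h _ h'].
- pose u : smap (sprod (Icube m) Delta1) W := @SMap (sprod (Icube m) Delta1) W
    (fun n y => loop_ev (Bset m) n (op (y.2 : dmap n 1) e, fromI y.1))
    (fun i n s y => etrans (congr2 (fun a b => loop_ev _ i (a, b)) (op_comp _ _ e) (fromI_op s y.1))
       (smap_op (loop_ev (Bset m)) s (op (y.2 : dmap n 1) e, fromI y.1))).
  exists u; split=> [n c|n c|n c t Ac].
  - apply: (congr1 (fun l => loop_ev (Bset m) n (l, fromI c))).
    by rewrite /cpt -op_comp dcst_comp.
  - apply: (congr1 (fun l => loop_ev (Bset m) n (l, fromI c))).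
    by rewrite /cpt -op_comp dcst_comp.
  - by rewrite loop_shape_bd //; apply: loop_ev_bd; apply/fromI_bd.
- exact: hrel_refl.
- exact: hrel_sym.
- exact: hrel_trans h h'.
Qed.
End Shape.
End Space.
End Loops.

(** * From homotopy groups of spectra to weak equivalences of fixed points *)

Section Stable.
Variables (gT : finGroupType) (G : {group gT}) (X Y : algebra G) (f : mor X Y 0).
Hypotheses (Xfib : fibrant X) (Yfib : fibrant Y).
Variables (H : {group gT}) (sHG : H \subset G).

Section Level.
Variables (A : finType) (rA : action H A).

Lemma fixed_map_pt : fixed_map f sHG rA 0 (fix_pt sHG X rA) = fix_pt sHG Y rA.
Proof. by apply: sval_eq; rewrite /= /ev mor_pt. Qed.

Lemma loops_map_ev (B : finType) n (l : loops X rA (triv_act H B) n) t :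
  loop_ev sHG Y rA B n (loops_map f sHG rA (triv_act H B) n l, t) =
  fixed_map f sHG rA n (loop_ev sHG X rA B n (l, t)).
Proof. exact: sval_eq. Qed.

Lemma loop_shape_map m (l : loops X rA (triv_act H (Bset m)) 0) :
  loop_shape sHG (loops_map f sHG rA (triv_act H (Bset m)) 0 l) =
  scomp (fixed_map f sHG rA) (loop_shape sHG l).
Proof.
apply: smapP => n c; apply: etrans (loops_map_ev _ _).
by congr (loop_ev sHG Y rA _ _ (_, _)); rewrite /cpt smap_op.
Qed.

Let WX := fixed X sHG rA.
Let WY := fixed Y sHG rA.
Let XH : hep WX. Proof. exact/Kan_hep/(Xfib.1). Qed.
Let YH : hep WY. Proof. exact/Kan_hep/(Yfib.1). Qed.

Hypothesis bij : forall B : finType, bijective (pi_ind f sHG rA (triv_act H B)).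

Lemma fixed_map_surj m (v : smap (Icube m) WY) :
  (forall n c, Ibd m n c -> v n c = cpt (fix_pt sHG Y rA) n) ->
  exists u : smap (Icube m) WX, (forall n c, Ibd m n c -> u n c = cpt (fix_pt sHG X rA) n) /\
    hrel (Ibd m) (scomp (fixed_map f sHG rA) u) v.
Proof.
move=> /loop_shape_surj[lv <-]; have [g _ gK] := bij (Bset m).
have [l lE] := component_surj (g (component lv)).
exists (loop_shape sHG l); split; first by move=> n c; apply: loop_shape_bd.
rewrite -loop_shape_map; apply: connected_hrel => //; apply: component_eq.
by rewrite -pi0_mapE -lE; apply: gK.
Qed.

Lemma fixed_map_inj m (u : smap (Icube m) WX) :
  (forall n c, Ibd m n c -> u n c = cpt (fix_pt sHG X rA) n) ->
  hrel (Ibd m) (scomp (fixed_map f sHG rA) u) (sconst _ (fix_pt sHG Y rA)) ->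
  hrel (Ibd m) u (sconst _ (fix_pt sHG X rA)).
Proof.
move=> /loop_shape_surj[l <-].
have [//|l0 e0] := @loop_shape_surj _ _ _ sHG X _ rA m (sconst _ (fix_pt sHG X rA)).
have -> : sconst (Icube m) (fix_pt sHG Y rA) = scomp (fixed_map f sHG rA) (loop_shape sHG l0).
  by apply: smapP => n c; rewrite e0; exact: esym (F_cpt fixed_map_pt n).
rewrite -e0 -!loop_shape_map => /hrel_connected h.
apply: connected_hrel => //; apply: component_eq; apply: (bij_inj (bij (Bset m))).
rewrite /pi_ind !pi0_mapE; exact: connected_component.
Qed.

Lemma fixed_map_contr B (A' : subcx B) : ext (hofib (fixed_map f sHG rA) (fix_pt sHG Y rA)) A'.
Proof.
have := @ext_null _ (hf_base fixed_map_pt) (hep_hofib fixed_map_pt XH YH); apply.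
exact: hofib_null XH YH fixed_map_surj fixed_map_inj.
Qed.

(** Uncurried, a family of loops in the target is constant at the end [false], as [hofib_ext_path]
    demands. Working relative to both ends of the loop coordinate keeps the lift and the homotopy
    families of loops. *)
Lemma loops_map_weq : weq (loops_map f sHG rA (triv_act H unit)).
Proof.
move=> B A' x z sx xz; set LX := loops X _ _ in x sx xz *; set LY := loops Y _ _ in z xz *.
pose evX n (l : LX n) (t : Delta1 n) : WX n := loop_ev sHG X rA unit n (l, fun _ => t).
pose evY n (l : LY n) (t : Delta1 n) : WY n := loop_ev sHG Y rA unit n (l, fun _ => t).
have evXop i n (s : dmap i n) l t : evX i (op s l) (op s t) = op s (evX n l t).
  by rewrite /evX -smap_op.
have evYop i n (s : dmap i n) l t : evY i (op s l) (op s t) = op s (evY n l t).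
  by rewrite /evY -smap_op.
have evX0 n l t : sc_ends n t -> evX n l t = cpt (fix_pt sHG X rA) n.
  by move=> /nonsurj1P h; apply: loop_ev_bd; exists tt.
have evY0 n l t : sc_ends n t -> evY n l t = cpt (fix_pt sHG Y rA) n.
  by move=> /nonsurj1P h; apply: loop_ev_bd; exists tt.
have evF n l t : evY n (loops_map f sHG rA (triv_act H unit) n l) t = fixed_map f sHG rA n (evX n l t).
  exact: loops_map_ev.
have evX_eq n (l l' : LX n) : (forall k (s : dmap k n) t, evX k (op s l) t = evX k (op s l') t) -> l = l'.
  move=> e; apply: (@loop_eq _ _ _ sHG X _ rA unit) => k s t.
  have -> : t = (fun _ => t tt) by apply/funext => -[].
  exact: e.
have evY_eq n (l l' : LY n) : (forall k (s : dmap k n) t, evY k (op s l) t = evY k (op s l') t) -> l = l'.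
  move=> e; apply: (@loop_eq _ _ _ sHG Y _ rA unit) => k s t.
  have -> : t = (fun _ => t tt) by apply/funext => -[].
  exact: e.
have F0 n : fixed_map f sHG rA n (cpt (fix_pt sHG X rA) n) = cpt (fix_pt sHG Y rA) n.
  exact: F_cpt fixed_map_pt n.
pose xx n (d : sprod B Delta1 n) := evX n (x n d.1) d.2.
pose zz : smap (sprod B Delta1) WY := @SMap (sprod B Delta1) WY (fun n d => evY n (z n d.1) d.2)
  (fun i n s d => etrans (congr1 (fun l => evY i l _) (smap_op z s d.1)) (evYop i n s (z n d.1) d.2)).
have [|||u [ux [h [h0 h1 hA]]]] :=
    hofib_ext_path fixed_map_pt YH fixed_map_contr (A := sc_prod A' sc_ends) (x := xx) (z := zz).
- move=> i n s [b t] [Ab|h]; first by rewrite /xx -evXop -sx.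
  have h' : sc_ends i (op s t) by apply: subcx_op.
  by rewrite /xx evX0 // evX0 // op_cpt.
- move=> n [b t] [Ab|h]; first by rewrite /xx /zz -evF xz.
  by rewrite /xx /zz [RHS]/= evX0 // evY0 // F0.
- by move=> n b; apply: evY0; left.
pose uu : smap (sprod B (cube unit)) WX := @SMap (sprod B (cube unit)) WX
  (fun n y => u n (y.1, y.2 tt)) (fun i n s y => smap_op u s (y.1, y.2 tt)).
have [|x' x'E] := @curry _ _ _ sHG X _ rA unit B uu.
  move=> n b t [[] /nonsurj1P tb]; rewrite /uu /= ux; last by right.
  exact: evX0.
have x'u n b t : evX n (x' n b) t = u n (b, t) by rewrite /evX x'E.
exists x'; split.
  move=> n b Ab; apply: evX_eq => k s t; rewrite -smap_op x'u ux; last by left; exact: subcx_op.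
  by rewrite /xx /= sx.
pose hh : smap (sprod (sprod B Delta1) (cube unit)) WY :=
  @SMap (sprod (sprod B Delta1) (cube unit)) WY (fun n y => h n ((y.1.1, y.2 tt), y.1.2))
  (fun i n s y => smap_op h s ((y.1.1, y.2 tt), y.1.2)).
have [|k kE] := @curry _ _ _ sHG Y _ rA unit _ hh.
  move=> n [b r] t [[] /nonsurj1P tb]; 
  have e : h n ((b, t tt), r) = fixed_map f sHG rA n (u n (b, t tt)) by apply: hA; right.
  by rewrite -[LHS]/(h n ((b, t tt), r)) e ux; [rewrite [xx _ _]evX0 ?F0|right].
have kh n b r t : evY n (k n (b, r)) t = h n ((b, t), r) by rewrite /evY kE.
have opE i n (s : dmap i n) (b : B n) e :
    op s ((b, endp n e) : sprod B Delta1 n) = ((op s b, endp i e) : sprod B Delta1 i).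
  by rewrite /= endp_op.
exists k; split=> [n b|n b|n b t Ab]; apply: evY_eq => j s t'; rewrite -?smap_op.
- rewrite opE kh h0 -[LHS]/(fixed_map f sHG rA j (u j (op s b, t'))) -x'u.
  by rewrite -evF.
- by rewrite opE kh h1.
- rewrite kh hA; last by left; exact: subcx_op.
  rewrite -[LHS]/(fixed_map f sHG rA j (u j (op s b, t'))) -x'u.
  by rewrite -evF.
Qed.
End Level.

Hypothesis bij : forall (A : finType) (rA : action H A) (B : finType),
  bijective (pi_ind f sHG rA (triv_act H B)).

Lemma fixed_map_weq (A : finType) (rA : action H A) : weq (fixed_map f sHG rA).
Proof.
pose rS := sum_action rA (triv_act H unit).
have hX (A' : finType) (r : action H A') : hep (fixed X sHG r) by exact/Kan_hep/(Xfib.1).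
have hY (A' : finType) (r : action H A') : hep (fixed Y sHG r) by exact/Kan_hep/(Yfib.1).
apply: (weq_cancel (F' := loops_map f sHG rS (triv_act H unit))
  (f := structure_map X sHG rA (triv_act H unit)) (g := structure_map Y sHG rA (triv_act H unit))).
- exact: hep_loops.
- move=> n x; apply: sval_eq; apply: smapP => k [t s] /=.
  rewrite /ev /structure_fun /= mor_push; last exact: inl_inj.
  by rewrite -(mor_op f); congr push; congr (f _ _ _ _); apply: dmap0_eq.
- exact: loops_map_weq.
- apply: hequiv_weq; [exact: hX|exact: hep_loops|exact: Xfib.2].
- apply: hequiv_weq; [exact: hY|exact: hep_loops|exact: Yfib.2].
Qed.
End Stable.

(** * The mapping path algebra *)

Lemma lexE (I : eqType) (J : I -> Type) (o : rel I) (q : forall i, rel (J i)) i (a b : J i) :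
  lex o q (existT J i a) (existT J i b) = q i a b.
Proof. by rewrite /lex /= eqxx tagged_asE. Qed.

Lemma lex_neq (I : eqType) (J : I -> Type) (o : rel I) (q : forall i, rel (J i)) i j
    (a : J i) (b : J j) : i != j -> lex o q (existT J i a) (existT J j b) = o i j.
Proof. by rewrite /lex /= => /negbTE ->. Qed.

(** Operadic composition stays among orders, so [PmuE] also evaluates composite operations on
    paths. *)
Lemma lex_order (I : eqType) (J : I -> Type) (o : rel I) (q : forall i, rel (J i)) :
  is_order o -> (forall i, is_order (q i)) -> is_order (lex o q).
Proof.
move=> [oT oR oA] qP; split=> [[i a] [j b]|[j b] [i a] [k c]|[i a] [j b]].
- case: (eqVneq i j) => [e|ij]; last by rewrite !lex_neq // eq_sym.
  by subst j; rewrite !lexE; case: (qP i).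
- case: (eqVneq i j) => [e|ij]; case: (eqVneq j k) => [e'|jk].
  + by subst j k; rewrite !lexE; case: (qP i) => _ + _; apply.
  + by subst j; rewrite lexE !lex_neq.
  + by subst k; rewrite lexE !lex_neq.
  + rewrite (lex_neq _ _ _ _ ij) (lex_neq _ _ _ _ jk) => h h'.
    case: (eqVneq i k) => [e|ik]; last by rewrite lex_neq //; apply: oR h h'.
    by subst k; case/eqP: ij; apply: oA; rewrite h.
- case: (eqVneq i j) => [e|ij].
    by subst j; rewrite !lexE; case: (qP i) => _ _ qA /qA ->.
  by rewrite !lex_neq ?(eq_sym j) // => /oA e; case/eqP: ij.
Qed.

(* The mapping path object X x_Y Y^(Delta^1) of f, with pointwise structure. *)
Section PathAlgebra.
Variables (gT : finGroupType) (G : {group gT}) (X Y : algebra G) (f : mor X Y 0).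

(** The second component is a map from Delta^1 x Delta^k to [Y A], unfolded so that every operation
    can be applied value by value. *)
Definition raw_path (A : finType) k : Type :=
  (X A k * (forall n, dmap n 1 -> dmap n k -> Y A n))%type.

Definition is_path A k (z : raw_path A k) : Prop :=
  (forall m n (r : dmap m n) u s, z.2 m (dcomp u r) (dcomp s r) = op r (z.2 n u s)) /\
  (forall n s, z.2 n (endp n false) s = ev f (op s z.1)).

Definition Pobj A k : Type := {z : raw_path A k | is_path z}.

Lemma Pobj_eq A k (z w : Pobj A k) : (sval z).1 = (sval w).1 ->
  (forall n u s, (sval z).2 n u s = (sval w).2 n u s) -> z = w.
Proof.
case: z w => [[x a] zP] [[y b] wP] /= exy eab; apply: eq_exist; congr pair => //.
apply/functional_extensionality_dep => n; apply/funext => u; apply/funext => s.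
exact: eab.
Qed.

Lemma pt_is_path A k : @is_path A k (pt X A k, fun n _ _ => pt Y A n).
Proof. by split=> [m n r u s|n s] /=; rewrite pt_op // /ev mor_pt. Qed.
Definition Ppt A k : Pobj A k := exist _ _ (pt_is_path A k).

(** The formulas for the operations are known to give paths only for injections, elements of [G] and
    orders; a value that is not a path is replaced by the base point. *)
Definition mkP A k (z : raw_path A k) : Pobj A k :=
  if pselect (is_path z) is left h then exist _ z h else Ppt A k.

Lemma mkPE A k (z : raw_path A k) : is_path z -> sval (mkP z) = z.
Proof. by rewrite /mkP; case: pselect. Qed.

Definition Pop_raw A m n (r : dmap m n) (z : raw_path A n) : raw_path A m :=
  (op r z.1, fun k u s => z.2 k u (dcomp r s)).

Lemma Pop_path A m n (r : dmap m n) (z : Pobj A n) : is_path (Pop_raw r (sval z)).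
Proof.
by case: z => z [z1 z2]; split=> [i j s u v|i s] /=; rewrite ?dcompA ?z1 // z2 op_comp.
Qed.

Definition Pspace (A : finType) : sset.
Proof.
refine (@SSet (Pobj A) (fun m n r z => exist _ _ (Pop_path r z)) _ _).
- by move=> n z; apply: Pobj_eq => [|k u s] /=; rewrite ?op_id ?d1comp.
- by move=> l m n g r z; apply: Pobj_eq => [|k u s] /=; rewrite ?op_comp ?dcompA.
Defined.

Definition Ppush (A C : finType) k (g : A -> C) (t : C -> dmap k 1) (z : Pobj A k) : Pobj C k :=
  mkP (push g t (sval z).1, fun n u s => push g (fun c => dcomp (t c) s) ((sval z).2 n u s)).

Lemma PpushE (A C : finType) k (g : A -> C) (t : C -> dmap k 1) (z : Pobj A k) : injective g ->
  sval (Ppush g t z) =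
  (push g t (sval z).1, fun n u s => push g (fun c => dcomp (t c) s) ((sval z).2 n u s)).
Proof.
move=> ginj; case: z => z [z1 z2]; apply: mkPE; split=> [i j r u s|i s] /=.
  rewrite push_op // z1; congr push; apply/funext => c; exact: dcompA.
by rewrite z2 push_op // /ev mor_push.
Qed.

(** Outside [G] the identity is taken, because [is_action] demands injectivity for every element of
    the ambient group. *)
Definition Pgact (A : finType) k (z : Pobj A k) (g : gT) : Pobj A k :=
  if g \in G then mkP (Defs.gact (sval z).1 g, fun n u s => Defs.gact ((sval z).2 n u s) g) else z.

Lemma PgactE A k (z : Pobj A k) g : g \in G ->
  sval (Pgact z g) = (Defs.gact (sval z).1 g, fun n u s => Defs.gact ((sval z).2 n u s) g).
Proof.
move=> gG; rewrite /Pgact gG; case: z => z [z1 z2]; apply: mkPE; split=> [i j r u s|i s] /=.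
  by rewrite z1 gact_op.
by rewrite z2 -gact_op // /ev mor_gact.
Qed.

Lemma Pgact_is_action A k : is_action G (@Pgact A k).
Proof.
have Xact := @gact_action _ _ X A k; have Yact n := @gact_action _ _ Y A n.
split=> [g z w|z g h gG hG].
  case gG: (g \in G); last by rewrite /Pgact gG.
  move=> /(congr1 sval); rewrite !PgactE // => e.
  apply: Pobj_eq => [|n u s]; first exact: (Xact.1 g) (congr1 fst e).
  exact: ((Yact n).1 g) (congr1 (fun a => a.2 n u s) e).
apply: Pobj_eq => [|n u s]; rewrite !PgactE ?groupM //=; first exact: Xact.2.
exact: (Yact n).2.
Qed.

Definition Pspectrum : gspectrum G.
Proof.
refine (@GSpectrum gT G Pspace Ppt Ppush Pgact _ _ _ _ _ _ (@Pgact_is_action) _ _ _).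
- by move=> A m n s; apply: Pobj_eq => [|k u r] //=; rewrite pt_op.
- by move=> A k t x; apply: Pobj_eq => [|n u s]; rewrite PpushE //= push_id.
- move=> A C E k g h t u v x ginj hinj vt vu.
  have hginj : injective (h \o g) by apply: inj_comp.
  apply: Pobj_eq => [|n a s]; rewrite !PpushE //=; first exact: push_push.
  by apply: push_push => // c /= h'; rewrite ?vt ?vu.
- by move=> A C k g t ginj; apply: Pobj_eq => [|n u s]; rewrite PpushE //= push_pt.
- move=> A C k g t x c ginj cg tc; apply: Pobj_eq => [|n u s]; rewrite PpushE //=.
    exact: push_boundary cg tc.
  by apply: push_boundary cg _ => //; exact: nonsurj_op.
- move=> A C m n s g t x ginj; apply: Pobj_eq => [|k u r]; rewrite /= !PpushE //= ?push_op //.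
  by congr push; apply/funext => c; rewrite dcompA.
- by move=> A m n s x g gG; apply: Pobj_eq => [|k u r]; rewrite /= !PgactE //= gact_op.
- by move=> A k g gG; apply: Pobj_eq => [|n u s]; rewrite PgactE //= gact_pt.
- move=> A C k h t x g hinj gG.
  by apply: Pobj_eq => [|n u s]; rewrite !(PgactE, PpushE) //= gact_push.
Defined.

Definition Pmu (I : finType) (A : I -> finType) k (o : 'I_k.+1 -> rel I)
    (z : forall i, Pobj (A i) k) : Pobj (Sigma A) k :=
  mkP (mu o (fun i => (sval (z i)).1),
       fun n u (s : dmap n k) => mu (fun l => o (s l)) (fun i => (sval (z i)).2 n u s)).

Lemma PmuE (I : finType) (A : I -> finType) k (o : 'I_k.+1 -> rel I)
    (z : forall i, Pobj (A i) k) : (forall l, is_order (o l)) ->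
  sval (Pmu o z) = (mu o (fun i => (sval (z i)).1),
       fun n u (s : dmap n k) => mu (fun l => o (s l)) (fun i => (sval (z i)).2 n u s)).
Proof.
move=> oP; apply: mkPE; split=> [i j r u s|i s] /=.
  rewrite mu_op //; congr mu; first by apply/funext => l; rewrite dcompE.
  by apply/functional_extensionality_dep => l; case: (z l) => w [w1 w2] /=.
rewrite mu_op // /ev mor_mu //; congr mu.
by apply/functional_extensionality_dep => l; case: (z l) => w [w1 w2] /=.
Qed.

Definition Palgebra : algebra G.
Proof.
refine (@Algebra gT G Pspectrum Pmu _ _ _ _ _ _ _).
- move=> I A m n s o x oP; have oP' l : is_order (o (s l)) by [].
  apply: Pobj_eq => [|k u r]; rewrite /= !PmuE //=; first by rewrite mu_op.
  by congr mu; apply/funext => l; rewrite dcompE.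
- move=> I A k o x i oP xi; apply: Pobj_eq => [|n u s]; rewrite PmuE //=.
    by apply: (mu_pt (i := i)) => //; rewrite xi.
  by apply: (mu_pt (i := i)) => //; rewrite xi.
- move=> I A C k o g t x oP ginj.
  have sinj : injective (fun u : Sigma A => existT C (tag u) (g (tag u) (tagged u)) : Sigma C).
    move=> [i a] [j b] /= e; have ij : i = j by exact: (congr1 (@tag _ _) e).
    subst j; congr existT; apply: ginj.
    (* Decidable equality of the tags gives equality of the second components. *)
    by have /eqP := e; rewrite -tag_eqE /tag_eq /= eqxx /= tagged_asE => /eqP.
  apply: Pobj_eq => [|n u s]; rewrite PmuE //= PpushE // PmuE //=.
    rewrite -mu_push //; congr mu; apply/functional_extensionality_dep => i.
    by rewrite PpushE.
  rewrite -(@mu_push _ _ _ _ _ _ _ _ _ (fun i c => dcomp (t i c) s)) //; congr mu.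
  by apply/functional_extensionality_dep => i; rewrite PpushE.
- move=> I A k o x g oP gG; apply: Pobj_eq => [|n u s]; rewrite PgactE // !PmuE //= mu_gact //.
    by congr mu; apply/functional_extensionality_dep => i; rewrite PgactE.
  by congr mu; apply/functional_extensionality_dep => i; rewrite PgactE.
- move=> I I' e A k o x oP ebij.
  have einj : injective (fun u : Sigma (fun i => A (e i)) =>
      existT A (e (tag u)) (tagged u) : Sigma A).
    move=> [i a] [j b] /= h; have /(bij_inj ebij) ij : e i = e j by exact: (congr1 (@tag _ _) h).
    subst j; congr existT.
    by have /eqP := h; rewrite -tag_eqE /tag_eq /= eqxx /= tagged_asE => /eqP.
  have oP' l : is_order (fun i j => o l (e i) (e j)).
    have [o1 o2 o3] := oP l; split=> [i j|j i l'|i j h]; first exact: o1.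
      exact: o2.
    by apply: (bij_inj ebij); apply: o3.
  apply: Pobj_eq => [|n u s]; rewrite PpushE // !PmuE //=; first exact: mu_sym.
  rewrite -(mu_sym (e := e)) //; congr push; apply/funext => c.
  exact: dcst_comp.
- move=> A k o x oP; have uinj : injective (fun a => existT (fun _ : unit => A) tt a : Sigma (fun _ : unit => A)).
    move=> a b /= /eqP; rewrite -tag_eqE /tag_eq /= tagged_asE => /eqP //.
  apply: Pobj_eq => [|n u s]; rewrite PmuE // PpushE //= mu_unit //.
  by congr push; apply/funext => c; rewrite dcst_comp.
- move=> I J A k o q x oP qP.
  have cinj : injective (fun u : Sigma (fun ij : Sigma J => A (tag ij) (tagged ij)) =>
            existT (fun i => Sigma (A i)) (tag (tag u))
              (existT (A (tag (tag u))) (tagged (tag u)) (tagged u))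
            : Sigma (fun i => Sigma (A i))).
    pose back (w : Sigma (fun i => Sigma (A i))) : Sigma (fun ij : Sigma J => A (tag ij) (tagged ij)) :=
      existT (fun ij : Sigma J => A (tag ij) (tagged ij))
        (existT J (tag w) (tag (tagged w))) (tagged (tagged w)).
    by apply: (can_inj (g := back)) => -[[i j] a].
  have lP l : is_order (lex (o l) (fun i => q i l)) by apply: lex_order.
  apply: Pobj_eq => [|n u s]; rewrite PpushE // !PmuE //=.
    apply: etrans (@mu_comp _ _ X _ _ _ _ _ _ (fun i j => (sval (x i j)).1) oP qP) _.
    congr mu; by apply/functional_extensionality_dep => i; rewrite PmuE.
  transitivity (mu (fun l => o (s l)) (fun i => mu (fun l => q i (s l))
    (fun j => (sval (x i j)).2 n u s))); last first.
    by congr mu; apply/functional_extensionality_dep => i; rewrite PmuE.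
  apply: etrans (@mu_comp _ _ Y _ _ _ _ (fun l => o (s l)) (fun i l => q i (s l))
    (fun i j => (sval (x i j)).2 n u s) _ _) => //.
  by congr push; apply/funext => c; exact: dcst_comp.
Defined.

Definition path_start : mor Palgebra X 0.
Proof.
refine (@Mor _ _ Palgebra X 0 (fun A k z _ => (sval (z : Pobj A k)).1) _ _ _ _ _) => //.
- by move=> A C k g t x s ginj; rewrite /= PpushE.
- by move=> A k x s g gG; rewrite /= PgactE.
- by move=> I A k o x s oP; rewrite /= PmuE.
Defined.

Definition path_end : mor Palgebra Y 0.
Proof.
refine (@Mor _ _ Palgebra Y 0
  (fun A k z _ => (sval (z : Pobj A k)).2 k (endp k true) (did k)) _ _ _ _ _) => //.
- by move=> A k l r [z [z1 z2]] s; rewrite /= -z1 endp_op dcomp1 d1comp.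
- move=> A C k g t x s ginj; rewrite /= PpushE //=; congr push.
  by apply/funext => c; rewrite dcomp1.
- by move=> A k x s g gG; rewrite /= PgactE.
- move=> I A k o x s oP; rewrite /= PmuE //=; congr mu.
  by apply/funext => l; rewrite didE.
Defined.

(** The evaluation of paths as an edge of the mapping space, from the composite of [f], [path_start]
    and [g] to that of [path_end] and [g]. *)
Definition path_homotopy Z (g : mor Z Palgebra 0) : mor Z Y 1.
Proof.
refine (@Mor _ _ Z Y 1 (fun A k z s => (sval (ev g z : Pobj A k)).2 k s (did k)) _ _ _ _ _).
- move=> A k l r z s; rewrite ev_op /=; case: (ev g z) => w [w1 w2] /=.
  by rewrite -w1 d1comp dcomp1.
- by move=> A k s; rewrite /ev mor_pt.
- move=> A C k h t z s hinj; rewrite /ev mor_push //= PpushE //=; congr push.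
  by apply/funext => c; rewrite dcomp1.
- by move=> A k z s h hG; rewrite /ev mor_gact //= PgactE.
- move=> I A k o z s oP; rewrite /ev mor_mu //= PmuE //=; congr mu.
  by apply/funext => l; rewrite didE.
Defined.

Lemma path_homotopy0 Z (g : mor Z Palgebra 0) A k (z : Z A k) :
  path_homotopy g A k z (endp k false) = ev f (ev path_start (ev g z)).
Proof. by rewrite /=; case: (ev g z) => w [w1 w2]; rewrite /= w2 op_id. Qed.

Section TrivFib.
Variables (H : {group gT}) (sHG : H \subset G) (A : finType) (rA : action H A).

Lemma path_at_fixed k (w : fixed Palgebra sHG rA k) n (u : dmap n 1) (r : dmap n k) h : h \in H ->
  twist rA ((sval (sval w)).2 n u r) h = (sval (sval w)).2 n u r.
Proof.
case: w => w wP hH /=; rewrite -[in RHS](wP h hH).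
have hG := subsetP sHG _ hH; have inj := act_inj rA h.
rewrite PpushE //= PgactE // /twist /=; congr push.
by apply/funext => c; rewrite dcst_comp.
Qed.

(** A lifting problem against a boundary amounts to starting points [x], paths [y] and end points
    [z], which is the input of [weq_lift]; the new starting points and paths assemble to the
    lift. *)
Lemma path_end_trivial : hep (fixed Y sHG rA) -> weq (fixed_map f sHG rA) ->
  trivial_fibration (fixed_map path_end sHG rA).
Proof.
move=> YH wf n b z bz.
pose FX := fixed X sHG rA; pose FY := fixed Y sHG rA.
pose x k (s : simplex n k) : FX k := if pselect (nonsurj s) is left ns then
  fixed_map path_start sHG rA k (b k (exist _ s ns)) else cpt (fix_pt sHG X rA) k.
have xE k s (ns : nonsurj s) : x k s = fixed_map path_start sHG rA k (b k (exist _ s ns)).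
  by rewrite /x; case: pselect => // ns'; rewrite (Prop_irrelevance ns' ns).
have sx : sim_on (sc_bd n) x.
  move=> i j r s ns; rewrite (xE _ _ ns) (xE _ _ (nonsurj_op r ns)) -!smap_op.
  by congr (fixed_map _ _ _ i (b i _)); apply: eq_exist.
pose pathb k (ns : boundary n k) (u : dmap k 1) : FY k :=
  exist (fun y : Y A k => forall h, h \in H -> twist rA y h = y) _
    (fun h hH => path_at_fixed (b k ns) u (did k) hH).
pose y k (su : sprod (simplex n) Delta1 k) : FY k := if pselect (nonsurj su.1) is left ns then
  pathb k (exist _ su.1 ns) su.2 else cpt (fix_pt sHG Y rA) k.
have yE k s u (ns : nonsurj s) : y k (s, u) = pathb k (exist _ s ns) u.
  by rewrite /y; case: pselect => // ns'; rewrite (Prop_irrelevance ns' ns).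
have [|||x' [K [x'x K0 K1 Ky]]] := weq_lift YH wf (A := sc_bd n) (x := x) (z := z) (h := y) sx.
- move=> i j r [s u] ns; rewrite [op r _]/= (yE _ _ _ ns) (yE _ _ _ (nonsurj_op r ns)).
  apply: sval_eq => /=.
  have -> : exist _ (dcomp s r) (nonsurj_op r ns) = op r (exist _ s ns : boundary n j) by apply: eq_exist.
  rewrite smap_op /=; case: (sval (b j _)) => w [w1 w2] /=.
  by rewrite -w1 d1comp dcomp1.
- move=> k s ns; rewrite (yE _ _ _ ns) (xE _ _ ns); apply: sval_eq => /=.
  by case: (sval (b k _)) => w [w1 w2]; rewrite /= w2 op_id.
- move=> k s ns; rewrite (yE _ _ _ ns) -(bz k (exist _ s ns)); exact: sval_eq.
have wP k (s : dmap k n) : is_path (sval (x' k s),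
    fun i (u : dmap i 1) (r : dmap i k) => sval (K i (dcomp s r, u))).
  split=> [i j r u v|i r] /=.
    by rewrite dcompA -[op r (sval _)]/(sval (op r (K j _))) -smap_op.
  rewrite K0 /= -[op r (sval _)]/(sval (op r (x' k s))) -smap_op //.
have wfix k (s : dmap k n) h : h \in H ->
    twist (X := Palgebra) rA (exist _ _ (wP k s) : Palgebra A k) h = exist _ _ (wP k s).
  move=> hH; have hG := subsetP sHG _ hH; have inj := act_inj rA h.
  apply: Pobj_eq => [|i u r]; rewrite /twist /= PpushE //= PgactE //=.
    exact: (svalP (x' k s)).
  rewrite -[in RHS](svalP (K i (dcomp s r, u)) h hH) /twist; congr push.
  by apply/funext => c; rewrite dcst_comp.
have wop i j (r : dmap i j) (s : dmap j n) :
    exist (fun y : Palgebra A i => forall h, h \in H -> twist rA y h = y) _ (wfix i (dcomp s r)) =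
    op r (exist _ _ (wfix j s) : fixed Palgebra sHG rA j).
  apply: sval_eq; apply: Pobj_eq => [|l u v] /=; last by rewrite dcompA.
  by rewrite -[op r (sval _)]/(sval (op r (x' j s))) -smap_op.
exists (@SMap (simplex n) (fixed Palgebra sHG rA) (fun k s => exist _ _ (wfix k s)) wop).
split=> [k [s ns]|k s].
  apply: sval_eq; apply: Pobj_eq => [|i u r] /=; first by rewrite x'x // (xE _ _ ns).
  have ns' := nonsurj_op r ns; rewrite Ky // (yE _ _ _ ns') /=.
  have -> : exist _ (dcomp s r) ns' = op r (exist _ s ns : boundary n k) by apply: eq_exist.
  by rewrite smap_op /= dcomp1.
by apply: sval_eq; rewrite /= dcomp1 K1.
Qed.
End TrivFib.
End PathAlgebra.

(** * The Whitehead theorem *)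

Section Homotopy.
Variables (gT : finGroupType) (G : {group gT}).

Lemma mor_eq0 (X Y : algebra G) (f g : mor X Y 0) :
  (forall A k (x : X A k), ev f x = ev g x) -> f = g.
Proof.
by move=> e; apply: morP => A k x s; rewrite (dmap0_eq s (zero_deg k)); apply: e.
Qed.

Lemma mor_compA (X Y Z T : algebra G) (f : mor Z T 0) (g : mor Y Z 0) (h : mor X Y 0) :
  mor_comp f (mor_comp g h) = mor_comp (mor_comp f g) h.
Proof. exact: mor_eq0. Qed.

Lemma mor_comp1 (X Y : algebra G) (f : mor X Y 0) : mor_comp f (mor_id X) = f.
Proof. exact: mor_eq0. Qed.

Lemma mor_1comp (X Y : algebra G) (f : mor X Y 0) : mor_comp (mor_id Y) f = f.
Proof. exact: mor_eq0. Qed.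

Definition post_mor (X Y Z : algebra G) (d : mor Y Z 0) n (f : mor X Y n) : mor X Z n.
Proof.
refine (@Mor _ _ X Z n (fun A k x s => ev d (f A k x s)) _ _ _ _ _).
- by move=> A k l r x s; rewrite mor_op ev_op.
- by move=> A k s; rewrite mor_pt /ev mor_pt.
- by move=> A C k g t x s ginj; rewrite mor_push // /ev mor_push.
- by move=> A k x s g gG; rewrite mor_gact // /ev mor_gact.
- by move=> I A k o x s oP; rewrite mor_mu // /ev mor_mu.
Defined.

Definition postcomp (X Y Z : algebra G) (d : mor Y Z 0) : smap (Map X Y) (Map X Z).
Proof.
refine (@SMap (Map X Y) (Map X Z) (fun n f => post_mor d f) _).
by move=> m n u f; apply: morP.
Defined.

Lemma postcompE (X Y Z : algebra G) (d : mor Y Z 0) (f : mor X Y 0) :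
  postcomp X d 0 f = mor_comp d f.
Proof. exact: mor_eq0. Qed.

Lemma mor_comp_connected (X Y Z : algebra G) (f f' : mor Y Z 0) (g g' : mor X Y 0) :
  @connected (Map Y Z) f f' -> @connected (Map X Y) g g' ->
  @connected (Map X Z) (mor_comp f g) (mor_comp f' g').
Proof.
move=> ff' gg'; apply: (@rst_trans _ _ _ (mor_comp f' g)).
  exact: (smap_connected (precomp g Z) ff').
by rewrite -!postcompE; exact: (smap_connected (postcomp X f') gg').
Qed.

Variables (X Y : algebra G) (H : {group gT}) (sHG : H \subset G).

Section Edge.
Variable e : mor X Y 1.

Lemma edge_genuine_proof (x : genuine_fixed X sHG 0) h : h \in H ->
  Defs.gact (e void 1 (op (dcst 1 ord0) (sval x)) (did 1)) h =
  e void 1 (op (dcst 1 ord0) (sval x)) (did 1).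
Proof.
case: x => x xP hH; have hG := subsetP sHG _ hH.
by rewrite -mor_gact // gact_op // [in LHS]xP.
Qed.

(** An edge of the mapping space, evaluated on a degenerate 1-simplex, is an edge joining the two
    images of the point. *)
Lemma edge_pi0 (a : pi0_fixed X sHG) :
  pi0_ind (op (s := Map X Y) (dcst 0 ord0) e) sHG a =
  pi0_ind (op (s := Map X Y) (dcst 0 ord_max) e) sHG a.
Proof.
have [x ->] := component_surj a; rewrite /pi0_ind !pi0_mapE.
apply: connected_component; apply: rst_step.
exists (exist (fun y : Y void 1 => forall h, h \in H -> Defs.gact y h = y) _ (edge_genuine_proof x)).
split; apply: sval_eq; rewrite /= -mor_op /ev /= d1comp -op_comp;
  by rewrite (dmap0_eq (dcomp _ _) (did 0)) op_id dcst_comp.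
Qed.

Variables (A : finType) (rA : action H A) (B : finType) (rB : action H B).

Lemma edge_loop_op (phi : ihom (cube B) (X A) 0) m n (s : dmap m n)
    (ts : sprod (cube B) (simplex 1) n) :
  e A m (phi m ((op s ts).1, zero_deg m)) (op s ts).2 =
  op s (e A n (phi n (ts.1, zero_deg n)) ts.2).
Proof.
rewrite -mor_op -smap_op; congr (e _ _ (phi m (_, _)) _); exact: dmap0_eq.
Qed.

Definition edge_loop (phi : ihom (cube B) (X A) 0) : ihom (cube B) (Y A) 1 := SMap (edge_loop_op phi).

Lemma edge_loop_loop (phi : loops X rA rB 0) : is_loop rA rB (edge_loop (sval phi)).
Proof.
case: phi => phi [phi1 phi2]; split=> [n t s tb|h hH n t s] /=.
  by rewrite phi1 // mor_pt.
have hG := subsetP sHG _ hH; have inj := act_inj rA h.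
by rewrite phi2 // /twist mor_push // mor_gact.
Qed.

Lemma edge_pi (a : pi_graded X rA rB) :
  pi_ind (op (s := Map X Y) (dcst 0 ord0) e) sHG rA rB a =
  pi_ind (op (s := Map X Y) (dcst 0 ord_max) e) sHG rA rB a.
Proof.
have [x ->] := component_surj a; rewrite /pi_ind !pi0_mapE.
apply: connected_component; apply: rst_step.
exists (exist _ _ (edge_loop_loop x)).
split; apply: sval_eq; apply: smapP => n [t s];
  by rewrite /= /ev /= (dmap0_eq s (zero_deg n)) dcst_comp.
Qed.
End Edge.

Lemma pi0_ind_connected (f g : mor X Y 0) a :
  @connected (Map X Y) f g -> pi0_ind f sHG a = pi0_ind g sHG a.
Proof.
elim=> {f g} [_ _ [e [<- <-]]|f|f g _ ->|f g h _ -> _ ->] //; exact: edge_pi0.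
Qed.

Lemma pi_ind_connected (f g : mor X Y 0) (A : finType) (rA : action H A)
    (B : finType) (rB : action H B) a :
  @connected (Map X Y) f g -> pi_ind f sHG rA rB a = pi_ind g sHG rA rB a.
Proof.
elim=> {f g} [_ _ [e [<- <-]]|f|f g _ ->|f g h _ -> _ ->] //; exact: edge_pi.
Qed.
End Homotopy.

Section Functor.
Variables (gT : finGroupType) (G : {group gT}) (X Y Z : algebra G).
Variables (H : {group gT}) (sHG : H \subset G).

Lemma pi0_ind_comp (f : mor Y Z 0) (g : mor X Y 0) a :
  pi0_ind (mor_comp f g) sHG a = pi0_ind f sHG (pi0_ind g sHG a).
Proof.
have [x ->] := component_surj a; rewrite /pi0_ind !pi0_mapE.
by congr component; apply: sval_eq.
Qed.

Variables (A : finType) (rA : action H A) (B : finType) (rB : action H B).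

Lemma pi_ind_comp (f : mor Y Z 0) (g : mor X Y 0) a :
  pi_ind (mor_comp f g) sHG rA rB a = pi_ind f sHG rA rB (pi_ind g sHG rA rB a).
Proof.
have [x ->] := component_surj a; rewrite /pi_ind !pi0_mapE.
by congr component; apply: sval_eq; apply: smapP.
Qed.

Lemma pi_ind_id a : pi_ind (mor_id X) sHG rA rB a = a.
Proof.
have [x ->] := component_surj a; rewrite /pi_ind !pi0_mapE.
by congr component; apply: sval_eq; apply: smapP.
Qed.
End Functor.

Section Whitehead.
Variables (gT : finGroupType) (G : {group gT}).

Definition stable_equivalence (X Y : algebra G) (f : mor X Y 0) : Prop :=
  forall (H : {group gT}) (sHG : H \subset G) (A : finType) (rA : action H A)
    (B : finType) (rB : action H B), bijective (pi_ind f sHG rA rB).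

Lemma stable_equivalence_section (X Y : CAlg G) (f : mor X Y 0) : stable_equivalence f ->
  exists g : mor Y X 0, homotopic_mor (mor_comp f g) (mor_id Y).
Proof.
move=> bij.
have tf (H : {group gT}) (sHG : H \subset G) (A : finType) (rA : action H A) :
    trivial_fibration (fixed_map (path_end f) sHG rA).
  apply: path_end_trivial; first exact/Kan_hep/(calg_fibrant Y).1.
  by apply: fixed_map_weq => [||A' rA' B]; [exact: calg_fibrant|exact: calg_fibrant|exact: bij].
(* Cofibrancy speaks of restrictions, so the identity and the lift are repackaged along the
   restriction of [Y] to [G] itself. *)
pose idY := @Mor _ _ (res_algebra (subxx G) Y) Y 0 (mor_id Y) (@mor_op _ _ _ _ _ (mor_id Y))
  (@mor_pt _ _ _ _ _ (mor_id Y)) (@mor_push _ _ _ _ _ (mor_id Y)) (@mor_gact _ _ _ _ _ (mor_id Y))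
  (@mor_mu _ _ _ _ _ (mor_id Y)).
have [g gP] := @calg_cofibrant _ _ Y G (subxx G) _ _ (path_end f) tf idY.
pose g' := @Mor _ _ Y (Palgebra f) 0 g (@mor_op _ _ _ _ _ g)
  (@mor_pt _ _ _ _ _ g) (@mor_push _ _ _ _ _ g) (@mor_gact _ _ _ _ _ g)
  (@mor_mu _ _ _ _ _ g).
exists (mor_comp (path_start f) g').
apply: rst_step; exists (path_homotopy g'); split; apply: mor_eq0 => A k y.
  apply: etrans (path_homotopy0 g' y).
  by rewrite {1}/ev /= dcst_comp.
by rewrite /ev /= dcst_comp; exact: gP.
Qed.

Lemma whitehead (X Y : CAlg G) (f : mor X Y 0) : stable_equivalence f -> is_equivalence f.
Proof.
move=> bf; have [g fg] := stable_equivalence_section bf.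
have bg : stable_equivalence g.
  move=> H sHG A rA B rB; have [f' fK _] := bf H sHG A rA B rB.
  have gK : cancel (pi_ind g sHG rA rB) (pi_ind f sHG rA rB).
    by move=> a; rewrite -pi_ind_comp (pi_ind_connected _ _ fg) pi_ind_id.
  by exists (pi_ind f sHG rA rB) => // a; rewrite -[LHS]fK gK fK.
have [h gh] := stable_equivalence_section bg.
exists g; split=> //.
(* A left and a right inverse of [g] agree: [f ~ f g h ~ h]. *)
have fh : homotopic_mor f h.
  have := mor_comp_connected fg (rst_refl _ _ h).
  rewrite mor_1comp -mor_compA => k.
  apply: rst_trans k; apply: rst_sym.
  rewrite -{2}(mor_comp1 f); exact: mor_comp_connected (rst_refl _ _ f) gh.
apply: rst_trans gh; exact: mor_comp_connected (rst_refl _ _ g) fh.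
Qed.
End Whitehead.

(** * Multiplication on homotopy groups *)

Section Dot.
Variables (gT : finGroupType) (G : {group gT}) (X : algebra G).

Lemma push_nocoord (A B C : finType) k (g : A -> B) (h : B -> C) (x : X A k) :
  injective g -> injective h ->
  push h nocoord (push g nocoord x) = push (h \o g) nocoord x.
Proof. by move=> ginj hinj; apply: push_push. Qed.

Lemma Sigma_map_inj (I : finType) (A B : I -> finType) (g : forall i, A i -> B i) :
  (forall i, injective (g i)) ->
  injective (fun u : Sigma A => existT B (tag u) (g (tag u) (tagged u)) : Sigma B).
Proof.
move=> ginj [i a] [j b] /= e; have ij : i = j by exact: (congr1 (@tag _ _) e).
subst j; congr existT; apply: ginj.
by have /eqP := e; rewrite -tag_eqE /tag_eq /= eqxx /= tagged_asE => /eqP.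
Qed.

Lemma mu_nocoord (I : finType) (A B : I -> finType) k (o : 'I_k.+1 -> rel I)
    (g : forall i, A i -> B i) (x : forall i, X (A i) k) :
  (forall l, is_order (o l)) -> (forall i, injective (g i)) ->
  mu o (fun i => push (g i) nocoord (x i)) =
  push (fun u : Sigma A => existT B (tag u) (g (tag u) (tagged u)) : Sigma B) nocoord (mu o x).
Proof. by move=> oP ginj; apply: (@mu_push _ _ _ _ _ _ _ _ _ (fun i => nocoord)). Qed.

Lemma push_eq_id (A : finType) k (g : A -> A) (x : X A k) :
  g =1 id -> push g nocoord x = x.
Proof. by move=> /funext ->; rewrite push_id. Qed.

Definition true_order k : 'I_k.+1 -> rel unit := fun _ _ _ => true.

Lemma true_orderP k l : is_order (@true_order k l).
Proof. by split=> // [[] []]. Qed.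

(* Three factors x, y : X(void) and z : X(A) multiplied in one step; both ways of
   bracketing reduce to this by operadic composition. *)
Section Three.
Variables (A : finType) (k : nat) (x y : X void k) (z : X A k).
Let T := option bool.
Let fam (t : T) : finType := if t is Some _ then (void : finType) else A.
Let val3 (t : T) : X (fam t) k :=
  match t return X (fam t) k with
  | Some true => x | Some false => y | None => z end.
(** The factors are ordered as x, y, z, in keeping with [bool_order], where [true] comes first. *)
Let rank (t : T) : nat := match t with Some true => 0 | Some false => 1 | None => 2 end.
Let ord3 : rel T := fun t u => rank t <= rank u.
Let sum3 (u : Sigma fam) : A :=
  match u with existT (Some _) v => match v : void with end | existT None a => a end.

Let ord3P : is_order ord3.
Proof. by split=> [[[]|] [[]|]|[[]|] [[]|] [[]|]|[[]|] [[]|]]. Qed.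

Let sum3_inj : injective sum3.
Proof. by case=> [[[]|] // a] [[[]|] // b] /= ->. Qed.

Let dot3 : X A k := push sum3 nocoord (mu (fun _ => ord3) val3).

Section Bracket.
Variables (J : bool -> finType) (q : forall b, 'I_k.+1 -> rel (J b)) (e : forall b, J b -> T).
Arguments q : clear implicits.
Arguments e : clear implicits.
Hypothesis qP : forall b l, is_order (q b l).
Let e' (u : Sigma J) : T := e (tag u) (tagged u).
Hypothesis ebij : bijective e'.
Hypothesis lexE3 : forall l (u v : Sigma J), lex bool_order (fun b => q b l) u v = ord3 (e' u) (e' v).
Variable h : forall b, Sigma (fun j => fam (e b j)) -> bfam A b.
Arguments h : clear implicits.
Hypothesis hinj : forall b, injective (h b).
Hypothesis hE : forall b (j : J b) (a : fam (e b j)),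
  @bsum A (existT (bfam A) b (h b (existT _ j a))) = sum3 (existT fam (e _ j) a).

(** [mu_comp] merges the two stages into one operation for the lexicographic order, and [mu_sym]
    relabels it along [e'] as the ternary one. *)
Lemma bracketE (w : forall b, X (bfam A b) k) :
  (forall b, w b = push (h b) nocoord (mu (q b) (fun j => val3 (e b j)))) ->
  push (@bsum A) nocoord (mu (fun _ => bool_order) w) = dot3.
Proof.
move=> wE.
have -> : w = fun b => push (h b) nocoord (mu (q b) (fun j => val3 (e b j))).
  by apply/functional_extensionality_dep.
have boP (l : 'I_k.+1) := bool_orderP.
rewrite mu_nocoord //.
rewrite -(@mu_comp _ _ X _ _ _ _ (fun _ => bool_order) q (fun b j => val3 (e b j))) //.
rewrite /dot3 -(@mu_sym _ _ X _ _ e' fam k (fun _ => ord3) val3) //.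
have lexEq : (fun l => lex bool_order (fun b => q b l)) =
    (fun l (i j : Sigma J) => ord3 (e' i) (e' j)).
  by apply/funext => l; apply/funext => u; apply/funext => v; apply: lexE3.
have einj : injective (fun u : Sigma (fun i => fam (e' i)) =>
    existT fam (e' (tag u)) (tagged u) : Sigma fam).
  move=> [i a] [j b] /= eq; have /(bij_inj ebij) ij : e' i = e' j by exact: (congr1 (@tag _ _) eq).
  subst j; congr existT.
  by have /eqP := eq; rewrite -tag_eqE /tag_eq /= eqxx /= tagged_asE => /eqP.
have cinj : injective (fun u : Sigma (fun ij : Sigma J => fam (e (tag ij) (tagged ij))) =>
          existT (fun i => Sigma (fun j : J i => fam (e i j))) (tag (tag u))
            (existT (fun j : J (tag (tag u)) => fam (e _ j)) (tagged (tag u)) (tagged u))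
          : Sigma (fun i => Sigma (fun j : J i => fam (e i j)))).
  pose back (w0 : Sigma (fun i => Sigma (fun j : J i => fam (e i j)))) :
      Sigma (fun ij : Sigma J => fam (e (tag ij) (tagged ij))) :=
    existT (fun ij : Sigma J => fam (e (tag ij) (tagged ij)))
      (existT J (tag w0) (tag (tagged w0))) (tagged (tagged w0)).
  by apply: (can_inj (g := back)) => -[[i j] a].
have sinj := @Sigma_map_inj _ _ _ h hinj; have binj := @bsum_inj A.
rewrite (push_nocoord _ sinj binj) (push_nocoord _ cinj (inj_comp binj sinj)).
rewrite (push_nocoord _ einj sum3_inj) -lexEq; congr push.
by apply/funext => -[[b j] a]; apply: hE.
Qed.
End Bracket.

Lemma mu_true (B : finType) (v : X B k) :
  push (fun u : Sigma (fun _ : unit => B) => tagged u) nocoord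
    (mu (@true_order k) (fun _ : unit => v)) = v.
Proof.
have uinj : injective (fun a => existT (fun _ : unit => B) tt a : Sigma (fun _ : unit => B)).
  by move=> a b /= /eqP; rewrite -tag_eqE /tag_eq /= tagged_asE => /eqP.
have tinj : injective (fun u : Sigma (fun _ : unit => B) => tagged u).
  by case=> [[] a] [[] b] /= ->.
rewrite mu_unit ?push_nocoord ?push_eq_id //.
by move=> l; apply: true_orderP.
Qed.

Lemma dot_right3 : dot x (dot y z) = dot3.
Proof.
pose J (b : bool) : finType := if b then (unit : finType) else (bool : finType).
pose q b : 'I_k.+1 -> rel (J b) := match b return 'I_k.+1 -> rel (J b) with
  | true => @true_order k | false => fun _ => bool_order end.
pose e b : J b -> T := match b return J b -> T with
  | true => fun _ => Some true | false => fun j : bool => if j then Some false else None end.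
pose h b : Sigma (fun j => fam (e b j)) -> bfam A b :=
  match b return Sigma (fun j => fam (e b j)) -> bfam A b with
  | true => fun u => tagged u
  | false => fun u => sum3 (existT fam (e false (tag u)) (tagged u)) end.
apply: (@bracketE J q e _ _ _ h).
- by case=> l; [apply: true_orderP|apply: bool_orderP].
- exists (fun t => match t with Some true => existT J true tt
    | Some false => existT J false true | None => existT J false false end).
    by case=> [[] []].
  by case=> [[]|].
- by move=> l [[] a] [[] d]; rewrite ?lexE ?lex_neq //; case: a; case: d.
- case=> [[j []]|[[] a] [[] b]] //=.
  by move=> ->.
- by case=> j //= [].
- case; first by rewrite [RHS]mu_true.
  pose c j : bfam A j -> fam (e false j) := match j return bfam A j -> fam (e false j) with
    true => id | false => id end.
  have cinj j : injective (c j) by case: j.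
  have -> : (fun j => val3 (e false j)) = fun j => push (c j) nocoord (bpair y z j).
    by apply/functional_extensionality_dep => -[] /=; rewrite push_id.
  rewrite mu_nocoord // ?push_nocoord.
  + by rewrite /= /dot; congr push; apply/funext => -[[] a].
  + exact: Sigma_map_inj.
  + by case=> [[] // a] [[] // b] /= ->.
  + by move=> l; apply: bool_orderP.
Qed.

Lemma dot_left3 : dot (dot x y) z = dot3.
Proof.
pose J (b : bool) : finType := if b then (bool : finType) else (unit : finType).
pose q b : 'I_k.+1 -> rel (J b) := match b return 'I_k.+1 -> rel (J b) with
  | true => fun _ => bool_order | false => @true_order k end.
pose e b : J b -> T := match b return J b -> T with
  | true => fun j : bool => Some j | false => fun _ => None end.
pose h b : Sigma (fun j => fam (e b j)) -> bfam A b :=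
  match b return Sigma (fun j => fam (e b j)) -> bfam A b with
  | true => fun u => tagged u
  | false => fun u => tagged u end.
apply: (@bracketE J q e _ _ _ h).
- by case=> l; [apply: bool_orderP|apply: true_orderP].
- exists (fun t => if t is Some j then existT J true j else existT J false tt).
    by case=> [[] []].
  by case.
- by move=> l [[] a] [[] d]; rewrite ?lexE ?lex_neq //; case: a; case: d.
- case=> [[j []]|[[] a] [[] b]] //=.
  by move=> ->.
- by case=> j //= [].
- case; last by rewrite [RHS]mu_true.
  pose c j : bfam void j -> fam (e true j) := match j return bfam void j -> fam (e true j) with
    true => id | false => id end.
  have cinj j : injective (c j) by case: j.
  have -> : (fun j => val3 (e true j)) = fun j => push (c j) nocoord (bpair x y j).
    by apply/functional_extensionality_dep => -[] /=; rewrite push_id.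
  rewrite mu_nocoord // ?push_nocoord.
  + by rewrite /= /dot; congr push; apply/funext => -[[] a].
  + exact: Sigma_map_inj.
  + by case=> [j []].
  + by move=> l; apply: bool_orderP.
Qed.

Lemma dotA : dot (dot x y) z = dot x (dot y z).
Proof. by rewrite dot_left3 dot_right3. Qed.
End Three.
End Dot.

(** * Multiplication on pi_0 and its action on homotopy groups *)

Section Pi0.
Variables (gT : finGroupType) (G : {group gT}) (X : algebra G).
Variables (H : {group gT}) (sHG : H \subset G).

Definition vsum2 (u : Sigma (fun _ : bool => void)) : void := tagged u.

Lemma vsum2_inj : injective vsum2.
Proof. by case=> [b []]. Qed.

(** For two factors at [void] the asymmetric family [bfam] can be replaced by a constant one, after
    which the factors can be exchanged. *)
Lemma dot_void k (x y : X void k) :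
  dot x y = push vsum2 nocoord (mu (fun _ => bool_order) (fun b : bool => if b then x else y)).
Proof.
pose c b : void -> bfam void b := match b return void -> bfam void b with
  true => id | false => id end.
have cinj b : injective (c b) by case: b.
have bE : bpair x y = fun b => push (c b) nocoord (if b then x else y).
  by apply/functional_extensionality_dep => -[] /=; rewrite push_id.
rewrite /dot bE mu_nocoord // ?push_nocoord.
- by congr push; apply/funext => -[b []].
- by case=> [b []].
- exact: bsum_inj.
- by move=> l; apply: bool_orderP.
Qed.

Definition swap_order (l : 'I_2) : rel bool :=
  if l == ord0 then bool_order else fun b c => bool_order (~~ b) (~~ c).

Lemma swap_orderP l : is_order (swap_order l).
Proof. by rewrite /swap_order; case: ifP => _; split; case=> [] [] // []. Qed.

(* The 1-simplex of the Barratt-Eccles operad joining the two orders on bool. *)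
Definition swap_edge (x y : X void 0) : X void 1 :=
  push vsum2 nocoord (mu swap_order (fun b : bool => op (dcst 1 ord0) (if b then x else y))).

Lemma swap_edge_gact (x y : genuine_fixed X sHG 0) h : h \in H ->
  Defs.gact (swap_edge (sval x) (sval y)) h = swap_edge (sval x) (sval y).
Proof.
case: x y => x xP [y yP] hH; have hG := subsetP sHG _ hH.
rewrite /swap_edge gact_push ?mu_gact //; [|exact: swap_orderP|exact: vsum2_inj].
congr push; congr mu; apply/functional_extensionality_dep => -[] /=.
  by rewrite gact_op // xP.
by rewrite gact_op // yP.
Qed.

Lemma op_swap_edge (x y : X void 0) j :
  op (dcst 0 j) (swap_edge x y) = push vsum2 nocoord (mu (fun _ => swap_order j) (fun b : bool => if b then x else y)).
Proof.
rewrite /swap_edge push_op ?mu_op; [|exact: swap_orderP|exact: vsum2_inj].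
congr push; first by apply/funext => -[].
congr mu; first by apply/funext => l; rewrite dcstE.
apply/functional_extensionality_dep => b.
by rewrite -op_comp (dmap0_eq (dcomp _ _) (did 0)) op_id.
Qed.

Lemma pi0_mulE (x y : genuine_fixed X sHG 0) :
  pi0_mul (component x) (component y) = component (fixed_mul X sHG 0 (x, y)).
Proof. by rewrite /pi0_mul pi0_pairE pi0_mapE. Qed.

(** [swap_edge] leads to the product of the same factors in the opposite order, and relabelling
    along [negb] turns that into the exchanged product. *)
Lemma pi0_mulC (a b : pi0_fixed X sHG) : pi0_mul a b = pi0_mul b a.
Proof.
have [x ->] := component_surj a; have [y ->] := component_surj b.
rewrite !pi0_mulE; apply: connected_component; apply: rst_step.
exists (exist (fun y : X void 1 => forall h, h \in H -> Defs.gact y h = y) _ (@swap_edge_gact x y)).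
split; apply: sval_eq; rewrite /= op_swap_edge dot_void //.
rewrite -(@mu_sym _ _ X _ _ negb (fun _ => void) 0 (fun _ => bool_order)); first last.
- by exists negb; apply: negbK.
- by move=> l; apply: bool_orderP.
rewrite push_nocoord; [|by case=> [? []]|exact: vsum2_inj].
congr push.
by congr mu; apply/functional_extensionality_dep => -[].
Qed.

Lemma pi0_mulA (a b c : pi0_fixed X sHG) : pi0_mul (pi0_mul a b) c = pi0_mul a (pi0_mul b c).
Proof.
have [x ->] := component_surj a; have [y ->] := component_surj b.
have [z ->] := component_surj c; rewrite !pi0_mulE; congr component.
by apply: sval_eq; rewrite /= dotA.
Qed.

Lemma pi0_unit_divisor (r a : pi0_fixed X sHG) : pi0_unit (pi0_mul r a) -> pi0_unit a.
Proof.
case=> v [_ vra]; exists (pi0_mul v r); rewrite pi0_mulC.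
by split; rewrite pi0_mulA.
Qed.

Section Scale.
Variables (A : finType) (rA : action H A) (B : finType) (rB : action H B).

Lemma pi_scaleE (x : genuine_fixed X sHG 0) (y : loops X rA rB 0) :
  pi_scale (component x) (component y) = component (loops_mul X sHG rA rB 0 (x, y)).
Proof. by rewrite /pi_scale pi0_pairE pi0_mapE. Qed.

Lemma pi_scaleA (a b : pi0_fixed X sHG) (c : pi_graded X rA rB) :
  pi_scale (pi0_mul a b) c = pi_scale a (pi_scale b c).
Proof.
have [x ->] := component_surj a; have [y ->] := component_surj b.
have [z ->] := component_surj c; rewrite pi0_mulE !pi_scaleE; congr component.
apply: sval_eq; apply: smapP => n [t s] /=.
by rewrite dot_op dotA.
Qed.

Lemma pi_scaleC (a b : pi0_fixed X sHG) (c : pi_graded X rA rB) :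
  pi_scale a (pi_scale b c) = pi_scale b (pi_scale a c).
Proof. by rewrite -!pi_scaleA pi0_mulC. Qed.
End Scale.

Section Restriction.
Variables (K : {group gT}) (sKG : K \subset G) (sKH : K \subset H).

Lemma pi0_resE (x : genuine_fixed X sHG 0) :
  pi0_res sHG sKG sKH (component x) = component (genuine_res X sHG sKG sKH 0 x).
Proof. exact: pi0_mapE. Qed.

Lemma pi0_res_one : pi0_res sHG sKG sKH (pi0_one X sHG) = pi0_one X sKG.
Proof. by rewrite pi0_resE; congr component; apply: sval_eq. Qed.
End Restriction.
End Pi0.

Lemma pi0_res_mul (gT : finGroupType) (G H K : {group gT}) (sHG : H \subset G)
    (sKG : K \subset G) (sKH : K \subset H) (X : algebra G) (a b : pi0_fixed X sHG) :
  pi0_res sHG sKG sKH (pi0_mul a b) = pi0_mul (pi0_res sHG sKG sKH a) (pi0_res sHG sKG sKH b).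
Proof.
have [x ->] := component_surj a; have [y ->] := component_surj b.
rewrite pi0_mulE !pi0_resE pi0_mulE; congr component; exact: sval_eq.
Qed.

Lemma pi0_res_unit (gT : finGroupType) (G H K : {group gT}) (sHG : H \subset G)
    (sKG : K \subset G) (sKH : K \subset H) (X : algebra G) (a : pi0_fixed X sHG) :
  pi0_unit a -> pi0_unit (pi0_res sHG sKG sKH a).
Proof.
case=> b [ab ba]; exists (pi0_res sHG sKG sKH b).
by rewrite -!pi0_res_mul ab ba pi0_res_one.
Qed.

Lemma pi0_res_res (gT : finGroupType) (G H K L : {group gT}) (sHG : H \subset G)
    (sKG : K \subset G) (sLG : L \subset G) (sKH : K \subset H) (sLK : L \subset K)
    (sLH : L \subset H) (X : algebra G) (a : pi0_fixed X sHG) :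
  pi0_res sKG sLG sLK (pi0_res sHG sKG sKH a) = pi0_res sHG sLG sLH a.
Proof.
have [x ->] := component_surj a.
by rewrite !pi0_resE; congr component; apply: sval_eq.
Qed.

Section MorPi0.
Variables (gT : finGroupType) (G : {group gT}) (X Y : algebra G) (f : mor X Y 0).

Lemma ev_dot A k (x : X void k) (y : X A k) : ev f (dot x y) = dot (ev f x) (ev f y).
Proof.
rewrite /ev /dot mor_push ?mor_mu; [|by move=> l; apply: bool_orderP|exact: bsum_inj].
by congr push; congr mu; apply/functional_extensionality_dep => -[].
Qed.

Variables (H : {group gT}) (sHG : H \subset G).

Lemma pi0_ind_mul (a b : pi0_fixed X sHG) :
  pi0_ind f sHG (pi0_mul a b) = pi0_mul (pi0_ind f sHG a) (pi0_ind f sHG b).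
Proof.
have [x ->] := component_surj a; have [y ->] := component_surj b.
rewrite pi0_mulE /pi0_ind !pi0_mapE pi0_mulE; congr component.
by apply: sval_eq; rewrite /= ev_dot.
Qed.

Lemma pi_ind_scale (A : finType) (rA : action H A) (B : finType) (rB : action H B)
    (a : pi0_fixed X sHG) (c : pi_graded X rA rB) :
  pi_ind f sHG rA rB (pi_scale a c) = pi_scale (pi0_ind f sHG a) (pi_ind f sHG rA rB c).
Proof.
have [x ->] := component_surj a; have [y ->] := component_surj c.
rewrite pi_scaleE /pi_ind /pi0_ind !pi0_mapE pi_scaleE; congr component.
by apply: sval_eq; apply: smapP => n [t s]; rewrite /= ev_dot ev_op.
Qed.

Lemma pi0_ind_res (K : {group gT}) (sKG : K \subset G) (sKH : K \subset H)
    (a : pi0_fixed X sHG) :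
  pi0_ind f sKG (pi0_res sHG sKG sKH a) = pi0_res sHG sKG sKH (pi0_ind f sHG a).
Proof.
have [x ->] := component_surj a; rewrite pi0_resE /pi0_ind !pi0_mapE pi0_resE.
by congr component; apply: sval_eq.
Qed.
End MorPi0.

(** * Corepresentability and restriction *)

Lemma homotopic_connected (X Y : sset) (f g : smap X Y) x :
  homotopic f g -> connected (f 0 x) (g 0 x).
Proof.
case=> h [h0 h1]; apply: rst_step; exists (h 1 (op (dcst 1 ord0) x, did 1)).
by split; rewrite -smap_op /= -op_comp d1comp (dmap0_eq (dcomp _ _) (did 0)) op_id ?h0 ?h1.
Qed.

Section FullSub.
Variables (X : sset) (P : X 0 -> Prop).

Lemma full_vertex x : P x -> forall v : dmap 0 0, P (op v x).
Proof. by move=> Px v; rewrite (dmap0_eq v (did 0)) op_id. Qed.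

Lemma full_P (x : full P 0) : P (sval x).
Proof. by case: x => x Px; rewrite /= -(op_id x). Qed.

Definition full_incl : smap (full P) X := @SMap (full P) X (fun n x => sval x) (fun _ _ _ _ => erefl).

Hypothesis Pinv : forall x y, connected x y -> P x -> P y.

Lemma dmap0_ends (v : dmap 0 1) : v = dcst 0 ord0 \/ v = dcst 0 ord_max.
Proof.
have vE : v = dcst 0 (v ord0) by apply: dmapP => i; rewrite dcstE (ord1 i).
by rewrite vE; case: (ord2P (v ord0)) => ->; [left|right].
Qed.

Lemma connected_full x y (Px : P x) (Py : P y) : connected x y ->
  @connected (full P) (exist _ x (full_vertex Px)) (exist _ y (full_vertex Py)).
Proof.
move=> h; elim: h Px Py => {x y} [x y [e [e0 e1]]|x|x y h IH|x y z h IH h' IH'] Px Py.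
- have Pe : forall v : dmap 0 1, P (op v e).
    by move=> v; case: (dmap0_ends v) => ->; rewrite ?e0 ?e1.
  apply: rst_step; exists (exist (fun x : X 1 => forall v : dmap 0 1, P (op v x)) e Pe).
  by split; apply: sval_eq.
- by rewrite (Prop_irrelevance Px Py); apply: rst_refl.
- exact/rst_sym/IH.
- have Py' := Pinv h Px; exact: rst_trans (IH Px Py') (IH' Py' Py).
Qed.
End FullSub.

Section Corepresentation.
Variables (gT : finGroupType) (G : {group gT}) (R : CAlg G).
Variable P : forall A : CAlg G, mor R A 0 -> Prop.
Hypothesis Pinv : forall (A : CAlg G) (f g : mor R A 0), homotopic_mor f g -> P f -> P g.

Lemma corepresents_factor (L A : CAlg G) (u : mor R L 0) (f : mor R A 0) :
  corepresents P u -> P f -> exists c : mor L A 0, homotopic_mor (mor_comp c u) f.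
Proof.
case=> _ /(_ A)[e [eE [g [_ eg]]]] Pf.
pose f' : full (X := Map R A) (P (A := A)) 0 := exist _ f (full_vertex (X := Map R A) Pf).
exists (g 0 f'); have := homotopic_connected f' eg.
by move/(smap_connected (full_incl _)); rewrite /= eE.
Qed.

(** The homotopy inverse of [e] is defined only on the selected components; invariance of [P] keeps
    the given path inside them. *)
Lemma corepresents_inj (L A : CAlg G) (u : mor R L 0) (f f' : mor L A 0) :
  corepresents P u -> homotopic_mor (mor_comp f u) (mor_comp f' u) -> homotopic_mor f f'.
Proof.
case=> _ /(_ A)[e [eE [g [ge _]]]] h.
have Pe (k : mor L A 0) : P (mor_comp k u) by rewrite -eE; apply: full_P.
have : @connected (full (X := Map R A) (P (A := A))) (e 0 f) (e 0 f').
  have eE' k : e 0 k = exist _ (mor_comp k u) (full_vertex (X := Map R A) (Pe k)).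
    by apply: sval_eq; rewrite eE.
  by rewrite !eE'; apply: connected_full => // a b; apply: Pinv.
move/(smap_connected g) => k.
apply: (@rst_trans _ _ _ (g 0 (e 0 f))); first by apply: rst_sym; exact: (@homotopic_connected (Map L A) (Map L A) _ _ f ge).
exact: rst_trans k (@homotopic_connected (Map L A) (Map L A) _ _ f' ge).
Qed.

Lemma corepresents_unique (T L : CAlg G) (l : mor R T 0) (u : mor R L 0) :
  corepresents P l -> corepresents P u ->
  (exists c : mor T L 0, homotopic_mor (mor_comp c l) u) /\
  (forall c : mor T L 0, homotopic_mor (mor_comp c l) u -> is_equivalence c).
Proof.
move=> cl cu; split=> [|c clu]; first exact: corepresents_factor cl cu.1.
have [d du] := corepresents_factor cu cl.1; exists d; split.
  apply: (corepresents_inj cl); rewrite mor_1comp -mor_compA.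
  exact: rst_trans (mor_comp_connected (rst_refl _ _ d) clu) du.
apply: (corepresents_inj cu); rewrite mor_1comp -mor_compA.
exact: rst_trans (mor_comp_connected (rst_refl _ _ c) du) clu.
Qed.
End Corepresentation.

Section Inverts.
Variables (gT : finGroupType) (G : {group gT}) (R : CAlg G).

Lemma inverts_homotopic (S : pi0_fixed R (subxx G) -> Prop) (A : CAlg G) (f g : mor R A 0) :
  homotopic_mor f g -> inverts S f -> inverts S g.
Proof. by move=> fg Sf a Sa; rewrite -(pi0_ind_connected _ fg); apply: Sf. Qed.

Lemma inverts_family_eq (S : subset_family R) : torsion_extension S ->
  @inverts _ _ R (S G (subxx G)) = @inverts_family _ _ R S.
Proof.
move=> tor; apply/functional_extensionality_dep => A; apply/funext => f; apply/propext.
split=> [Sf H sHG a Sa|Sf a]; last exact: Sf.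
have [r [b [Sb rab]]] := tor H sHG a Sa.
apply: (@pi0_unit_divisor _ _ _ _ _ (pi0_ind f sHG r)).
by rewrite -pi0_ind_mul rab pi0_ind_res; apply/pi0_res_unit/Sf.
Qed.
End Inverts.

(** * Homotopy groups under restriction to a subgroup *)

Section Restrict.
Variables (gT : finGroupType) (G K : {group gT}) (sKG : K \subset G).

Definition res_mor (X Y : algebra G) (f : mor X Y 0) : mor (res_algebra sKG X) (res_algebra sKG Y) 0.
Proof.
refine (@Mor _ _ (res_algebra sKG X) (res_algebra sKG Y) 0 f (@mor_op _ _ _ _ _ f)
  (@mor_pt _ _ _ _ _ f) (@mor_push _ _ _ _ _ f) _ (@mor_mu _ _ _ _ _ f)).
by move=> A k x s g gK; apply: (@mor_gact _ _ _ _ _ f); apply: (subsetP sKG).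
Defined.

Variables (H : {group gT}) (sHK : H \subset K) (sHG : H \subset G).

(** Restriction leaves the fixed points unchanged but alters their type; this identity on simplices
    carries statements across. *)
Definition genuine_unres (X : algebra G) :
  smap (genuine_fixed (res_algebra sKG X) sHK) (genuine_fixed X sHG).
Proof.
refine (@SMap (genuine_fixed (res_algebra sKG X) sHK) (genuine_fixed X sHG)
  (fun n x => exist _ (sval x) (svalP x)) _).
by move=> m n f x; apply: sval_eq.
Defined.

Definition pi0_unres (X : algebra G) :
    pi0_fixed (res_algebra sKG X) sHK -> pi0_fixed X sHG := pi0_map (genuine_unres X).

Definition loops_unres (X : algebra G) (A : finType) (rA : action H A) (B : finType) (rB : action H B) :
  smap (loops (res_algebra sKG X) rA rB) (loops X rA rB).
Proof.
refine (@SMap (loops (res_algebra sKG X) rA rB) (loops X rA rB)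
  (fun n x => exist _ (sval x) (svalP x)) _).
by move=> m n f x; apply: sval_eq.
Defined.

Definition pi_unres (X : algebra G) (A : finType) (rA : action H A) (B : finType) (rB : action H B) :
    pi_graded (res_algebra sKG X) rA rB -> pi_graded X rA rB := pi0_map (loops_unres X rA rB).
End Restrict.
Arguments pi0_unres {gT G K} sKG {H} sHK sHG {X} _.
Arguments pi_unres {gT G K} sKG {H X A} rA {B} rB _.

Lemma bijectiveP (S T : Type) (f : S -> T) :
  injective f -> (forall y, exists x, f x = y) -> bijective f.
Proof.
move=> finj /choice[g fg]; exists g => // x.
by apply: finj; rewrite fg.
Qed.

Lemma pi0_map_bij (X Y : sset) (f : smap X Y) (g : smap Y X) :
  cancel (f 0) (g 0) -> cancel (g 0) (f 0) -> bijective (pi0_map f).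
Proof.
move=> fK gK; exists (pi0_map g) => C; have [x ->] := component_surj C.
  by rewrite !pi0_mapE fK.
by rewrite !pi0_mapE gK.
Qed.

Section Unres.
Variables (gT : finGroupType) (G K : {group gT}) (sKG : K \subset G).
Variables (H : {group gT}) (sHK : H \subset K) (sHG : H \subset G).
Variable X : algebra G.
Notation XK := (res_algebra sKG X).
Notation unres := (pi0_unres sKG sHK sHG (X := X)).

Lemma pi0_unresE (x : genuine_fixed XK sHK 0) :
  unres (component x) = component (genuine_unres sKG sHK sHG X 0 x).
Proof. exact: pi0_mapE. Qed.

Lemma pi0_unres_bij : bijective unres.
Proof.
have gP m n (s : dmap m n) (x : genuine_fixed X sHG n) :
  (exist _ (sval (op s x)) (svalP (op s x)) : genuine_fixed XK sHK m) =
  op s (exist _ (sval x) (svalP x) : genuine_fixed XK sHK n) by exact: sval_eq.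
apply: (@pi0_map_bij _ _ _ (@SMap (genuine_fixed X sHG) (genuine_fixed XK sHK)
  (fun n x => exist _ (sval x) (svalP x)) gP)) => x; exact: sval_eq.
Qed.

Lemma pi0_unres_mul a b : unres (pi0_mul a b) = pi0_mul (unres a) (unres b).
Proof.
have [x ->] := component_surj a; have [y ->] := component_surj b.
by rewrite pi0_mulE !pi0_unresE pi0_mulE; congr component; apply: sval_eq.
Qed.

Lemma pi0_unres_one : unres (pi0_one XK sHK) = pi0_one X sHG.
Proof. by rewrite /pi0_one pi0_unresE; congr component; apply: sval_eq. Qed.

Lemma pi0_unres_unit a : pi0_unit (unres a) -> pi0_unit a.
Proof.
have [g uK gK] := pi0_unres_bij => -[b [ab ba]]; exists (g b).
by split; apply: (can_inj uK); rewrite pi0_unres_mul gK pi0_unres_one.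
Qed.

Variables (A : finType) (rA : action H A) (B : finType) (rB : action H B).
Notation unres_pi := (pi_unres sKG (X := X) rA rB).

Lemma pi_unresE (x : loops XK rA rB 0) :
  unres_pi (component x) = component (loops_unres sKG X rA rB 0 x).
Proof. exact: pi0_mapE. Qed.

Lemma pi_unres_bij : bijective unres_pi.
Proof.
have gP m n (s : dmap m n) (x : loops X rA rB n) :
  (exist _ (sval (op s x)) (svalP (op s x)) : loops XK rA rB m) =
  op s (exist _ (sval x) (svalP x) : loops XK rA rB n) by exact: sval_eq.
apply: (@pi0_map_bij _ _ _ (@SMap (loops X rA rB) (loops XK rA rB)
  (fun n x => exist _ (sval x) (svalP x)) gP)) => x; exact: sval_eq.
Qed.

Lemma pi_unres_scale a (c : pi_graded XK rA rB) :
  unres_pi (pi_scale (sHG := sHK) a c) = pi_scale (unres a) (unres_pi c).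
Proof.
have [x ->] := component_surj a; have [y ->] := component_surj c.
rewrite pi_scaleE !pi_unresE pi0_unresE pi_scaleE; congr component.
by apply: sval_eq; apply: smapP.
Qed.
End Unres.
Arguments pi0_unres_bij {gT G K} sKG {H} sHK sHG X.
Arguments pi_unres_bij {gT G K} sKG {H X A} rA {B} rB.
Arguments pi_unres_scale {gT G K} sKG {H} sHK sHG {X A rA B rB} a c.

Section UnresMor.
Variables (gT : finGroupType) (G K : {group gT}) (sKG : K \subset G).
Variables (H : {group gT}) (sHK : H \subset K) (sHG : H \subset G).
Variables (X Y : algebra G) (f : mor X Y 0).

Lemma pi0_unres_ind a : pi0_unres sKG sHK sHG (pi0_ind (res_mor sKG f) sHK a) =
  pi0_ind f sHG (pi0_unres sKG sHK sHG a).
Proof.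
have [x ->] := component_surj a.
rewrite pi0_unresE /pi0_ind !pi0_mapE pi0_unresE; congr component; exact: sval_eq.
Qed.

Lemma pi0_unres_res (L : {group gT}) (sLK : L \subset K) (sLG : L \subset G) (sLH : L \subset H) a :
  pi0_unres sKG sLK sLG (pi0_res (X := res_algebra sKG X) sHK sLK sLH a) =
  pi0_res sHG sLG sLH (pi0_unres sKG sHK sHG a).
Proof.
have [x ->] := component_surj a.
by rewrite pi0_resE !pi0_unresE pi0_resE; congr component; apply: sval_eq.
Qed.

Variables (A : finType) (rA : action H A) (B : finType) (rB : action H B).

Lemma pi_unres_ind a : pi_unres sKG (X := Y) rA rB (pi_ind (res_mor sKG f) sHK rA rB a) =
  pi_ind f sHG rA rB (pi_unres sKG (X := X) rA rB a).
Proof.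
have [x ->] := component_surj a.
rewrite pi_unresE /pi_ind !pi0_mapE pi_unresE; congr component.
by apply: sval_eq; apply: smapP.
Qed.
End UnresMor.
Arguments pi0_unres_ind {gT G K} sKG {H} sHK sHG {X Y} f a.
Arguments pi0_unres_res {gT G K} sKG {H} sHK sHG {X L} sLK sLG sLH a.
Arguments pi_unres_ind {gT G K} sKG {H} sHK sHG {X Y} f {A rA B rB} a.

(** Fractions with equal images have cross-multiplied numerators that agree after a factor from
    [SP]; this factor lies in [SN] and cancels in [N], as do the denominators. A fraction in [P] has
    its denominator in [SP], so it can already be formed in [N]. *)
Lemma localisation_bijective (M N P E : Type) (SN SP : E -> Prop)
    (aM : E -> M -> M) (aN : E -> N -> N) (aP : E -> P -> P)
    (lN : M -> N) (lP : M -> P) (c : N -> P) :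
  (forall s, SP s -> SN s) ->
  (forall s t y, aN s (aN t y) = aN t (aN s y)) ->
  (forall s x, lN (aM s x) = aN s (lN x)) ->
  (forall x, c (lN x) = lP x) ->
  (forall s y, c (aN s y) = aP s (c y)) ->
  (forall s, SN s -> bijective (aN s)) ->
  (forall y, exists s x, SN s /\ aN s y = lN x) ->
  (forall s, SP s -> injective (aP s)) ->
  (forall y, exists s x, SP s /\ aP s y = lP x) ->
  (forall x x', lP x = lP x' -> exists s, SP s /\ aM s x = aM s x') ->
  bijective c.
Proof.
move=> SPN aNC lNa cl ca bN fN iP fP kP; apply: bijectiveP => [y y' cy|w].
  have [s [x [Ss e]]] := fN y; have [s' [x' [Ss' e']]] := fN y'.
  have [|t [St et]] := kP (aM s' x) (aM s x').
    by rewrite -!cl !lNa -e -e' aNC !ca cy.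
  have := congr1 lN et; rewrite !lNa => /(bij_inj (bN _ (SPN _ St))).
  by rewrite -e -e' aNC => /(bij_inj (bN _ Ss)) /(bij_inj (bN _ Ss')).
have [s [x [Ss e]]] := fP w; have [g gK Kg] := bN _ (SPN _ Ss).
by exists (g (lN x)); apply: (iP s Ss); rewrite -ca Kg cl e.
Qed.

(** * The two localisations over a subgroup *)

Section ResLocalisation.
Variables (gT : finGroupType) (G : {group gT}) (R : CAlg G) (S : subset_family R).
Arguments S : clear implicits.
Hypotheses (S_Gsubset : Gsubset S) (S_torsion : torsion_extension S).
Variables (T : CAlg G) (l : mor R T 0).
Hypothesis l_telescopic : telescopic_localisation (S G (subxx G)) l.
Variables (K : {group gT}) (sKG : K \subset G).

Lemma pi0_ResE (X : CAlg G) a :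
  pi0_Res (sKG := sKG) (X := X) a = pi0_unres sKG (subxx K) sKG (X := X) a.
Proof.
have [x ->] := component_surj a; rewrite pi0_unresE /pi0_Res pi0_mapE.
by congr component; apply: sval_eq.
Qed.

(** The torsion-extension condition enters here: through it, inverting [S] at level [G] inverts [S]
    at level [K]. *)
Lemma res_inverts : inverts (Res_subset S sKG) (res_mor sKG l : mor (Res sKG R) (Res sKG T) 0).
Proof.
move=> a; rewrite /Res_subset pi0_ResE => Sa.
apply: (@pi0_unres_unit _ _ _ sKG _ (subxx K) sKG T).
rewrite (pi0_unres_ind sKG (subxx K) sKG l).
have : inverts_family S l by rewrite -inverts_family_eq //; exact: l_telescopic.1.1.
exact.
Qed.

Variables (TK : CAlg K) (lK : mor (Res sKG R) TK 0).
Hypothesis lK_telescopic : telescopic_localisation (Res_subset S sKG) lK.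
Variable c : mor TK (Res sKG T) 0.
Hypothesis clK : homotopic_mor (mor_comp c lK) (res_mor sKG l).

Lemma comparison_stable_equivalence : stable_equivalence c.
Proof.
move=> H sHK A rA B rB; have sHG := subset_trans sHK sKG.
have [bN fN _] := lK_telescopic.2 H sHK A rA B rB.
have [bP fP kP] := l_telescopic.2 H sHG A rA B rB.
pose E := pi0_fixed (Res sKG R) (subxx K).
pose resH (s : E) : pi0_fixed (Res sKG R) sHK := pi0_res (X := Res sKG R) (subxx K) sHK sHK s.
(* The denominators for the restriction of [T], viewed at level [K]; they lie in those for [TK] by
   [S_Gsubset]. *)
pose SP (s : E) := exists t, S G (subxx G) t /\
  pi0_unres sKG (subxx K) sKG (X := R) s = pi0_res (X := R) (subxx G) sKG sKG t.
have cl x : pi_ind c sHK rA rB (pi_ind lK sHK rA rB x) = pi_ind (res_mor sKG l) sHK rA rB x.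
  by rewrite -pi_ind_comp (pi_ind_connected _ _ clK).
have cl0 x : pi0_ind c sHK (pi0_ind lK sHK x) = pi0_ind (res_mor sKG l) sHK x.
  by rewrite -pi0_ind_comp (pi0_ind_connected _ clK).
have inT : injective (pi_unres sKG (X := T) rA rB) by exact: bij_inj (pi_unres_bij sKG rA rB).
have unres_resH s t : pi0_unres sKG (subxx K) sKG (X := R) s = pi0_res (X := R) (subxx G) sKG sKG t ->
    pi0_unres sKG sHK sHG (X := R) (resH s) = pi0_res (X := R) (subxx G) sHG sHG t.
  move=> e; rewrite (pi0_unres_res sKG (subxx K) sKG sHK sHG sHK) e.
  exact: pi0_res_res.
have scaleT s t (w : pi_graded (Res sKG T) rA rB) :
    pi0_unres sKG (subxx K) sKG (X := R) s = pi0_res (X := R) (subxx G) sKG sKG t ->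
    pi_unres sKG (X := T) rA rB (pi_scale (pi0_ind (res_mor sKG l) sHK (resH s)) w) =
    pi_scale (pi0_ind l sHG (pi0_res (X := R) (subxx G) sHG sHG t)) (pi_unres sKG (X := T) rA rB w).
  move=> e; rewrite (pi_unres_scale sKG sHK sHG) (pi0_unres_ind sKG sHK sHG l) (unres_resH _ t) //.
apply: (@localisation_bijective (pi_graded (Res sKG R) rA rB) _ _ E (Res_subset S sKG) SP
  (fun s => pi_scale (resH s)) (fun s => pi_scale (pi0_ind lK sHK (resH s)))
  (fun s => pi_scale (pi0_ind (res_mor sKG l) sHK (resH s)))
  (pi_ind lK sHK rA rB) (pi_ind (res_mor sKG l) sHK rA rB)).
- move=> s [t [St e]]; rewrite /Res_subset pi0_ResE e; exact: S_Gsubset.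
- by move=> s t y; apply: pi_scaleC.
- by move=> s x; apply: pi_ind_scale.
- exact: cl.
- by move=> s y; rewrite pi_ind_scale cl0.
- exact: bN.
- exact: fN.
- move=> s [t [St e]] w w' eww; apply: inT; apply: (bij_inj (bP t St)).
  by rewrite -!(scaleT s t) // eww.
- move=> w; have [t [x [St e]]] := fP (pi_unres sKG (X := T) rA rB w).
  have [g _ gK] := pi0_unres_bij sKG (subxx K) sKG R.
  have [g' _ g'K] := pi_unres_bij sKG (X := R) rA rB.
  exists (g (pi0_res (X := R) (subxx G) sKG sKG t)), (g' x); split.
    by exists t; rewrite gK.
  apply: inT; rewrite (scaleT _ t) ?gK // (pi_unres_ind sKG sHK sHG l) g'K.
  exact: e.
- move=> x x' e.
  have [|t [St et]] := kP (pi_unres sKG (X := R) rA rB x) (pi_unres sKG (X := R) rA rB x').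
    by rewrite -!(pi_unres_ind sKG sHK sHG l) e.
  have [g _ gK] := pi0_unres_bij sKG (subxx K) sKG R.
  exists (g (pi0_res (X := R) (subxx G) sKG sKG t)); split; first by exists t; rewrite gK.
  apply: (bij_inj (pi_unres_bij sKG (X := R) rA rB)).
  by rewrite !(pi_unres_scale sKG sHK sHG) (unres_resH _ t) ?gK.
Qed.
End ResLocalisation.

(* The E_oo-ring T with the map l is the telescopic localisation of R at S_G. *)
Theorem lemma3p6 (gT : finGroupType) (G : {group gT}) (R : CAlg G)
    (S : subset_family R)
    (S_Gsubset : Gsubset S) (S_closed : mult_closed S)
    (S_torsion : torsion_extension S)
    (T : CAlg G) (l : mor R T 0)
    (l_telescopic : telescopic_localisation (S G (subxx G)) l) :
  (exists (L : CAlg G) (u : mor R L 0), is_Glocalisation S u) /\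
  (forall (L : CAlg G) (u : mor R L 0), is_Glocalisation S u ->
     (exists c : mor T L 0, homotopic_mor (mor_comp c l) u) /\
     (forall c : mor T L 0, homotopic_mor (mor_comp c l) u -> is_equivalence c)) /\
  (forall (K : {group gT}) (sKG : K \subset G)
     (TK : CAlg K) (lK : mor (Res sKG R) TK 0),
     telescopic_localisation (Res_subset S sKG) lK -> equivalent (Res sKG T) TK).
Proof.
have l_corep : is_Glocalisation S l.
  by rewrite /is_Glocalisation -inverts_family_eq //; exact: l_telescopic.1.
split; [by exists T, l|split=> [L u|K sKG TK lK lK_telescopic]].
  rewrite /is_Glocalisation -inverts_family_eq // => u_corep.
  apply: corepresents_unique l_telescopic.1 u_corep => A f g.
  exact: inverts_homotopic.
have [c clK] := corepresents_factor lK_telescopic.1 (@res_inverts _ _ _ _ S_torsion _ _ l_telescopic _ sKG).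
have [d [dc cd]] := whitehead (comparison_stable_equivalence S_Gsubset l_telescopic lK_telescopic clK).
by exists d, c.
Qed.
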